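(* Let $K$ be a field. Already for $n=3$, permutation array schemes over $K$ can behave as follows. (i) They need not be irreducible: for every positive integer $N$ there exist $d$ and a permutation array $P\subset[3]^d$ such that the permutation array scheme $X^o_P$ has at least $N$ irreducible components, of at least $N$ different dimensions. (ii) They need not be reduced: there exist $d$ and a permutation array $P\subset[3]^d$ such that $X^o_P$ is not reduced. (iii) They need not be equidimensional: there exist $d$ and a permutation array $P\subset[3]^d$ such that $X^o_P$ is not equidimensional.
   Context: $\mathcal{F}\ell_n$ is the variety over $K$ of complete flags $E_\bullet=\{0=E_0\subset E_1\subset\cdots\subset E_n=K^n\}$, $\dim E_i=i$. Let $[n]=\{1,\dots,n\}$. For $x,y\in[n]^d$ write $x\preceq y$ if $x_i\le y_i$ for all $i$; $\bigvee R$ is the coordinatewise maximum of a set $R$. A dot array is a subset $P\subset[n]^d$; $P[y]=\{x\in P:x\preceq y\}$. Put $\mathrm{rk}_jP=\#\{k\in[n]:\exists x\in P,\ x_j=k\}$. $P$ is rankable of rank $r$, written $\mathrm{rk}\,P=r$, if $\mathrm{rk}_jP=r$ for all $j$; it is totally rankable if every $P[y]$ is rankable. A position $x$ is redundant in $P$ if there is $R\subset P$ with $x=\bigvee R$, $\#R>1$, and every $y\in R$ has some coordinate $y_i=x_i$. A permutation array in $[n]^d$ is a totally rankable dot array of rank $n$ no element of which is redundant. The permutation array scheme $X^o_P$ of a permutation array $P\subset[n]^d$ is the locally closed subscheme of $\mathcal{F}\ell_n^d=\{(E^1_\bullet,\dots,E^d_\bullet)\}$ cut out scheme-theoretically by the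 conditions $\dim(E^1_{x_1}\cap\cdots\cap E^d_{x_d})=\mathrm{rk}(P[x])$ for all $x\in[n]^d$ (each condition giving the usual determinantal scheme structure: vanishing of the appropriate minors, on the open locus where the intersection dimension is not larger). *)

(* Defs.v *)
From HB Require Import structures.
From mathcomp Require Import all_boot all_order all_fingroup all_algebra.
From mathcomp Require Import mpoly.
From mathcomp Require Import boolp classical_sets.
From mathcomp Require Import topology_structure subtype_topology.

Set Implicit Arguments.
Unset Strict Implicit.
Unset Printing Implicit Defensive.

Import GRing.Theory.
Local Open Scope classical_set_scope.
Local Open Scope ring_scope.

Definition irreducible (T : topologicalType) (Z : set T) : Prop :=
  Z !=set0 /\
  forall A B : set T, closed A -> closed B ->
    Z `<=` A `|` B -> Z `<=` A \/ Z `<=` B.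

Definition irreducible_component (T : topologicalType) (Z : set T) : Prop :=
  irreducible Z /\
  forall Z' : set T, irreducible Z' -> Z `<=` Z' -> Z' = Z.

Definition irreducible_chain (T : topologicalType) (Z : set T) (m : nat) : Prop :=
  exists c : nat -> set T,
    (forall i, (i <= m)%N -> [/\ closed (c i), irreducible (c i) & c i `<=` Z]) /\
    (forall i, (i < m)%N -> c i `<` c i.+1).

(* Krull dimension of a closed subset Z: the supremum of the lengths of the
   chains above is the natural number m. *)
Definition has_dim (T : topologicalType) (Z : set T) (m : nat) : Prop :=
  irreducible_chain Z m /\ forall m', irreducible_chain Z m' -> (m' <= m)%N.

Definition equidimensional (T : topologicalType) : Prop :=
  exists m : nat, forall Z : set T, irreducible_component Z -> has_dim Z m.

(* The element k of {1, ..., n} is the ordinal of value k - 1. *)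
Definition position (n d : nat) := {ffun 'I_d -> 'I_n}.

Definition dot_array (n d : nat) := {set position n d}.

Definition lepos n d (x y : position n d) : bool :=
  [forall i, (x i <= y i)%N].

Definition below n d (P : dot_array n d) (y : position n d) : dot_array n d :=
  [set x in P | lepos x y]%SET.

Definition rk_coord n d (P : dot_array n d) (j : 'I_d) : nat :=
  #|[set k : 'I_n | [exists x in P, x j == k]]%SET|.

Definition rank_is n d (P : dot_array n d) (r : nat) : Prop :=
  forall j : 'I_d, rk_coord P j = r.

Definition totally_rankable n d (P : dot_array n d) : Prop :=
  forall y : position n d, exists r, rank_is (below P y) r.

Definition redundant n d (P : dot_array n d) (x : position n d) : Prop :=
  exists R : dot_array n d,
    [/\ R \subset P,
        forall i, x i = (\max_(y in R) (y i : nat))%N :> nat,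
        (1 < #|R|)%N
      & forall y, y \in R -> exists i, y i = x i].

Definition permutation_array n d (P : dot_array n d) : Prop :=
  [/\ totally_rankable P, rank_is P n & forall x, x \in P -> ~ redundant P x].

(* E i is a matrix whose row space is the i-dimensional member of the flag. *)
Definition is_flag (L : fieldType) (n : nat) (E : 'I_n.+1 -> 'M[L]_n) : Prop :=
  (forall i, \rank (E i) = i) /\
  (forall i j : 'I_n.+1, (i <= j)%N -> (E i <= E j)%MS).

(* The variety of d-tuples of complete flags in K^n is covered by the affine
   spaces U_w, for w a d-tuple of permutations: U_w consists of the tuples of
   flags whose j-th member is spanned step by step by the rows of a unipotent
   upper triangular matrix with columns permuted by w j. The entries above the
   diagonal of these d matrices are the coordinates on U_w. *)

Definition coord (n d : nat) :=
  {c : 'I_d * 'I_n * 'I_n | (c.1.2 < c.2)%N}.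

Definition chart (n d : nat) := 'I_d -> 'S_n.

Definition chart_mx (A : nzRingType) n d (w : chart n d)
    (u : 'I_#|{: coord n d}| -> A) (j : 'I_d) : 'M[A]_n :=
  \matrix_(i, c)
    if (insub (j, i, w j c) : option (coord n d)) is Some e
    then u (enum_rank e) else (i == w j c)%:R.

Definition has_coordinates (L : fieldType) n d (w : chart n d)
    (E : 'I_d -> 'I_n.+1 -> 'M[L]_n) (u : 'I_#|{: coord n d}| -> L) : Prop :=
  forall j i, (E j i == (pid_mx i : 'M[L]_n) *m chart_mx w u j)%MS.

Definition chart_ring (K : fieldType) (n d : nat) :=
  {mpoly K[#|{: coord n d}|]}.

(* For a tuple E of flags over an extension field L of K, the functions on U_w
   vanishing at E; empty if E is not in U_w. *)
Definition vanishing (K L : fieldType) (iota : {rmorphism K -> L}) n d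
    (E : 'I_d -> 'I_n.+1 -> 'M[L]_n) (w : chart n d) : set (chart_ring K n d) :=
  [set f | exists2 u, has_coordinates w E u & mmap iota u f = 0].

Definition represents (K L : fieldType) (iota : {rmorphism K -> L}) n d
    (E : 'I_d -> 'I_n.+1 -> 'M[L]_n)
    (p : chart n d -> set (chart_ring K n d)) : Prop :=
  (forall j, is_flag (E j)) /\ p = vanishing iota E.

(* Scheme-theoretic points of the d-fold product of the flag variety over K.
   A point is an equivalence class of field-valued points (L, E); it is recorded
   by the family of the prime ideals it defines in the coordinate rings of the
   charts U_w, with the empty set for the charts not containing it. Two
   field-valued points give the same point exactly when these families agree,
   and by passing to residue fields every prime of every chart occurs. *)
Record flag_point (K : fieldType) (n d : nat) := FlagPoint {
  prime_at : chart n d -> set (chart_ring K n d) ;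
  _ : exists (L : fieldType) (iota : {rmorphism K -> L})
        (E : 'I_d -> 'I_n.+1 -> 'M[L]_n), represents iota E prime_at
}.

Definition in_chart K n d (w : chart n d) (x : flag_point K n d) : Prop :=
  prime_at x w !=set0.

Lemma prime_at_prime K n d (w : chart n d) (x : flag_point K n d)
  (f g : chart_ring K n d) :
  prime_at x w (f * g) <-> prime_at x w f \/ prime_at x w g.
Proof.
case: x => p [L [iota [E [flE /= ->]]]]; split.
- case=> u hu /eqP; rewrite rmorphM mulf_eq0 => /orP[] /eqP e; [left|right];
  by exists u.
- by case=> -[u hu e]; exists u; rewrite // rmorphM /= e ?mul0r ?mulr0.
Qed.

Lemma prime_at_proper K n d (w : chart n d) (x : flag_point K n d) :
  ~ prime_at x w 1.
Proof.
case: x => p [L [iota [E [flE /= ->]]]] [u hu /eqP].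
by rewrite rmorph1 oner_eq0.
Qed.

(* The Zariski topology glued from those of the charts: U is open if in every
   chart it is the complement of the vanishing locus of a set of functions. *)
Definition zariski_open K n d (U : set (flag_point K n d)) : Prop :=
  forall w : chart n d, exists I : set (chart_ring K n d),
    forall x, in_chart w x -> (U x <-> ~ I `<=` prime_at x w).

Lemma zariski_openT K n d : zariski_open (@setT (flag_point K n d)).
Proof.
move=> w; exists [set 1] => x _; split => // _ /(_ 1 erefl).
exact: prime_at_proper.
Qed.

Lemma zariski_openI K n d (A B : set (flag_point K n d)) :
  zariski_open A -> zariski_open B -> zariski_open (A `&` B).
Proof.
move=> oA oB w; have [I hI] := oA w; have [J hJ] := oB w.
exists [set h | exists f g, [/\ I f, J g & h = f * g]] => x xw.
split.
- case=> /(hI x xw) nI /(hJ x xw) nJ sub.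
  have [f If nf] : exists2 f, I f & ~ prime_at x w f.
    apply: contra_notP nI => h f If; apply: contrapT => nf; apply: h.
    by exists f.
  apply: nJ => g Jg; have /prime_at_prime[//|//] : prime_at x w (f * g).
  by apply: sub; exists f, g.
- move=> nIJ; split; [apply/(hI x xw) | apply/(hJ x xw)] => sub; apply: nIJ.
  + by move=> _ [f [g [If Jg ->]]]; apply/prime_at_prime; left; apply: sub.
  + by move=> _ [f [g [If Jg ->]]]; apply/prime_at_prime; right; apply: sub.
Qed.

Lemma zariski_open_bigU K n d (S : Type) (A : S -> set (flag_point K n d)) :
  (forall s, zariski_open (A s)) -> zariski_open (\bigcup_s A s).
Proof.
move=> oA w; have /choice[I hI] := fun s => oA s w.
exists (\bigcup_s I s) => x xw; split.
- case=> s _ /(hI s x xw) nI sub; apply: nI => f If; apply: sub.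
  by exists s.
- move=> nI; apply: contra_notP nI => nA f [s _ If].
  apply: contrapT => nf; apply: nA; exists s => //.
  by apply/(hI s x xw) => sub; apply: nf; apply: sub.
Qed.

HB.instance Definition _ K n d := gen_eqMixin (flag_point K n d).
HB.instance Definition _ K n d := gen_choiceMixin (flag_point K n d).
HB.instance Definition _ K n d :=
  isOpenTopological.Build (flag_point K n d) (@zariski_openT K n d)
    (@zariski_openI K n d) (@zariski_open_bigU K n d).

(* The set of points, with the subspace topology. Flags are indexed by
   dimension, so E j (lift ord0 (x j)), of dimension (x j).+1, is E^j_(x_j). *)
Definition perm_array_scheme (K : fieldType) n d (P : dot_array n d) :
    set (flag_point K n d) :=
  [set p | exists (L : fieldType) (iota : {rmorphism K -> L})
      (E : 'I_d -> 'I_n.+1 -> 'M[L]_n),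
    represents iota E (prime_at p) /\
    forall (x : position n d) (r : nat), rank_is (below P x) r ->
      \rank (\bigcap_(j < d) E j (lift ord0 (x j)))%MS = r].
Arguments perm_array_scheme K {n d} P.

(* In a chart, with M_j the matrix of coordinates of the j-th flag, a row vector
   v lies in E^j_i iff the entries of index >= i (from 0) of v *m invmx M_j
   vanish. So E^1_(x_1) :&: ... :&: E^d_(x_d) is the kernel of the matrix formed
   by the columns of index k >= x_j (that is, k > x j) of all the invmx M_j, and
   its dimension is >= r iff the minors of size n - r + 1 of this matrix vanish.
   Such a minor is given by its rows and its columns (j, k). *)
Definition minor_equation (K : fieldType) n d (P : dot_array n d)
    (w : chart n d) : set (chart_ring K n d) :=
  [set f | exists (x : position n d) (r : nat)
      (row : 'I_(n - r).+1 -> 'I_n) (col : 'I_(n - r).+1 -> 'I_d * 'I_n),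
    [/\ rank_is (below P x) r,
        forall b, (x (col b).1 < (col b).2)%N
      & f = \det (\matrix_(a, b)
              invmx (chart_mx w (fun i => 'X_i : chart_ring K n d) (col b).1)
                (row a) (col b).2)]].
Arguments minor_equation K {n d} P w.

Definition generated_ideal (R : nzRingType) (G : set R) : set R :=
  [set f | exists s : seq (R * R),
    (forall c, c \in s -> G c.2) /\ f = \sum_(c <- s) c.1 * c.2].

(* The local ring at a point p of the scheme is A/I localized at the prime of p,
   where A is the coordinate ring of a chart containing p and I the ideal of the
   equations; f in A becomes 0 there iff s * f is in I for some s outside the
   prime. *)
Definition zero_germ (K : fieldType) n d (P : dot_array n d)
    (p : flag_point K n d) (w : chart n d) (f : chart_ring K n d) : Prop :=
  exists2 s, ~ prime_at p w s &
    generated_ideal (minor_equation K P w) (s * f).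

(* All local rings have no nonzero nilpotents; an element f/s of the local ring
   is nilpotent (resp. zero) iff f is. *)
Definition perm_array_scheme_reduced (K : fieldType) n d (P : dot_array n d) :
    Prop :=
  forall p : flag_point K n d, perm_array_scheme K P p ->
  forall w : chart n d, in_chart w p ->
  forall (f : chart_ring K n d) (m : nat),
    zero_germ P p w (f ^+ m) -> zero_germ P p w f.
Arguments perm_array_scheme_reduced K {n d} P.

(* Main.v *)
Require Import Defs.
From HB Require Import structures.
From mathcomp Require Import all_boot all_fingroup all_algebra.
From mathcomp Require Import ring.
From mathcomp Require Import mpoly ring_quotient.
From mathcomp Require Import boolp classical_sets functions.
From mathcomp Require Import topology_structure initial_topology subtype_topology.

Set Implicit Arguments.
Unset Strict Implicit.
Unset Printing Implicit Defensive.

Import GRing.Theory.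
Local Open Scope ring_scope.

(** In K^3 a complete flag is a point on a line of the projective plane. Let the
    lines l_k of d flags be distinct, and let the point of the k-th flag be the
    intersection of l_k with another line l_(mu k). Then all intersection
    dimensions are determined by the set of concurrent triples of lines, and a
    permutation array prescribes exactly this set (pattern_permutation_array,
    perm_array_schemeP). So the theorem is about spaces of line arrangements
    with prescribed concurrent triples, and such spaces can be made to imitate
    systems of equations.

    The arrangements used are webs: the line at infinity, verticals x = a, and
    triangles whose vertices lie on given verticals and whose sides have given
    slopes. A triangle closes exactly when the affine ratio of its three slopes
    is that of its three verticals. With the verticals 0, 1, u, p, three
    triangles force their ratios to be u, p and p / u, which expresses products
    of ratios. No unwanted triple is concurrent in a generic web, because each
    triangle can be translated by itself (model_realizes), and every arrangement
    with these concurrent triples is a web up to a projective transformation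
    (web_extraction). In this way one may impose on variable ratios any number
    of relations
      lam * x = mu * y  and  (1 - lam) * (1 - x) = (1 - mu) * (1 - y),
    which over a field say that {lam, x} = {mu, y}; the equalities of ratios that
    follow are not visible in the set of concurrent triples
    (ratio_line_realizes, ratio_extraction).

    Many components. Take ratios mu, lam_j, x_jl and y_jl with the relations
    {lam_j, x_jl} = {mu, y_jl}. For every j either x_jl = mu and y_jl = lam_j
    for all l, with lam_j free, or lam_j = mu and x_jl = y_jl are free. The set
    S of those j in the first case indexes the irreducible components
    (star_cover, star_component). The dimension of a component is at most the
    number of its free parameters (dimension_le), by a count of monomials, and
    at least this number minus 10 (star_dim_ge): with the frame fixed, the
    parameters other than one can be specialized one at a time to powers of the
    remaining one, which is possible over every field. As there are 12
    indices l, enlarging S lowers the dimension (many_components), and a scheme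
    with two components of different dimensions is not equidimensional.

    Nilpotents. Take ratios lam, mu, y with the relation {lam, lam} = {mu, y}.
    Eliminating y leaves (lam - mu)^2 = 0. On all field-valued points lam = mu,
    so a function measuring lam - mu is nilpotent in the local ring at the
    generic such point (double_function_nilpotent). It is not zero there, since
    lam, mu = lam + epsilon, y = lam - epsilon is a solution in dual numbers and
    all the minors that define the scheme vanish on it (conc_minors,
    double_function_nonzero). *)

(** * Vectors in three-space *)

Definition i0 : 'I_3 := @Ordinal 3 0 isT.
Definition i1 : 'I_3 := @Ordinal 3 1 isT.
Definition i2 : 'I_3 := @Ordinal 3 2 isT.

Lemma ord3P (P : 'I_3 -> Prop) : P i0 -> P i1 -> P i2 -> forall i, P i.
Proof.
by move=> h0 h1 h2 [[|[|[|//]]] hi]; [move: h0|move: h1|move: h2];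
  congr P; apply: val_inj.
Qed.

Lemma sum3 (V : nmodType) (F : 'I_3 -> V) :
  \sum_i F i = F i0 + F i1 + F i2.
Proof.
rewrite !big_ord_recr big_ord0 /= add0r.
by congr (F _ + F _ + F _); apply: val_inj.
Qed.

Definition vec3 (R : Type) (x y z : R) : 'rV[R]_3 :=
  \row_(i < 3) (if val i is k.+1 then if k is _.+1 then z else y else x).

Lemma vec3_0 (R : Type) (x y z : R) j : vec3 x y z j i0 = x.
Proof. by rewrite mxE. Qed.
Lemma vec3_1 (R : Type) (x y z : R) j : vec3 x y z j i1 = y.
Proof. by rewrite mxE. Qed.
Lemma vec3_2 (R : Type) (x y z : R) j : vec3 x y z j i2 = z.
Proof. by rewrite mxE. Qed.
Definition vec3E := (vec3_0, vec3_1, vec3_2).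

Lemma row3P (R : Type) (u v : 'rV[R]_3) :
  u 0 i0 = v 0 i0 -> u 0 i1 = v 0 i1 -> u 0 i2 = v 0 i2 -> u = v.
Proof.
by move=> h0 h1 h2; apply/rowP; apply: ord3P.
Qed.

Section ComVectors.
Variable R : comNzRingType.
Implicit Types (u v w q : 'rV[R]_3) (g : 'M[R]_3) (c : R).

Definition dot u v : R :=
  u 0 i0 * v 0 i0 + u 0 i1 * v 0 i1 + u 0 i2 * v 0 i2.

Definition cross u v : 'rV[R]_3 :=
  vec3 (u 0 i1 * v 0 i2 - u 0 i2 * v 0 i1)
       (u 0 i2 * v 0 i0 - u 0 i0 * v 0 i2)
       (u 0 i0 * v 0 i1 - u 0 i1 * v 0 i0).

(** The determinant of the matrix with rows u, v, w; it vanishes when the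
    three lines with these coordinates are concurrent. *)
Definition br u v w : R := dot (cross u v) w.

Lemma dotE u v : (u *m v^T) = (dot u v)%:M.
Proof.
by apply/matrixP => i j; rewrite !ord1 !mxE sum3 !mxE eqxx mulr1n.
Qed.

Lemma br_mxE (A : 'M[R]_3) :
  \det A = br (row i0 A) (row i1 A) (row i2 A).
Proof.
have det2 (B : 'M[R]_2) : \det B = B 0 0 * B 1 1 - B 0 1 * B 1 0.
  rewrite (expand_det_row _ 0) !big_ord_recl big_ord0 /cofactor !det_mx11 !mxE.
  have -> : lift 0 0 = 1 :> 'I_2 by apply: val_inj.
  have -> : lift 1 0 = 0 :> 'I_2 by apply: val_inj.
  by rewrite /=; ring.
have E : ((lift i0 0 = i1 :> 'I_3) * (lift i0 1 = i2 :> 'I_3)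
  * (lift i1 0 = i0 :> 'I_3) * (lift i1 1 = i2 :> 'I_3)
  * (lift i2 0 = i0 :> 'I_3) * (lift i2 1 = i1 :> 'I_3))%type.
  by do !split; apply: val_inj.
rewrite (expand_det_row _ i0) sum3 /cofactor !det2 !mxE !E.
rewrite /br /dot /cross !vec3E !mxE /=.
ring.
Qed.

Lemma br_swap12 u v w : br v u w = - br u v w.
Proof. by rewrite /br /dot /cross !vec3E; ring. Qed.

Lemma br_swap23 u v w : br u w v = - br u v w.
Proof. by rewrite /br /dot /cross !vec3E; ring. Qed.

Lemma br_same u v : br u u v = 0.
Proof. by rewrite /br /dot /cross !vec3E; ring. Qed.

Lemma br_mulmx u v w g : br (u *m g) (v *m g) (w *m g) = br u v w * \det g.
Proof.
rewrite br_mxE /br /dot /cross !vec3E !mxE !sum3.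
ring.
Qed.

Lemma br_scale a b c u v w :
  br (a *: u) (b *: v) (c *: w) = a * b * c * br u v w.
Proof. by rewrite /br /dot /cross !vec3E !mxE; ring. Qed.

Lemma crossZ a b u v : cross (a *: u) (b *: v) = (a * b) *: cross u v.
Proof. by apply: row3P; rewrite !mxE /=; ring. Qed.

Lemma dot_crossl u v : dot (cross u v) u = 0.
Proof. by rewrite /dot /cross !vec3E; ring. Qed.

Lemma dot_crossr u v : dot (cross u v) v = 0.
Proof. by rewrite /dot /cross !vec3E; ring. Qed.

(** The adjugate identity: a common zero of three lines is killed, coordinate
    by coordinate, by their determinant. *)
Lemma br_common_zero q u v w i :
  dot q u = 0 -> dot q v = 0 -> dot q w = 0 -> q 0 i * br u v w = 0.
Proof.
move=> hu hv hw.
have -> : q 0 i * br u v w = dot q u * cross v w 0 i + dot q v * cross w u 0 i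
   + dot q w * cross u v 0 i.
  by move: i; apply: ord3P; rewrite /br /dot /cross !vec3E; ring.
by rewrite hu hv hw !mul0r !addr0.
Qed.

Lemma br_zero q u v w i : q 0 i = 1 ->
  dot q u = 0 -> dot q v = 0 -> dot q w = 0 -> br u v w = 0.
Proof.
by move=> qi hu hv hw; have := br_common_zero i hu hv hw; rewrite qi mul1r.
Qed.

(** The cross product of q with u x v is (q.v) u - (q.u) v, which vanishes. *)
Lemma cross_parallel u v q i j : dot q u = 0 -> dot q v = 0 ->
  q 0 j * cross u v 0 i = q 0 i * cross u v 0 j.
Proof.
move=> hu hv.
have : forall k, cross q (cross u v) 0 k = 0.
  have -> : cross q (cross u v) = dot q v *: u - dot q u *: v.
    by apply: row3P; rewrite /dot !mxE /=; ring.
  by move=> k; rewrite hu hv !scale0r subr0 mxE.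
move=> hk; have := (hk i0, hk i1, hk i2); rewrite /cross !vec3E.
move=> [[/subr0_eq e0 /subr0_eq e1] /subr0_eq e2].
move: (j) (i); apply: ord3P; apply: ord3P; rewrite /cross !vec3E //.
Qed.

(** Cramer's rule in the basis u, v, w. *)
Lemma cramer u v w x :
  br u v w *: x = br x v w *: u + br u x w *: v + br u v x *: w.
Proof.
by apply: row3P; rewrite /br /dot !mxE /=; ring.
Qed.

End ComVectors.

Section MapVectors.
Variables (R S : comNzRingType) (f : {rmorphism R -> S}).

Lemma map_dot u v : f (dot u v) = dot (map_mx f u) (map_mx f v).
Proof. by rewrite /dot !rmorphD !rmorphM /= !mxE. Qed.

Lemma map_cross u v : map_mx f (cross u v) = cross (map_mx f u) (map_mx f v).
Proof.
by apply: row3P; rewrite !mxE /= rmorphB !rmorphM.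
Qed.

Lemma map_br u v w :
  f (br u v w) = br (map_mx f u) (map_mx f v) (map_mx f w).
Proof. by rewrite /br map_dot map_cross. Qed.

End MapVectors.

Section FieldVectors.
Variable F : fieldType.
Implicit Types (u v w q : 'rV[F]_3).

Lemma row3_neq0 u : u != 0 -> exists i, u 0 i != 0.
Proof.
move=> u0; apply/existsP; apply: contraNT u0 => /existsPn h.
by apply/eqP/rowP => i; have := h i; rewrite negbK mxE => /eqP.
Qed.

Lemma br_neq0_cross u v w : br u v w != 0 -> cross u v != 0.
Proof.
apply: contraNneq => h; rewrite /br h /dot !mxE; apply/eqP; ring.
Qed.

Lemma cross_span u v q : cross u v != 0 -> dot q u = 0 -> dot q v = 0 ->
  exists c, q = c *: cross u v.
Proof.
move=> h; have [i hi] := row3_neq0 h => hu hv.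
exists (q 0 i / cross u v 0 i).
have key j := cross_parallel i j hu hv.
apply/rowP => j; rewrite mxE mulrAC -key mulfK //.
Qed.

End FieldVectors.

(** * The permutation array of a concurrency pattern *)

(** The concurrency relation of d pairwise distinct lines of a projective
    plane that do not all pass through one point; the mark mu chooses on every
    line k the point where it meets the line mu k. *)
Record pencils d (conc : 'I_d -> 'I_d -> 'I_d -> bool) (mu : 'I_d -> 'I_d) :
    Prop := Pencils {
  conc_id : forall i k, conc i i k;
  concC : forall i j k, conc j i k = conc i j k;
  concA : forall i j k, conc i k j = conc i j k;
  conc_trans : forall a b i j k, a != b -> i != j ->
    conc a b i -> conc a b j -> conc i j k = conc a b k;
  conc_rank : forall i j, i != j -> exists k, ~~ conc i j k;
  mark_neq : forall k, mu k != k
}.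

Section PatternArray.
Variables (d : nat) (conc : 'I_d -> 'I_d -> 'I_d -> bool) (mu : 'I_d -> 'I_d).

(** The position of the common point of the lines a and b: its coordinate at
    the flag k is the index of the first member of that flag containing it. *)
Definition pos (a b : 'I_d) : position 3 d :=
  [ffun k => if conc a b k then if conc a b (mu k) then i0 else i1 else i2].

Definition pattern_array : dot_array 3 d :=
  [set y | [exists a, exists b, (a != b) && (y == pos a b)]]%SET.

(** The lines whose intersection is the intersection of the flag members
    selected by x. *)
Definition line_set (x : position 3 d) : {set 'I_d} :=
  [set j | (x j < 2)%N || [exists k, (mu k == j) && (x k == 0 :> nat)]]%SET.

(** The dimension of the intersection of the planes of K^3 given by the lines
    in J: the whole space, one plane, and then a line or 0 according as the
    lines of J are concurrent or not. *)
Definition lines_rank (J : {set 'I_d}) : nat :=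
  if J == finset.set0 then 3%N else if #|J| == 1%N then 2%N else
  [exists i in J, exists j in J, (i != j) && [forall k in J, conc i j k]].

Hypothesis Hc : pencils conc mu.

Lemma conc12 i k : conc i k i. Proof. by rewrite (concA Hc) (conc_id Hc). Qed.
Lemma conc22 i k : conc i k k. Proof. by rewrite (concC Hc) conc12. Qed.

(** A point lies below x exactly when it lies on all the lines that x selects. *)
Lemma pos_leP a b x :
  reflect (forall j, j \in line_set x -> conc a b j) (lepos (pos a b) x).
Proof.
apply: (iffP forallP) => [h j|h k].
  rewrite inE => /orP[xj|/existsP[k /andP[/eqP <- /eqP xk]]].
    have := h j; rewrite ffunE; case: ifP => // _ /= xj2.
    by move: xj2; rewrite leqNgt xj.
  by have := h k; rewrite ffunE xk; case: ifP => // _; case: ifP.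
have [x2|xk] := leqP 2 (x k).
  by rewrite ffunE (leq_trans _ x2) //; case: ifP => // _; case: ifP.
have ck : conc a b k by apply: h; rewrite inE xk.
rewrite ffunE ck; case: ifP => // cm; move: cm.
case: posnP => [x0|//]; rewrite h // inE; apply/orP; right.
by apply/existsP; exists k; rewrite eqxx x0.
Qed.

Lemma below_patternP x y : reflect
  (exists a b, [/\ a != b, y = pos a b & forall j, j \in line_set x -> conc a b j])
  (y \in below pattern_array x).
Proof.
rewrite !inE; apply: (iffP andP) => [[/existsP[a /existsP[b]]]|[a [b [ab -> h]]]].
  by case/andP=> ab /eqP -> /pos_leP h; exists a, b.
split; last exact/pos_leP.
by apply/existsP; exists a; apply/existsP; exists b; rewrite ab eqxx.
Qed.

Lemma pos_same a b i j : a != b -> i != j -> conc a b i -> conc a b j ->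
  pos a b = pos i j.
Proof.
move=> ab ij ci cj; apply/ffunP => k; rewrite !ffunE.
by rewrite !(conc_trans Hc _ ab ij ci cj).
Qed.

Lemma pos_mark j : pos j (mu j) j = i0.
Proof. by rewrite ffunE conc12 conc22. Qed.

Lemma rk_coordE x j (S : {set 'I_3}) :
  (forall a b, a != b -> (forall k, k \in line_set x -> conc a b k) ->
     pos a b j \in S) ->
  (forall k, k \in S -> exists a b, [/\ a != b,
     forall k, k \in line_set x -> conc a b k & pos a b j = k]) ->
  rk_coord (below pattern_array x) j = #|S|.
Proof.
move=> h1 h2; apply: eq_card => k; rewrite inE; apply/existsP/idP.
  by case=> y /andP[/below_patternP[a [b [ab -> h]]] /eqP <-]; apply: h1.
case/h2 => a [b [ab h <-]]; exists (pos a b); rewrite eqxx andbT.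
by apply/below_patternP; exists a, b.
Qed.

Lemma lines_rank0 J : J = finset.set0 -> lines_rank J = 3%N.
Proof. by move->; rewrite /lines_rank eqxx. Qed.

Lemma lines_rank1 i : lines_rank [set i]%SET = 2%N.
Proof.
rewrite /lines_rank cards1 eqxx; case: eqP => // /setP/(_ i).
by rewrite !inE eqxx.
Qed.

Lemma lines_rank2 (J : {set 'I_d}) i j : i \in J -> j \in J -> i != j ->
  lines_rank J = [forall k in J, conc i j k] :> nat.
Proof.
move=> iJ jJ ij; rewrite /lines_rank.
case: eqP => [J0|_]; first by move: iJ; rewrite J0 inE.
case: eqP => [/eqP/cards1P[z Jz]|_].
  by move: iJ jJ ij; rewrite Jz !inE => /eqP-> /eqP->; rewrite eqxx.
congr (nat_of_bool _); apply/existsP/forall_inP.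
  case=> a /andP[aJ /existsP[b /andP[bJ /andP[ab /forall_inP h]]]] k kJ.
  by rewrite (conc_trans Hc _ ab ij) ?h.
move=> h; exists i; rewrite iJ; apply/existsP; exists j; rewrite jJ ij /=.
exact/forall_inP.
Qed.

(** The points below x are the intersection points that lie on all the lines
    of J: all of them, those of one line, a single one, or none. In each case
    a flag coordinate takes on them as many values as the dimension of the
    intersection; on a line of J, another flag only tells its own meeting
    point from the rest. *)
Lemma rank_below x : rank_is (below pattern_array x) (lines_rank (line_set x)).
Proof.
move=> j; set J := line_set x.
case: (set_0Vmem J) => [J0|[i iJ]].
  rewrite (lines_rank0 J0); transitivity #|[set: 'I_3]%SET|; last first.
    by rewrite cardsT card_ord.
  apply: rk_coordE => [*|k _]; first by rewrite inE.
  have [c nc] := conc_rank Hc (mark_neq Hc j).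
  have jc : j != c by apply: contraNneq nc => <-; rewrite conc22.
  have mc : mu j != c by apply: contraNneq nc => <-; rewrite conc12.
  move: k; apply: ord3P.
  - exists j, (mu j); rewrite eq_sym (mark_neq Hc) pos_mark; split=> // k.
    by rewrite -/J J0 inE.
  - exists j, c; split=> // [k|]; first by rewrite -/J J0 inE.
    rewrite ffunE conc12 (concA Hc) (concC Hc).
    by rewrite (negbTE nc).
  - exists (mu j), c; split=> // [k|]; first by rewrite -/J J0 inE.
    by rewrite ffunE (concA Hc) (negbTE nc).
have [[j' /andP[j'J ij']]|hJ] :=
    altP (existsP : reflect _ [exists k, (k \in J) && (i != k)]).
  rewrite (lines_rank2 iJ j'J ij').
  case: (boolP [forall k in J, conc i j' k]) => [/forall_inP h|nh] /=.
    transitivity #|[set pos i j' j]%SET|; last by rewrite cards1.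
    apply: rk_coordE => [a b ab hab|k].
      by rewrite inE (pos_same ab ij') ?hab.
    by rewrite inE => /eqP ->; exists i, j'.
  transitivity #|@finset.set0 'I_3|; last by rewrite cards0.
  apply: rk_coordE => [a b ab hab|k]; last by rewrite inE.
  case/negP: nh; apply/forall_inP => k kJ.
  by rewrite (conc_trans Hc _ ab ij') ?hab.
have JE : J = [set i]%SET.
  apply/setP => k; rewrite inE; apply/idP/eqP => [kJ|-> //].
  move/existsPn: hJ => /(_ k); rewrite kJ /= negbK => /eqP ->; done.
rewrite JE lines_rank1.
have [c nc] := conc_rank Hc (mark_neq Hc i).
have ic : i != c by apply: contraNneq nc => <-; rewrite conc22.
have [<-|ij] := eqVneq i j.
  transitivity #|[set i0; i1]%SET|; last by rewrite cards2.
  apply: rk_coordE => [a b ab hab|k].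
    by rewrite ffunE hab -/J ?JE ?inE //; case: ifP.
  rewrite !inE => /orP[] /eqP ->.
    exists i, (mu i); rewrite eq_sym (mark_neq Hc) pos_mark; split=> // k'.
    by rewrite -/J JE inE => /eqP ->; rewrite conc12.
  exists i, c; split=> // [k'|].
    by rewrite -/J JE inE => /eqP ->; rewrite conc12.
  by rewrite ffunE conc12 (concA Hc) (concC Hc) (negbTE nc).
have [e ne] := conc_rank Hc ij.
have ie : i != e by apply: contraNneq ne => <-; rewrite conc12.
have p2 : pos i j j != i2 by rewrite ffunE conc22; case: ifP.
transitivity #|[set pos i j j; i2]%SET|; last by rewrite cards2 p2.
apply: rk_coordE => [a b ab hab|k].
  have ci : conc a b i by apply: hab; rewrite -/J JE inE.
  rewrite !inE; case: (boolP (conc a b j)) => cj.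
    by rewrite (pos_same ab ij) ?eqxx.
  by rewrite orbC ffunE (negbTE cj).
rewrite !inE => /orP[] /eqP ->.
  exists i, j; split=> // k'; rewrite -/J JE inE => /eqP ->; exact: conc12.
exists i, e; split=> // [k'|].
  rewrite -/J JE inE => /eqP ->; exact: conc12.
by rewrite ffunE (concA Hc) (negbTE ne).
Qed.

(** No position is redundant because the positions form an antichain: a point
    lying on two lines through another point is equal to it. *)
Lemma pattern_permutation_array : permutation_array pattern_array.
Proof.
split; first by move=> y; exists (lines_rank (line_set y)); apply: rank_below.
  pose top : position 3 d := [ffun=> i2].
  have b : below pattern_array top = pattern_array.
    apply/setP => y; rewrite !inE; case: [exists a, _] => //=.
    by apply/forallP => k; rewrite ffunE -ltnS.
  have J0 : line_set top = finset.set0.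
    apply/setP => j; rewrite !inE ffunE /=; apply/existsP => -[k].
    by rewrite ffunE andbF.
  by move=> j; have := rank_below top j; rewrite b (lines_rank0 J0).
move=> x; rewrite inE => /existsP[a /existsP[b /andP[ab /eqP xE]]].
case=> R [sub hmax cR hR].
have R1 y : y \in R -> y = x.
  move=> yR; have := fintype.subsetP sub _ yR; rewrite inE => /existsP[a' /existsP[b']].
  case/andP=> ab' /eqP yE.
  have ley k : (y k <= x k)%N by rewrite hmax (leq_bigmax_cond _ yR).
  have on k : conc a b k -> conc a' b' k.
    move=> ck; have := ley k; rewrite xE yE !ffunE ck.
    by case: (conc a' b' k) => //; case: ifP.
  rewrite yE xE; apply: pos_same => //; apply: on; [exact: conc12|exact: conc22].
have : (#|R| <= #|[set x]%SET|)%N.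
  by apply: subset_leq_card; apply/fintype.subsetP => y /R1 ->; rewrite inE.
by rewrite cards1 leqNgt cR.
Qed.

End PatternArray.

(** * Flags in three-space as point-line pairs, and their chart coordinates *)

Section ChartVectors.
Variables (A : comNzRingType) (d : nat).
Implicit Types (u : 'I_#|{: Defs.coord 3 d}| -> A) (j : 'I_d).

(** The entry (i, k) of the unipotent matrix of the j-th flag, before its
    columns are permuted. *)
Definition entry u j (i k : 'I_3) : A :=
  if (insub (j, i, k) : option (Defs.coord 3 d)) is Some e then u (enum_rank e)
  else (i == k)%:R.

Lemma entry_low u j (i k : 'I_3) : (k <= i)%N -> entry u j i k = (i == k)%:R.
Proof. by move=> ki; rewrite /entry insubF //= ltnNge ki. Qed.

Lemma chart_mxE w u j i c : chart_mx w u j i c = entry u j i (w j c).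
Proof. by rewrite mxE /entry; case: insubP. Qed.

(** The point of the j-th flag with chart coordinates u. *)
Definition cpt (w : chart 3 d) u j : 'rV[A]_3 := row i0 (chart_mx w u j).

(** The line of the j-th flag with chart coordinates u: the last column of the
    inverse of the chart matrix, as row_chart_cln shows. *)
Definition cln (w : chart 3 d) u j : 'rV[A]_3 :=
  \row_c (if w j c == i0 then entry u j i0 i1 * entry u j i1 i2 - entry u j i0 i2
          else if w j c == i1 then - entry u j i1 i2 else 1).

Lemma dot_sum (v v' : 'rV[A]_3) : dot v v' = \sum_i v 0 i * v' 0 i.
Proof. by rewrite sum3. Qed.

Lemma dot_perm (s : 'S_3) (f g : 'I_3 -> A) :
  dot (\row_c f (s c)) (\row_c g (s c)) = f i0 * g i0 + f i1 * g i1 + f i2 * g i2.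
Proof.
rewrite dot_sum -(sum3 (fun k => f k * g k)) [RHS](reindex_inj (@perm_inj _ s)).
by apply: eq_bigr => c _; rewrite !mxE.
Qed.

Lemma row_chart_cln w u j i :
  dot (row i (chart_mx w u j)) (cln w u j) = (i == i2)%:R.
Proof.
have -> : row i (chart_mx w u j) = \row_c entry u j i (w j c).
  by apply/rowP => c; rewrite mxE chart_mxE mxE.
rewrite (@dot_perm (w j) (entry u j i) (fun k => if k == i0 then _ else if k == i1 then _ else _)).
move: i; apply: ord3P => /=.
- by rewrite (@entry_low _ _ i0 i0) //= ; ring.
- by rewrite (@entry_low _ _ i1 i0) // (@entry_low _ _ i1 i1) //=; ring.
- by rewrite !(@entry_low _ _ i2) //=; ring.
Qed.

Lemma dot_cpt_cln w u j : dot (cpt w u j) (cln w u j) = 0.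
Proof. exact: row_chart_cln. Qed.

Lemma cpt0 w u j : cpt w u j 0 ((w j)^-1 i0)%g = 1.
Proof. by rewrite !mxE -/(entry _ _ _ _) permKV entry_low. Qed.

Lemma cptS w u j k : cpt w u j 0 ((w j)^-1 k)%g = entry u j i0 k.
Proof. by rewrite mxE chart_mxE permKV. Qed.

Lemma cln2 w u j : cln w u j 0 ((w j)^-1 i2)%g = 1.
Proof. by rewrite mxE permKV. Qed.

Lemma cln1 w u j : cln w u j 0 ((w j)^-1 i1)%g = - entry u j i1 i2.
Proof. by rewrite mxE permKV. Qed.

End ChartVectors.

Lemma chart_mx_unit (A : comUnitRingType) d (w : chart 3 d)
  (u : 'I_#|{: Defs.coord 3 d}| -> A) j : chart_mx w u j \in unitmx.
Proof.
pose U : 'M[A]_3 := \matrix_(i, k) entry u j i k.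
have -> : chart_mx w u j = U *m perm_mx (w j)^-1.
  rewrite -col_permE; apply/matrixP => i c.
  by rewrite chart_mxE !mxE.
rewrite unitmx_mul unitmx_perm andbT unitmxE -det_tr det_trig; last first.
  by apply/is_trig_mxP => i k ik; rewrite !mxE entry_low ?(ltnW ik) // -val_eqE /= gtn_eqF.
by rewrite big1 ?unitr1 // => i _; rewrite !mxE entry_low // eqxx.
Qed.

Lemma chart_mx_map (A B : comNzRingType) (f : {rmorphism A -> B}) d (w : chart 3 d)
  (u : 'I_#|{: Defs.coord 3 d}| -> A) j :
  map_mx f (chart_mx w u j) = chart_mx w (f \o u) j.
Proof.
apply/matrixP => i c; rewrite mxE !chart_mxE /entry.
by case: insub => //=; rewrite rmorph_nat.
Qed.

Lemma entry_map (A B : comNzRingType) (f : {rmorphism A -> B}) d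
  (u : 'I_#|{: Defs.coord 3 d}| -> A) j i k :
  f (entry u j i k) = entry (f \o u) j i k.
Proof. by rewrite /entry; case: insub => //=; rewrite rmorph_nat. Qed.

Lemma cpt_map (A B : comNzRingType) (f : {rmorphism A -> B}) d (w : chart 3 d)
  (u : 'I_#|{: Defs.coord 3 d}| -> A) j :
  map_mx f (cpt w u j) = cpt w (f \o u) j.
Proof. by rewrite /cpt map_row chart_mx_map. Qed.

Lemma cln_map (A B : comNzRingType) (f : {rmorphism A -> B}) d (w : chart 3 d)
  (u : 'I_#|{: Defs.coord 3 d}| -> A) j :
  map_mx f (cln w u j) = cln w (f \o u) j.
Proof.
apply/rowP => c; rewrite !mxE -!entry_map.
by case: ifP => _; [|case: ifP => _]; rewrite ?rmorphB ?rmorphM ?rmorphN ?rmorph1.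
Qed.

Section Adapted.
Variable L : fieldType.
Implicit Types (p l : 'rV[L]_3) (E : 'I_4 -> 'M[L]_3).

Definition e1 : 'I_4 := lift ord0 i0.
Definition e2 : 'I_4 := lift ord0 i1.
Definition e3 : 'I_4 := lift ord0 i2.

Lemma ord4P (P : 'I_4 -> Prop) : P ord0 -> P e1 -> P e2 -> P e3 -> forall i, P i.
Proof.
by move=> h0 h1 h2 h3 [[|[|[|[|//]]]] hi]; [move: h0|move: h1|move: h2|move: h3];
  congr P; apply: val_inj.
Qed.

Definition flag_pair p l := [&& p != 0, l != 0 & dot p l == 0].

(** The flag E consists of the point p and the line of equation l. *)
Definition adapted E p l :=
  [/\ flag_pair p l, (E e1 == p)%MS & (E e2 == kermx l^T)%MS].

Definition pair_flag p l (i : 'I_4) : 'M[L]_3 :=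
  match val i with 0 => 0 | 1 => <<p>>%MS | 2 => kermx l^T | _ => 1%:M end.

Lemma sub_ker v l : (v <= kermx l^T)%MS = (dot v l == 0).
Proof.
apply/sub_kermxP/eqP => [h|h]; last by rewrite dotE h raddf0.
by have := congr1 (fun M : 'M_1 => M 0 0) h; rewrite dotE !mxE eqxx.
Qed.

Lemma rank_ker l : l != 0 -> \rank (kermx l^T) = 2%N.
Proof. by move=> l0; rewrite mxrank_ker mxrank_tr rank_rV l0. Qed.

Lemma pair_flagP p l : flag_pair p l -> is_flag (pair_flag p l).
Proof.
case/and3P=> p0 l0 /eqP pl; split.
  apply: ord4P; rewrite /pair_flag /=.
  - exact: mxrank0.
  - by rewrite mxrank_gen rank_rV p0.
  - exact: rank_ker.
  - exact: mxrank1.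
apply: ord4P; apply: ord4P => //= _; rewrite /pair_flag /= ?sub0mx ?submx1 //.
by rewrite genmxE sub_ker pl.
Qed.

Lemma pair_flag_adapted p l : flag_pair p l -> adapted (pair_flag p l) p l.
Proof.
by move=> pl; split=> //; rewrite /pair_flag /= ?genmxE ?submx_refl.
Qed.

Lemma flag_adapted E : is_flag E -> exists p l, adapted E p l.
Proof.
case=> rk sub.
have [p [p0 hp]] : exists p, p != 0 /\ (E e1 == p)%MS.
  have : E e1 != 0 by rewrite -mxrank_eq0 (rk e1).
  case/rowV0Pn=> p hp p0; exists p; split=> //.
  apply/eqmxP/eqmx_sym/eqmxP.
  by have := mxrank_leqif_eq hp; case=> _ <-; rewrite (rk e1) rank_rV p0.
have [l [l0 hl]] : exists l, l != 0 /\ (E e2 == kermx l^T)%MS.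
  have : kermx (E e2)^T != 0.
    by rewrite -mxrank_eq0 mxrank_ker mxrank_tr (rk e2).
  case/rowV0Pn=> l /sub_kermxP hl l0; exists l; split=> //.
  have h : (E e2 <= kermx l^T)%MS; last first.
    by have [_ <-] := mxrank_leqif_eq h; rewrite rank_ker ?(rk e2).
  by apply/sub_kermxP; rewrite -[LHS]trmxK trmx_mul trmxK hl trmx0.
exists p, l; split=> //; apply/and3P; split=> //.
rewrite -sub_ker -(eqmxP hp) -(eqmxP hl); exact: sub.
Qed.

Lemma rank1_prop p p' : p != 0 -> p' != 0 -> (p' <= p)%MS ->
  exists2 a, a != 0 & p' = a *: p.
Proof.
move=> p0 p'0 /sub_rVP[a e]; exists a => //.
by apply: contraNneq p'0 => a0; rewrite e a0 scale0r.
Qed.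

Lemma adapted_unique E p l p' l' : adapted E p l -> adapted E p' l' ->
  (exists2 a, a != 0 & p = a *: p') /\ (exists2 b, b != 0 & l = b *: l').
Proof.
case=> /and3P[p0 l0 _] hp hl [/and3P[p0' l0' _] hp' hl'].
split.
  apply: rank1_prop => //; rewrite -(eqmxP hp) (eqmxP hp'); exact: submx_refl.
apply: rank1_prop => //.
have h : (kermx l'^T <= kermx l^T)%MS by rewrite -(eqmxP hl') (eqmxP hl) submx_refl.
have [c hc] := row3_neq0 l0'.
pose v i j : 'rV[L]_3 := l' 0 i *: delta_mx 0 j - l' 0 j *: delta_mx 0 i.
have dv i j (m : 'rV[L]_3) : dot (v i j) m = l' 0 i * m 0 j - l' 0 j * m 0 i.
  have e k (a : 'rV[L]_3) : dot (delta_mx 0 k) a = a 0 k.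
    rewrite dot_sum (bigD1 k) //= big1 => [|k' /negbTE kk]; rewrite !mxE ?eqxx.
      by rewrite mul1r addr0.
    by rewrite kk /= mul0r.
  by rewrite -(e j m) -(e i m) /v /dot !mxE; ring.
have E' j : l 0 j = (l 0 c / l' 0 c) * l' 0 j.
  have : (v c j <= kermx l^T)%MS.
    by apply: submx_trans h; rewrite sub_ker dv mulrC subrr.
  by rewrite sub_ker dv subr_eq0 mulrAC [l 0 c * _]mulrC => /eqP <-; rewrite mulrAC divff // mul1r.
have -> : l = (l 0 c / l' 0 c) *: l' by apply/rowP => j; rewrite mxE E'.
exact: scalemx_sub.
Qed.

Lemma adapted_scale E p l a b : a != 0 -> b != 0 -> adapted E p l ->
  adapted E (a *: p) (b *: l).
Proof.
move=> a0 b0 [/and3P[p0 l0 pl] hp hl]; split.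
- rewrite /flag_pair !scaler_eq0 (negbTE a0) (negbTE b0) p0 l0 /=.
  have -> : dot (a *: p) (b *: l) = a * b * dot p l by rewrite /dot !mxE; ring.
  by rewrite (eqP pl) mulr0.
- have e := eqmx_scale p a0; apply/eqmxP.
  exact: eqmx_trans (eqmxP hp) (eqmx_sym e).
- apply/eqmxP; apply: eqmx_trans (eqmxP hl) _.
  by apply/eqmxP/andP; split; apply/sub_kermxP; rewrite linearZ /= -?scalemxAr
    ?mulmx_ker ?scaler0 //; apply: (scalerI b0); rewrite scalemxAr -linearZ mulmx_ker scaler0.
Qed.

(** A tuple of flags has coordinates u in a chart exactly when it is adapted
    to the points and lines that u describes. *)
Lemma adapted_coordinates d (w : chart 3 d) u E j : is_flag E ->
  (forall i, (E i == (pid_mx i : 'M[L]_3) *m chart_mx w u j)%MS) <->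
  adapted E (cpt w u j) (cln w u j).
Proof.
case=> rk sub; set M := chart_mx w u j.
have Mu : M \in unitmx by apply: chart_mx_unit.
have rM (i : 'I_4) : \rank ((pid_mx i : 'M[L]_3) *m M) = i.
  by rewrite mxrankMfree ?row_free_unit // rank_pid_mx // -ltnS.
have prow k i : row i ((pid_mx k : 'M[L]_3) *m M) = (i < k)%:R *: row i M.
  rewrite row_mul [in RHS]rowE scalemxAl; congr (_ *m _).
  by apply/rowP => c; rewrite !mxE /= -natrM mulnb andbC eq_sym.
have p1 : ((pid_mx e1 : 'M[L]_3) *m M :=: cpt w u j)%MS.
  apply/eqmxP/andP; split; apply/row_subP => i.
    rewrite prow; move: i; apply: ord3P => /=; rewrite ?scale0r ?sub0mx //.
    by rewrite scale1r submx_refl.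
  rewrite ord1 row_id -[cpt w u j]scale1r.
  have -> : 1 *: cpt w u j = row i0 ((pid_mx e1 : 'M[L]_3) *m M).
    by rewrite prow.
  exact: row_sub.
have p2 : ((pid_mx e2 : 'M[L]_3) *m M :=: kermx (cln w u j)^T)%MS.
  have c0 : cln w u j != 0.
    apply/eqP => /rowP/(_ ((w j)^-1 i2)%g); rewrite cln2 mxE => /eqP.
    by rewrite oner_eq0.
  suff h : ((pid_mx e2 : 'M[L]_3) *m M <= kermx (cln w u j)^T)%MS.
    by apply/eqmxP; have [_ <-] := mxrank_leqif_eq h; rewrite rM rank_ker.
  apply/row_subP => i; rewrite sub_ker prow; move: i; apply: ord3P => /=.
  - by rewrite scale1r row_chart_cln.
  - by rewrite scale1r row_chart_cln.
  - by rewrite scale0r /dot !mxE !mul0r !addr0.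
split=> [h|[pl h1 h2]].
  split.
  - rewrite /flag_pair dot_cpt_cln eqxx andbT; apply/andP; split; apply/eqP.
      move=> /rowP/(_ ((w j)^-1 i0)%g); rewrite cpt0 mxE => /eqP.
      by rewrite oner_eq0.
    move=> /rowP/(_ ((w j)^-1 i2)%g); rewrite cln2 mxE => /eqP.
    by rewrite oner_eq0.
  - by apply/eqmxP; apply: eqmx_trans (eqmxP (h e1)) p1.
  - by apply/eqmxP; apply: eqmx_trans (eqmxP (h e2)) p2.
apply: ord4P.
- have e0 (B : 'M[L]_3) : \rank B = 0%N -> B = 0.
    by move/eqP; rewrite mxrank_eq0 => /eqP.
  by rewrite (e0 _ (rk ord0)) (e0 _ (rM ord0)) submx_refl.
- by apply/eqmxP; apply: eqmx_trans (eqmxP h1) (eqmx_sym p1).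
- by apply/eqmxP; apply: eqmx_trans (eqmxP h2) (eqmx_sym p2).
- have f (B : 'M[L]_3) : \rank B = e3 -> (B :=: 1%:M)%MS.
    move=> h; apply/eqmxP; rewrite submx1 /= sub1mx /row_full h //.
  by apply/eqmxP; apply: eqmx_trans (f _ (rk e3)) (eqmx_sym (f _ (rM e3))).
Qed.

End Adapted.

(** * Points of the product of flag varieties, and specialization *)

Lemma mmap_ext n (R S : nzRingType) (f f' : R -> S) (h h' : 'I_n -> S) p :
  f =1 f' -> h =1 h' -> mmap f h p = mmap f' h' p.
Proof.
move=> ef eh; apply: eq_bigr => m _; rewrite ef; congr (_ * _).
by apply: eq_bigr => i _; rewrite eh.
Qed.

Lemma mmap_XU n (R S : nzRingType) (f : {rmorphism R -> S}) (h : 'I_n -> S) i :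
  mmap f h 'X_i = h i.
Proof. by rewrite mmapX mmap1U. Qed.

Lemma mmap_unique n (R : nzRingType) (S : comNzRingType) (f : R -> S)
    (h : 'I_n -> S) (phi : {rmorphism {mpoly R[n]} -> S}) p :
  (forall c, phi c%:MP = f c) -> (forall i, phi 'X_i = h i) ->
  phi p = mmap f h p.
Proof.
move=> hc hx; rewrite [in LHS](mpolyE p) raddf_sum; apply: eq_bigr => m _ /=.
rewrite -mul_mpolyC rmorphM /= hc; congr (_ * _).
rewrite mpolyXE_id rmorph_prod; apply: eq_bigr => i _.
by rewrite rmorphXn /= hx.
Qed.

Section Coordinates.
Variables (d : nat) (L : fieldType).
Implicit Types (p l : 'I_d -> 'rV[L]_3) (u : 'I_#|{: Defs.coord 3 d}| -> L).

(** The chart coordinates of a tuple of point-line pairs, defined up to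
    scaling of the points and lines. *)
Definition coords (w : chart 3 d) p l u := forall j, exists a b,
  [/\ a != 0, b != 0, p j = a *: cpt w u j & l j = b *: cln w u j].

Lemma has_coordinatesP (w : chart 3 d) E p l u :
  (forall j, is_flag (E j)) -> (forall j, adapted (E j) (p j) (l j)) ->
  has_coordinates w E u <-> coords w p l u.
Proof.
move=> fl ad; split=> h j.
  have := (adapted_coordinates w u j (fl j)).1 (h j).
  by move=> /(adapted_unique (ad j))[[a a0 ->] [b b0 ->]]; exists a, b.
apply: (adapted_coordinates w u j (fl j)).2; have [a [b [a0 b0 pa lb]]] := h j.
have := ad j; rewrite pa lb => /(adapted_scale (invr_neq0 a0) (invr_neq0 b0)).
by rewrite !scalerA !mulVf // !scale1r.
Qed.

Definition chart_col (w : chart 3 d) j k : 'I_3 := ((w j)^-1 k)%g.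

Lemma entry_val (A : comNzRingType) (u : 'I_#|{: Defs.coord 3 d}| -> A) e :
  u e = entry u (val (enum_val e)).1.1 (val (enum_val e)).1.2 (val (enum_val e)).2.
Proof.
rewrite /entry; set x := val (enum_val e).
have -> : (x.1.1, x.1.2, x.2) = x by case: (x) => [[]].
by rewrite valK enum_valK.
Qed.

Definition chart_nonzero (w : chart 3 d) p l := forall j,
  p j 0 (chart_col w j i0) != 0 /\ l j 0 (chart_col w j i2) != 0.

Lemma coords_entries (w : chart 3 d) p l u : coords w p l u ->
  forall j, [/\ p j 0 (chart_col w j i0) != 0, l j 0 (chart_col w j i2) != 0,
    forall k, entry u j i0 k * p j 0 (chart_col w j i0) = p j 0 (chart_col w j k)
  & entry u j i1 i2 * l j 0 (chart_col w j i2) = - l j 0 (chart_col w j i1)].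
Proof.
move=> h j; have [a [b [a0 b0 -> ->]]] := h j; rewrite /chart_col.
have sE c (v : 'rV[L]_3) k : (c *: v) 0 k = c * v 0 k by rewrite mxE.
rewrite !sE cpt0 cln1 cln2 !mulr1; split=> // [k|].
  by rewrite sE cptS mulrC.
by rewrite mulrN opprK mulrC.
Qed.

Lemma ord3_lt (i k : 'I_3) : (i < k)%N -> i = i0 \/ i = i1 /\ k = i2.
Proof.
by move: i; apply: ord3P; move: k; apply: ord3P => //= _; [left|left|right].
Qed.

(** The scaling factors are read off from the entries that a chart makes equal
    to 1. *)
Lemma coords_uniq (w : chart 3 d) p l u u' :
  coords w p l u -> coords w p l u' -> u =1 u'.
Proof.
move=> /coords_entries h /coords_entries h' e.
rewrite (entry_val u) (entry_val u'); set x := enum_val e.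
have [p0 l0 e0 e1] := h (val x).1.1; have [_ _ e0' e1'] := h' (val x).1.1.
have [->|[-> ->]] := ord3_lt (valP x).
  by apply: (mulIf p0); rewrite e0 e0'.
by apply: (mulIf l0); rewrite e1 e1'.
Qed.

Definition pair_coord (w : chart 3 d) p l (e : 'I_#|{: Defs.coord 3 d}|) : L :=
  let x := val (enum_val e) in let j := x.1.1 in
  if x.1.2 == i0 then p j 0 (chart_col w j x.2) / p j 0 (chart_col w j i0)
  else - l j 0 (chart_col w j i1) / l j 0 (chart_col w j i2).

Lemma chart_col_row (w : chart 3 d) j (Q : 'I_3 -> Prop) :
  Q (chart_col w j i0) -> Q (chart_col w j i1) -> Q (chart_col w j i2) ->
  forall c, Q c.
Proof.
move=> h0 h1 h2 c; rewrite -(permK (w j) c) -/(chart_col w j _).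
by move: (w j c); apply: ord3P.
Qed.

Lemma pair_coordP (w : chart 3 d) p l : (forall j, dot (p j) (l j) = 0) ->
  chart_nonzero w p l -> coords w p l (pair_coord w p l).
Proof.
move=> pl nz j; have [p0 l0] := nz j.
exists (p j 0 (chart_col w j i0)), (l j 0 (chart_col w j i2)).
have en (i k : 'I_3) : (i < k)%N -> entry (pair_coord w p l) j i k =
   if i == i0 then p j 0 (chart_col w j k) / p j 0 (chart_col w j i0)
   else - l j 0 (chart_col w j i1) / l j 0 (chart_col w j i2).
  by move=> ik; rewrite /entry insubT //= /pair_coord enum_rankK.
have sE c (v : 'rV[L]_3) k : (c *: v) 0 k = c * v 0 k by rewrite mxE.
split=> //; apply/rowP; apply: (@chart_col_row w j); rewrite sE.
- by rewrite cpt0 mulr1.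
- by rewrite cptS en //= mulrC divfK.
- by rewrite cptS en //= mulrC divfK.
- have e : dot (p j) (l j) =
    p j 0 (chart_col w j i0) * l j 0 (chart_col w j i0) +
    p j 0 (chart_col w j i1) * l j 0 (chart_col w j i1) +
    p j 0 (chart_col w j i2) * l j 0 (chart_col w j i2).
    rewrite -(@dot_perm _ (w j) (fun k => p j 0 (chart_col w j k))
      (fun k => l j 0 (chart_col w j k))).
    by congr dot; apply/rowP => c; rewrite !mxE /chart_col permK.
  rewrite mxE [w j _]permKV /= !en //=.
  have := pl j; rewrite e => e0; apply: (mulfI p0).
  rewrite -[LHS]subr0 -{}[X in _ - X]e0.
  by field; apply/andP; split; [exact: p0|exact: l0].
- by rewrite cln1 en //= mulNr opprK mulrC divfK.
- by rewrite cln2 mulr1.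
Qed.

(** Some chart contains the flag of any incident point-line pair: a point and a
    line through it have nonzero coordinates at two different indices. *)
Lemma chart_exists p l : (forall j, flag_pair (p j) (l j)) ->
  exists w : chart 3 d, chart_nonzero w p l.
Proof.
move=> h.
have hj j : exists s : 'S_3, p j 0 (s^-1 i0)%g != 0 /\ l j 0 (s^-1 i2)%g != 0.
  have /and3P[p0 l0 /eqP pl] := h j.
  have [a pa] := row3_neq0 p0.
  have [b [ba lb]] : exists b, b != a /\ l j 0 b != 0.
    apply: contrapT => nb.
    have z b : b != a -> l j 0 b = 0.
      by move=> ba; apply/eqP; apply: contrapT => /negP lb; apply: nb; exists b.
    have [c lc] := row3_neq0 l0; have ca : c = a.
      by apply/eqP; apply: contraNT lc => ca; rewrite z.
    move: pl; rewrite dot_sum (bigD1 a) //= big1 => [|k ka]; last first.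
      by rewrite z ?mulr0.
    rewrite addr0 -[X in l j 0 X]ca => /eqP; rewrite mulf_eq0 (negbTE pa).
    by rewrite (negbTE lc).
  pose s := (tperm i0 a * tperm i2 (tperm i0 a b))%g.
  have sa : s a = i0.
    rewrite permM tpermR tpermD //.
    by rewrite -[X in _ != X](tpermR i0 a) (inj_eq perm_inj).
  have sb : s b = i2 by rewrite permM tpermR.
  by exists s; rewrite -sa -sb !permK.
have [w hw] := choice hj.
by exists w.
Qed.

End Coordinates.

(** Chart coordinates are ratios of entries of the points and lines. So a
    function on a chart, pulled back to a family of flags over any ring, is a
    fraction whose denominator vanishes nowhere the family meets the chart;
    numerator and denominator do not depend on the field-valued point of the
    family. *)
Lemma universal_fraction (K : fieldType) (A : comNzRingType)
  (iotaA : {rmorphism K -> A}) d (w : chart 3 d) (P N : 'I_d -> 'rV[A]_3)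
  (f : chart_ring K 3 d) :
  exists F G : A, forall (L : fieldType) (iota : {rmorphism K -> L})
    (phi : {rmorphism A -> L}) u,
    (forall c, iota c = phi (iotaA c)) ->
    coords w (fun j => map_mx phi (P j)) (fun j => map_mx phi (N j)) u ->
    phi G != 0 /\ mmap iota u f * phi G = phi F.
Proof.
pose Reg (f : chart_ring K 3 d) := exists F G : A,
  forall (L : fieldType) (iota : {rmorphism K -> L})
    (phi : {rmorphism A -> L}) u,
    (forall c, iota c = phi (iotaA c)) ->
    coords w (fun j => map_mx phi (P j)) (fun j => map_mx phi (N j)) u ->
    phi G != 0 /\ mmap iota u f * phi G = phi F.
have RC c : Reg c%:MP.
  exists (iotaA c), 1 => L iota phi u e _; rewrite rmorph1 oner_neq0 mulr1.
  by split=> //; rewrite mmapC; apply: e.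
have RM f1 f2 : Reg f1 -> Reg f2 -> Reg (f1 * f2).
  case=> F1 [G1 h1] [F2 [G2 h2]]; exists (F1 * F2), (G1 * G2) => L iota phi u e c.
  have [n1 E1] := h1 _ _ _ _ e c; have [n2 E2] := h2 _ _ _ _ e c.
  by rewrite !rmorphM /= mulf_neq0 // -E1 -E2; split=> //; ring.
have RD f1 f2 : Reg f1 -> Reg f2 -> Reg (f1 + f2).
  case=> F1 [G1 h1] [F2 [G2 h2]].
  exists (F1 * G2 + F2 * G1), (G1 * G2) => L iota phi u e c.
  have [n1 E1] := h1 _ _ _ _ e c; have [n2 E2] := h2 _ _ _ _ e c.
  by rewrite !rmorphD !rmorphM /= mulf_neq0 // -E1 -E2; split=> //; ring.
have RX e : Reg 'X_e.
  set x := enum_val e; set j := (val x).1.1.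
  have [i0E|[i1E k2E]] := ord3_lt (valP x).
    exists (P j 0 (chart_col w j (val x).2)), (P j 0 (chart_col w j i0)).
    move=> L iota phi u _ /coords_entries/(_ j)[h _ h0 _].
    move: h (h0 (val x).2); rewrite !mxE => h {}h0; split=> //.
    by rewrite mmap_XU (entry_val u) -/x -/j i0E h0.
  exists (- N j 0 (chart_col w j i1)), (N j 0 (chart_col w j i2)).
  move=> L iota phi u _ /coords_entries/(_ j)[_ h _ h0].
  move: h h0; rewrite !mxE rmorphN => h h0; split=> //.
  by rewrite mmap_XU (entry_val u) -/x -/j i1E k2E h0.
have R1 : Reg 1 by rewrite -mpolyC1; exact: RC.
have RXn e k : Reg ('X_e ^+ k).
  by elim: k => [|k IH]; rewrite ?expr0 // exprS; apply: RM.
rewrite -/(Reg f); move: f; apply: mpolyind => [|c m q _ _ IH].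
  by rewrite -mpolyC0; exact: RC.
apply: RD => //; rewrite -mul_mpolyC; apply: (RM); first exact: RC.
rewrite mpolyXE_id; apply: (big_ind Reg) => [|f1 f2|i _].
- exact: R1.
- exact: RM.
- exact: RXn.
Qed.

Section Points.
Variables (K : fieldType) (d : nat).
Implicit Types (x y : flag_point K 3 d) (w : chart 3 d).

(** The point x is given by the L-valued point-line pairs (p j, l j). *)
Definition defines x (L : fieldType) (iota : {rmorphism K -> L})
    (p l : 'I_d -> 'rV[L]_3) : Prop :=
  (forall j, flag_pair (p j) (l j)) /\
  forall w f, prime_at x w f <-> exists2 u, coords w p l u & mmap iota u f = 0.

Lemma represents_defines x (L : fieldType) (iota : {rmorphism K -> L}) E p l :
  represents iota E (prime_at x) -> (forall j, adapted (E j) (p j) (l j)) ->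
  defines x iota p l.
Proof.
case=> fl e ad; split=> [j|w f]; first by have [] := ad j.
by rewrite e; split=> -[u /(has_coordinatesP w u fl ad) h z]; exists u.
Qed.

Lemma defines_exists x : exists (L : fieldType) (iota : {rmorphism K -> L}) p l,
  defines x iota p l.
Proof.
case: x => p0 [L [iota [E rep]]]; have [fl _] := rep.
have [p hp] := choice (fun j => flag_adapted (fl j)).
have [l hl] := choice hp.
by exists L, iota, p, l; apply: represents_defines hl.
Qed.

Lemma pair_point_proof (L : fieldType) (iota : {rmorphism K -> L})
  (p l : 'I_d -> 'rV[L]_3) : (forall j, flag_pair (p j) (l j)) ->
  exists (L' : fieldType) (iota' : {rmorphism K -> L'}) E,
    represents iota' E (vanishing iota (fun j => pair_flag (p j) (l j))).
Proof.
move=> h; exists L, iota, (fun j => pair_flag (p j) (l j)).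
by split=> // j; apply: pair_flagP.
Qed.

Definition pair_point (L : fieldType) (iota : {rmorphism K -> L})
    (p l : 'I_d -> 'rV[L]_3) (h : forall j, flag_pair (p j) (l j)) :
    flag_point K 3 d :=
  FlagPoint (pair_point_proof iota h).

Lemma pair_point_defines (L : fieldType) (iota : {rmorphism K -> L})
    (p l : 'I_d -> 'rV[L]_3) (h : forall j, flag_pair (p j) (l j)) :
  defines (pair_point iota h) iota p l.
Proof.
apply: (@represents_defines _ _ _ (fun j => pair_flag (p j) (l j))) => [|j].
  by split=> // j; apply: pair_flagP.
exact: pair_flag_adapted.
Qed.

Section Defined.
Variables (x : flag_point K 3 d) (L : fieldType) (iota : {rmorphism K -> L}).
Variables (p l : 'I_d -> 'rV[L]_3).
Hypothesis def_x : defines x iota p l.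

Lemma in_chartP w : in_chart w x <-> exists u, coords w p l u.
Proof.
split=> [[f /(def_x.2 w)[u hu _]]|[u hu]]; first by exists u.
by exists 0; apply/(def_x.2 w); exists u; rewrite ?raddf0.
Qed.

Lemma in_chart_nonzero w : in_chart w x <-> chart_nonzero w p l.
Proof.
rewrite in_chartP; split=> [[u /coords_entries h] j|h].
  by have [] := h j.
exists (pair_coord w p l); apply: pair_coordP => // j.
by have /and3P[_ _ /eqP] := def_x.1 j.
Qed.

Lemma prime_atP w u f : coords w p l u -> prime_at x w f <-> mmap iota u f = 0.
Proof.
move=> hu; rewrite def_x.2; split=> [[u' hu' <-]|h]; last by exists u.
exact: mmap_ext (coords_uniq hu hu').
Qed.

End Defined.

Lemma chart_cover x : exists w, in_chart w x.
Proof.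
have [L [iota [p [l h]]]] := defines_exists x.
have [w hw] := chart_exists h.1.
by exists w; apply/(in_chart_nonzero h).
Qed.

Definition generic_point w : 'I_d -> 'rV[chart_ring K 3 d]_3 :=
  cpt w (fun i => 'X_i).
Definition generic_line w : 'I_d -> 'rV[chart_ring K 3 d]_3 :=
  cln w (fun i => 'X_i).

Lemma generic_point_eval w (L : comNzRingType) (iota : {rmorphism K -> L}) u j :
  map_mx (mmap iota u) (generic_point w j) = cpt w u j.
Proof.
rewrite /generic_point cpt_map; apply/rowP => c; rewrite !mxE.
by case: insub => //= e; rewrite mmap_XU.
Qed.

Lemma generic_line_eval w (L : comNzRingType) (iota : {rmorphism K -> L}) u j :
  map_mx (mmap iota u) (generic_line w j) = cln w u j.
Proof.
have e i k : entry (mmap iota u \o (fun i => 'X_i)) j i k = entry u j i k.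
  by rewrite /entry; case: insub => //= e; rewrite mmap_XU.
by rewrite /generic_line cln_map; apply/rowP => c; rewrite !mxE !e.
Qed.

Definition basic_set w (f : chart_ring K 3 d) : set (flag_point K 3 d) :=
  [set x | in_chart w x /\ ~ prime_at x w f]%classic.

(** In another chart w' this set is the complement of the zeros of one
    function: the numerator of f times the product of the entries that must
    not vanish for a point of w' to lie in w. *)
Lemma basic_set_open w f : open (basic_set w f).
Proof.
change (zariski_open (basic_set w f)) => w'.
have [F [G FG]] := universal_fraction (@mpolyC _ K) w
  (generic_point w') (generic_line w') f.
pose D : chart_ring K 3 d := \prod_j (generic_point w' j 0 (chart_col w j i0)
  * generic_line w' j 0 (chart_col w j i2)).
exists [set F * D]%classic => x xw'.
have [L [iota [p [l dx]]]] := defines_exists x.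
have [u hu] := (in_chartP dx w').1 xw'.
have sub1 : ([set F * D] `<=` prime_at x w')%classic <-> prime_at x w' (F * D).
  by split=> [h|h _ ->]; [exact: h|].
rewrite sub1 (prime_atP dx _ hu) rmorphM /=.
have gp j c : mmap iota u (generic_point w' j 0 c) = cpt w' u j 0 c.
  by rewrite -(generic_point_eval w' iota u j) [RHS]mxE.
have gl j c : mmap iota u (generic_line w' j 0 c) = cln w' u j 0 c.
  by rewrite -(generic_line_eval w' iota u j) [RHS]mxE.
have sE c (v : 'rV[L]_3) k : (c *: v) 0 k = c * v 0 k by rewrite mxE.
have Dn : mmap iota u D != 0 <-> in_chart w x.
  rewrite (in_chart_nonzero dx) rmorph_prod /=; split=> [/prodf_neq0 h j|h].
    have := h j isT; rewrite rmorphM /= gp gl mulf_eq0 negb_or => /andP[ha hb].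
    by have [a [b [a0 b0 -> ->]]] := hu j; rewrite !sE !mulf_neq0.
  apply/prodf_neq0 => j _; rewrite rmorphM /= gp gl.
  have := h j; have [a [b [a0 b0 -> ->]]] := hu j; rewrite !sE !mulf_eq0.
  by rewrite (negbTE a0) (negbTE b0) /= negb_or => -[-> ->].
have cw u' : coords w p l u' -> coords w (fun j => map_mx (mmap iota u) (generic_point w' j))
    (fun j => map_mx (mmap iota u) (generic_line w' j)) u'.
  move=> h j; have [a [b [a0 b0 pa lb]]] := hu j.
  have [a' [b' [a0' b0' pa' lb']]] := h j; exists (a^-1 * a'), (b^-1 * b').
  rewrite !mulf_neq0 ?invr_neq0 // generic_point_eval generic_line_eval.
  by rewrite -!scalerA -pa' -lb' pa lb !scalerA !mulVf // !scale1r.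
split=> [[xw nf]|nFD].
  have [u' hu'] := (in_chartP dx w).1 xw.
  have [|Gn e] := FG L iota (mmap iota u) u' _ (cw _ hu').
    by move=> c; rewrite /= mmapC.
  apply/eqP; rewrite -e; apply: mulf_neq0; last exact/Dn.
  by apply: mulf_neq0 => //; apply/eqP => z; apply: nf; apply/(prime_atP dx _ hu').
have xw : in_chart w x by apply/Dn; apply: contra_not_neq nFD => ->; rewrite mulr0.
have [u' hu'] := (in_chartP dx w).1 xw.
split=> // /(prime_atP dx _ hu') z; apply: nFD.
have [|Gn e] := FG L iota (mmap iota u) u' _ (cw _ hu').
  by move=> c; rewrite /= mmapC.
by rewrite -e z mul0r mul0r.
Qed.

(** The point y lies in the closure of x; see spec_closure. *)
Definition spec x y : Prop :=
  forall w, in_chart w y -> in_chart w x /\ (prime_at x w `<=` prime_at y w)%classic.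

Lemma spec_closure x y : spec x y <-> closure [set x]%classic y.
Proof.
split=> [s|h w yw].
  have [w yw] := chart_cover y; have [xw sub] := s w yw.
  move=> B; rewrite nbhsE => -[U [oU Uy] UB].
  exists x; split=> //; apply: UB.
  have [I hI] := (oU : zariski_open U) w; apply/(hI _ xw) => Ix.
  by apply: (hI _ yw).1 Uy _; apply: subset_trans sub.
have near (U : set (flag_point K 3 d)) : open U -> U y -> U x.
  by move=> oU Uy; have [z [->]] := h U (open_nbhs_nbhs (conj oU Uy)).
have xw : in_chart w x.
  have := near _ (basic_set_open w 1).
  by case; [split=> //; exact: prime_at_proper|].
split=> // f fx; apply: contrapT => fy.
have [_ nfx] : basic_set w f x by apply: near (basic_set_open w f) _; split.
exact: nfx.
Qed.

Lemma spec_refl x : spec x x. Proof. by move=> w xw; split. Qed.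

Lemma spec_trans y x z : spec x y -> spec y z -> spec x z.
Proof.
move=> xy yz w zw; have [yw s] := yz w zw; have [xw s'] := xy w yw.
by split=> //; apply: subset_trans s.
Qed.

(** A function vanishing at the first point has its numerator in the kernel of
    the first homomorphism, hence in that of the second. *)
Lemma spec_family x y (A : comNzRingType) (iotaA : {rmorphism K -> A})
  (P N : 'I_d -> 'rV[A]_3) (L1 L2 : fieldType)
  (f1 : {rmorphism A -> L1}) (f2 : {rmorphism A -> L2})
  (iota1 : {rmorphism K -> L1}) (iota2 : {rmorphism K -> L2}) :
  (forall c, iota1 c = f1 (iotaA c)) -> (forall c, iota2 c = f2 (iotaA c)) ->
  (forall a, f1 a = 0 -> f2 a = 0) ->
  defines x iota1 (fun j => map_mx f1 (P j)) (fun j => map_mx f1 (N j)) ->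
  defines y iota2 (fun j => map_mx f2 (P j)) (fun j => map_mx f2 (N j)) ->
  spec x y.
Proof.
move=> e1 e2 ker dx dy w yw.
have [u2 hu2] := (in_chartP dy w).1 yw.
have xw : in_chart w x.
  apply/(in_chart_nonzero dx) => j.
  have [h h'] := (in_chart_nonzero dy w).1 yw j.
  by split; [move: h|move: h']; rewrite !mxE; apply: contraNneq => /ker ->.
split=> // f; have [u1 hu1] := (in_chartP dx w).1 xw.
have [F [G FG]] := universal_fraction iotaA w P N f.
have [_ E1] := FG _ _ _ _ e1 hu1; have [G2 E2] := FG _ _ _ _ e2 hu2.
move=> /(prime_atP dx _ hu1) z; apply/(prime_atP dy _ hu2).
apply: (mulIf G2); rewrite mul0r E2; apply: ker.
by rewrite -E1 z mul0r.
Qed.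

End Points.

(** * Permutation array schemes as spaces of line arrangements *)

(** A singular matrix has a nonzero vector in its kernel. *)
Lemma br0_common (F : fieldType) (u v w : 'rV[F]_3) : br u v w = 0 ->
  exists2 q : 'rV[F]_3, q != 0 & [/\ dot q u = 0, dot q v = 0 & dot q w = 0].
Proof.
pose A : 'M[F]_3 := \matrix_(a < 3)
  (if a == i0 then u else if a == i1 then v else w).
have e i x : row i A = x -> forall q : 'rV_3, (q *m A^T) 0 i = dot q x.
  by move=> <- q; rewrite mxE dot_sum; apply: eq_bigr => k _; rewrite !mxE.
have [r0 r1 r2] : [/\ row i0 A = u, row i1 A = v & row i2 A = w].
  by split; rewrite rowK.
rewrite -r0 -r1 -r2 -br_mxE -det_tr => /eqP/det0P[q q0 qA].
exists q => //; rewrite -!(e _ _ erefl) qA !mxE; split=> //.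
Qed.

Section Arrangements.
Variables (d : nat) (conc : 'I_d -> 'I_d -> 'I_d -> bool) (mu : 'I_d -> 'I_d).

Definition realizes (L : fieldType) (l : 'I_d -> 'rV[L]_3) :=
  forall i j k, (br (l i) (l j) (l k) == 0) = conc i j k.

(** The point of the k-th flag: the intersection of its line with the line mu
    k. *)
Definition mark (R : comNzRingType) (l : 'I_d -> 'rV[R]_3) k :=
  cross (l k) (l (mu k)).

Lemma realizes_pencils (L : fieldType) (l : 'I_d -> 'rV[L]_3) :
  realizes l -> (forall i j, i != j -> exists k, ~~ conc i j k) ->
  (forall k, mu k != k) -> pencils conc mu.
Proof.
move=> rl off mk; have cr i j : i != j -> cross (l i) (l j) != 0.
  by case/off => k; rewrite -rl => /br_neq0_cross.
split=> // [i k|i j k|i j k|a b i j k ab ij].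
- by rewrite -rl br_same eqxx.
- by rewrite -!rl br_swap12 oppr_eq0.
- by rewrite -!rl br_swap23 oppr_eq0.
rewrite -!rl => /eqP ci /eqP cj.
have [c e] := cross_span (cr _ _ ij) ci cj.
have c0 : c != 0 by apply: contraNneq (cr _ _ ab) => c0; rewrite e c0 scale0r.
have sE : br (l a) (l b) (l k) = c * br (l i) (l j) (l k).
  by rewrite /br e /dot !mxE; ring.
by rewrite sE mulf_eq0 (negbTE c0).
Qed.

Hypothesis Hc : pencils conc mu.

Section OneArrangement.
Variables (L : fieldType) (l : 'I_d -> 'rV[L]_3).
Hypothesis rl : realizes l.

Lemma realizes_cross i j : i != j -> cross (l i) (l j) != 0.
Proof. by case/(conc_rank Hc) => k; rewrite -rl => /br_neq0_cross. Qed.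

Lemma mark_pair k : flag_pair (mark l k) (l k).
Proof.
have h : cross (l k) (l (mu k)) != 0.
  by apply: realizes_cross; rewrite eq_sym (mark_neq Hc).
apply/and3P; split; [exact: h| |by rewrite dot_crossl].
apply: contraNneq h => ->; apply/eqP.
by apply: row3P; rewrite !mxE /=; ring.
Qed.

Lemma flag_member_sub E j (k : 'I_3) v : is_flag E ->
  adapted E (mark l j) (l j) ->
  (v <= E (lift ord0 k))%MS = [&& (k < 2)%N ==> (dot v (l j) == 0)
                        & (k == 0 :> nat) ==> (dot v (l (mu j)) == 0)].
Proof.
move=> [rk _] [pl /eqmxP h1 /eqmxP h2]; move: k; apply: ord3P => /=.
- rewrite -/e1 h1; apply/idP/andP => [/sub_rVP[a ->]|[/eqP a /eqP b]].
    have dE x : dot (a *: mark l j) x = a * dot (mark l j) x.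
      by rewrite /dot !mxE; ring.
    by rewrite !dE dot_crossl dot_crossr mulr0 eqxx.
  have [|c ->] := cross_span _ a b; last exact: scalemx_sub.
  by case/and3P: pl.
- by rewrite -/e2 h2 sub_ker andbT.
- rewrite -/e3; apply: submx_full; rewrite /row_full rk; done.
Qed.

(** A flag member of dimension 2 imposes one line, and a flag member of
    dimension 1 imposes the line of the flag and the line that marks its
    point. *)
Lemma flags_meet_sub (E : 'I_d -> 'I_4 -> 'M[L]_3) (x : position 3 d) v :
  (forall j, is_flag (E j)) -> (forall j, adapted (E j) (mark l j) (l j)) ->
  reflect (forall j, j \in line_set mu x -> dot v (l j) = 0)
    (v <= \bigcap_(j < d) E j (lift ord0 (x j)))%MS.
Proof.
move=> fl ad; apply: (iffP sub_bigcapmxP) => [h j|h j _].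
  rewrite inE => /orP[xj|/existsP[k /andP[/eqP <- xk]]].
    by have := h j isT; rewrite (flag_member_sub _ _ (fl j) (ad j)) xj => /andP[/eqP].
  have := h k isT; rewrite (flag_member_sub _ _ (fl k) (ad k)) xk.
  by case/andP=> _ /eqP.
rewrite (flag_member_sub _ _ (fl j) (ad j)); apply/andP; split; apply/implyP => xj.
  by rewrite h // inE xj.
by rewrite h // inE; apply/orP; right; apply/existsP; exists j; rewrite eqxx.
Qed.

Lemma rank_row_space m1 m2 (A : 'M[L]_(m1, 3)) (B : 'M[L]_(m2, 3)) :
  (forall v : 'rV_3, (v <= A)%MS <-> (v <= B)%MS) -> \rank A = \rank B.
Proof.
move=> h; have e : (A == B)%MS by apply/andP; split; apply/rV_subP => v /h.
exact: eqmx_rank e.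
Qed.

Lemma flags_meet_rank (E : 'I_d -> 'I_4 -> 'M[L]_3) (x : position 3 d) :
  (forall j, is_flag (E j)) -> (forall j, adapted (E j) (mark l j) (l j)) ->
  \rank (\bigcap_(j < d) E j (lift ord0 (x j)))%MS =
  lines_rank conc (line_set mu x).
Proof.
move=> fl ad; have sub v := flags_meet_sub x v fl ad.
set W := (\bigcap_(j < d) _)%MS in sub *; set J := line_set mu x in sub *.
case: (set_0Vmem J) => [J0|[i iJ]].
  rewrite (lines_rank0 _ J0); transitivity (\rank (1%:M : 'M[L]_3)); last exact: mxrank1.
  apply: rank_row_space => v.
  by split=> [_|_]; rewrite ?submx1 //; apply/sub => j; rewrite J0 inE.
have [[j /andP[jJ ij]]|hJ] :=
    altP (existsP : reflect _ [exists k, (k \in J) && (i != k)]).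
  rewrite (lines_rank2 Hc iJ jJ ij).
  have sp v : (v <= W)%MS -> exists c, v = c *: cross (l i) (l j).
    by move/sub=> h; apply: cross_span; rewrite ?realizes_cross ?h.
  case: (boolP [forall k in J, conc i j k]) => [/forall_inP h|nh] /=.
    transitivity (\rank (cross (l i) (l j))); last first.
      by rewrite rank_rV realizes_cross.
    apply: rank_row_space => v; split=> [/sp[c ->]|/sub_rVP[c ->]].
      exact: scalemx_sub.
    apply: scalemx_sub; apply/sub => k kJ; apply/eqP.
    by rewrite -/(br _ _ _) rl h.
  transitivity (\rank (0 : 'M[L]_3)); last by rewrite mxrank0.
  apply: rank_row_space => v; split=> [vW|]; last first.
    by rewrite submx0 => /eqP ->; rewrite sub0mx.
  have [c e] := sp _ vW; rewrite submx0 e.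
  have [k kJ nk] : exists2 k, k \in J & ~~ conc i j k.
    by move: nh; rewrite negb_forall_in => /exists_inP.
  have : dot v (l k) = 0 by move/sub: vW; apply.
  rewrite e; have -> : dot (c *: cross (l i) (l j)) (l k) = c * br (l i) (l j) (l k).
    by rewrite /br /dot !mxE; ring.
  by move/eqP; rewrite mulf_eq0 rl (negbTE nk) orbF => /eqP ->; rewrite scale0r.
have JE : J = [set i]%SET.
  apply/setP => k; rewrite inE; apply/idP/eqP => [kJ|-> //].
  by move/existsPn: hJ => /(_ k); rewrite kJ /= negbK => /eqP ->.
rewrite JE lines_rank1; transitivity (\rank (kermx (l i)^T)); last first.
  by apply: rank_ker; case/and3P: (mark_pair i).
apply: rank_row_space => v; rewrite sub_ker; split=> [/sub h|/eqP h].
  by rewrite h.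
by apply/sub => k; rewrite JE inE => /eqP ->.
Qed.

End OneArrangement.

(** The intersection dimensions determine the concurrency pattern of the lines
    and force the point of each flag to lie on the line that marks it;
    conversely these data determine all the dimensions. So a point of the
    scheme is an arrangement of lines with the prescribed concurrent triples. *)
Lemma perm_array_schemeP (K : fieldType) (x : flag_point K 3 d) : (0 < d)%N ->
  perm_array_scheme K (pattern_array conc mu) x <->
  exists (L : fieldType) (iota : {rmorphism K -> L}) (l : 'I_d -> 'rV[L]_3),
    realizes l /\ defines x iota (mark l) l.
Proof.
move=> d0; split; last first.
  case=> L [iota [l [rl dx]]]; pose E j := pair_flag (mark l j) (l j).
  have fl j : is_flag (E j) by apply: pair_flagP; apply: mark_pair.
  have ad j : adapted (E j) (mark l j) (l j).
    by apply: pair_flag_adapted; apply: mark_pair.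
  exists L, iota, E; split.
    split=> //; apply/funext => w; apply/predeqP => f; rewrite (dx.2 w f).
    by split=> -[u /(has_coordinatesP w u fl ad) hu z]; exists u.
  move=> y r hr; rewrite (flags_meet_rank rl y fl ad).
  by rewrite -(hr (Ordinal d0)) (rank_below Hc).
case=> L [iota [E [rep hE]]]; have [fl _] := rep.
have [p hp] := choice (fun j => flag_adapted (fl j)).
have [l ad] := choice hp.
have rkE (y : position 3 d) : \rank (\bigcap_(j < d) E j (lift ord0 (y j)))%MS =
    lines_rank conc (line_set mu y) by apply: hE; apply: rank_below.
have e2E j : (E j e2 :=: kermx (l j)^T)%MS by have [_ _ /eqmxP] := ad j.
have e1E j : (E j e1 :=: p j)%MS by have [_ /eqmxP] := ad j.
have e3E j v : (v <= E j e3)%MS.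
  by apply: submx_full; rewrite /row_full; have [-> _] := fl j.
have rl : realizes l.
  move=> i j k; have [<-|ij] := eqVneq i j.
    by rewrite br_same eqxx (conc_id Hc).
  pose y : position 3 d := [ffun t => if t \in [:: i; j; k] then i1 else i2].
  have ls : line_set mu y = [set t in [:: i; j; k]]%SET.
    apply/setP => t; rewrite [RHS]inE [LHS]inE ffunE.
    rewrite [X in _ || X](_ : _ = false) ?orbF; first by case: ifP.
    by apply/existsP => -[s]; rewrite ffunE; case: ifP => _; rewrite andbF.
  have ry := rkE y; rewrite (@lines_rank2 _ _ _ Hc _ i j) ?ls ?inE ?eqxx ?orbT // in ry.
  have cE : [forall t in [set t in [:: i; j; k]]%SET, conc i j t] = conc i j k.
    apply/forall_inP/idP => [h|h t]; first by apply: h; rewrite !inE eqxx !orbT.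
    rewrite !inE => /or3P[] /eqP -> //; rewrite ?(conc12 Hc) ?(conc22 Hc) //.
  rewrite cE in ry.
  have vP v : (v <= \bigcap_(t < d) E t (lift ord0 (y t)))%MS <->
      [/\ dot v (l i) = 0, dot v (l j) = 0 & dot v (l k) = 0].
    split=> [/sub_bigcapmxP h|[hi hj hk]].
      have ht t : t \in [:: i; j; k] -> dot v (l t) = 0.
        move=> ti; have := h t isT; rewrite ffunE ti -/e2 e2E sub_ker.
        by move/eqP.
      by split; apply: ht; rewrite !inE eqxx ?orbT.
    apply/sub_bigcapmxP => t _; rewrite ffunE; case: ifP => ti; last exact: e3E.
    rewrite -/e2 e2E sub_ker; move: ti; rewrite !inE => /or3P[] /eqP ->;
    by rewrite ?hi ?hj ?hk.
  rewrite -[RHS]lt0b -ry lt0n mxrank_eq0; apply/eqP/idP => [/br0_common[q q0 /vP qW]|].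
    by apply: contraNneq q0 => W0; rewrite -submx0 -W0.
  case/rowV0Pn=> q /vP[hi hj hk] q0; have [c qc] := row3_neq0 q0.
  by apply: (mulfI qc); rewrite mulr0; apply: br_common_zero.
exists L, iota, l; split=> //; apply: (represents_defines rep) => k.
have pk : dot (p k) (l (mu k)) = 0.
  pose y : position 3 d := [ffun t => if t == k then i0 else
    if t == mu k then i1 else i2].
  have ls : line_set mu y = [set k; mu k]%SET.
    apply/setP => t; rewrite [RHS]inE [LHS]inE !inE ffunE.
    have -> : [exists s, (mu s == t) && (y s == 0 :> nat)] = (t == mu k).
      apply/existsP/eqP => [[s]|->].
        rewrite ffunE; case: (eqVneq s k) => [->|_].
          by case/andP=> /eqP ->.
        by case: ifP; rewrite andbF.
      by exists k; rewrite ffunE !eqxx.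
    case: (t == k) => //; case: (t == mu k) => //.
  have ry := rkE y.
  have nk : k != mu k by rewrite eq_sym (mark_neq Hc).
  rewrite (@lines_rank2 _ _ _ Hc _ k (mu k)) ?ls ?inE ?eqxx ?orbT // in ry.
  move: ry; have -> : [forall t in [set k; mu k]%SET, conc k (mu k) t] = true.
    apply/forall_inP => t; rewrite !inE => /orP[] /eqP ->.
      exact: (conc12 Hc).
    exact: (conc22 Hc).
  move=> ry; have : \rank (\bigcap_(j < d) E j (lift ord0 (y j)))%MS != 0%N.
    by rewrite ry.
  rewrite mxrank_eq0 => /rowV0Pn[q /sub_bigcapmxP h q0].
  have := h k isT; rewrite ffunE eqxx -/e1 e1E => /sub_rVP[a e].
  have := h (mu k) isT; rewrite ffunE (negbTE (mark_neq Hc k)) eqxx -/e2 e2E.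
  rewrite sub_ker e.
  have -> : dot (a *: p k) (l (mu k)) = a * dot (p k) (l (mu k)).
    by rewrite /dot !mxE; ring.
  rewrite mulf_eq0 => /orP[/eqP a0|/eqP //].
  by move: q0; rewrite e a0 scale0r eqxx.
have [/and3P[p0 _ /eqP pl] _ _] := ad k.
have ck : cross (l k) (l (mu k)) != 0.
  by apply: (realizes_cross rl); rewrite eq_sym (mark_neq Hc).
have [c e] := cross_span ck pl pk.
have c0 : c != 0 by apply: contraNneq p0 => c0; rewrite e c0 scale0r.
have := adapted_scale (invr_neq0 c0) (oner_neq0 L) (ad k).
by rewrite e scalerA mulVf // !scale1r.
Qed.

End Arrangements.

(** * Algebraic dependence, and chains of primes *)

Lemma msizeM_bound (K : fieldType) m (p q : {mpoly K[m]}) a b :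
  (msize p <= a.+1)%N -> (msize q <= b.+1)%N -> (msize (p * q) <= (a + b).+1)%N.
Proof.
have [->|p0] := eqVneq p 0; first by rewrite mul0r msize0.
have [->|q0] := eqVneq q 0; first by rewrite mulr0 msize0.
move=> pa qb; rewrite msizeM //.
have := leq_add pa qb; rewrite addSn addnS => h.
by case: (_ + _)%N h.
Qed.

Lemma msizeX_bound (K : fieldType) m (p : {mpoly K[m]}) a k :
  (msize p <= a.+1)%N -> (msize (p ^+ k) <= (k * a).+1)%N.
Proof.
move=> pa; elim: k => [|k IH]; first by rewrite expr0 msize1.
by rewrite exprS mulSn; apply: msizeM_bound.
Qed.

Lemma msize_prod_bound (K : fieldType) m n (p : 'I_n -> {mpoly K[m]}) a :
  (forall i, msize (p i) <= a.+1)%N -> (msize (\prod_i p i) <= (n * a).+1)%N.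
Proof.
elim: n p => [|n IH] p h; first by rewrite big_ord0 msize1.
by rewrite big_ord_recl mulSn; apply: msizeM_bound => //; apply: IH => i.
Qed.

Lemma mnm_le_mdeg m (x : 'X_{1..m}) i : (x i <= mdeg x)%N.
Proof. by rewrite mdegE (bigD1 i) //= leq_addr. Qed.

Lemma card_bmultinom m b : (#|{: 'X_{1..m < b}}| <= b ^ m)%N.
Proof.
pose f (x : 'X_{1..m < b}) : {ffun 'I_m -> 'I_b} :=
  [ffun i => Ordinal (leq_ltn_trans (mnm_le_mdeg (bmnm x) i) (bmdeg x))].
rewrite -[X in (X ^ m)%N](card_ord b) -[X in (_ ^ X)%N](card_ord m) -card_ffun.
apply: (@leq_card _ _ f) => x y /ffunP e.
apply: val_inj; apply/mnmP => i.
by have /(congr1 val) := e i; rewrite !ffunE.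
Qed.

(** More than m fractions in m variables are algebraically dependent: the
    monomials of degree less than D in each of them span, over a common
    denominator, a space of polynomials of degree O(D) in m variables, and
    there are D ^ (m + 1) of these monomials. *)
Lemma algebraic_dependence (K : fieldType) m (F : 'I_m.+1 -> {mpoly K[m]})
    (G : 'I_m.+1 -> {mpoly K[m]}) :
  (forall i, G i != 0) ->
  exists2 Q : {mpoly K[m.+1]}, Q != 0 &
  forall (L : fieldType) (iota : {rmorphism K -> L})
    (phi : {rmorphism {mpoly K[m]} -> L}) (v : 'I_m.+1 -> L),
    (forall c, iota c = phi c%:MP) -> injective phi ->
    (forall i, v i * phi (G i) = phi (F i)) -> mmap iota v Q = 0.
Proof.
move=> G0.
(* N bounds all degrees, and D is so large that the D ^ (m + 1) products P e
   outnumber the at most (D (m + 1) N + 1) ^ m monomials occurring in them. *)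
pose N := (\max_i maxn (msize (F i)) (msize (G i)))%N.
pose D := (((m.+1 * N).+1 ^ m).+1)%N.
pose B := (m.+1 * (D * N)).+1.
pose P (e : {ffun 'I_m.+1 -> 'I_D}) := \prod_i (F i ^+ e i * G i ^+ (D - e i)).
have sF i : (msize (F i) <= N.+1)%N.
  by rewrite leqW // (leq_trans _ (leq_bigmax i)) // leq_maxl.
have sG i : (msize (G i) <= N.+1)%N.
  by rewrite leqW // (leq_trans _ (leq_bigmax i)) // leq_maxr.
have sP e : (msize (P e) <= B)%N.
  apply: msize_prod_bound => i.
  have -> : (D * N = e i * N + (D - e i) * N)%N.
    by rewrite -mulnDl subnKC // ltnW.
  by  apply: msizeM_bound; apply: msizeX_bound.
pose I := {ffun 'I_m.+1 -> 'I_D}; pose J : finType := 'X_{1..m < B}.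
pose M : 'M[K]_(#|{: I}|, #|{: J}|) :=
  \matrix_(a, b) (P (enum_val a))@_(bmnm (enum_val b)).
have cJI : (#|{: J}| < #|{: I}|)%N.
  apply: leq_ltn_trans (card_bmultinom m B) _.
  rewrite card_ffun !card_ord expnS.
  have BD : (B <= D * (m.+1 * N).+1)%N.
    by rewrite /B mulnCA mulnS -add1n leq_add2r.
  apply: (@leq_ltn_trans ((D * (m.+1 * N).+1) ^ m)%N).
    have mono a b k : (a <= b)%N -> (a ^ k <= b ^ k)%N.
      by case: k => // k ab; rewrite leq_exp2r.
    exact: mono.
  by rewrite expnMn mulnC ltn_pmul2r ?expn_gt0 // ltnS.
have [c cM c0] : exists2 c : 'rV[K]_(#|{: I}|), c *m M = 0 & c != 0.
  have : kermx M != 0.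
    rewrite -mxrank_eq0 mxrank_ker -lt0n subn_gt0.
    exact: leq_ltn_trans (rank_leq_col M) cJI.
  by case/rowV0Pn => c /sub_kermxP cM c0; exists c.
pose ce (e : I) := c 0 (enum_rank e).
have cP : \sum_(e : I) ce e *: P e = 0.
  apply/mpolyP => x; rewrite raddf_sum mcoeff0 /=.
  have [xB|xB] := ltnP (mdeg x) B; last first.
    rewrite big1 // => e _; rewrite mcoeffZ memN_msupp_eq0 ?mulr0 //.
    by apply: msize_mdeg_ge; apply: leq_trans xB.
  transitivity ((c *m M) 0 (enum_rank (BMultinom xB : J))); last first.
    by rewrite cM mxE.
  rewrite mxE (reindex enum_rank) /=; last first.
    by apply: onW_bij; apply: enum_rank_bij.
  by apply: eq_bigr => e _; rewrite mxE !enum_rankK mcoeffZ.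
pose mono (e : I) : 'X_{1..m.+1} := [multinom (e i : nat) | i < m.+1].
pose Q : {mpoly K[m.+1]} := \sum_(e : I) ce e *: 'X_[mono e].
have mono_inj : injective mono.
  move=> e e' h; apply/ffunP => i; apply: val_inj.
  by have := congr1 (fun x : 'X_{1..m.+1} => x i) h; rewrite !mnmE.
exists Q.
  apply: contraNneq c0 => Q0; apply/eqP/rowP => a; rewrite mxE.
  have := congr1 (mcoeff (mono (enum_val a))) Q0.
  rewrite mcoeff0 raddf_sum (bigD1 (enum_val a)) //= big1 => [|e ne].
    by rewrite mcoeffZ mcoeffX eqxx mulr1 addr0 /ce enum_valK.
  by rewrite mcoeffZ mcoeffX (inj_eq mono_inj) (negbTE ne) mulr0.
move=> L iota phi v hi inj hv.
have Gn i : phi (G i) != 0 by rewrite -(rmorph0 phi) (inj_eq inj).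
have PG : \prod_i phi (G i) ^+ D != 0.
  by apply/prodf_neq0 => i _; rewrite expf_neq0.
apply: (mulIf PG); rewrite mul0r -(rmorph0 phi) -cP !rmorph_sum /= mulr_suml.
apply: eq_bigr => e _; rewrite mmapZ mmapX -mul_mpolyC rmorphM /= -hi -mulrA.
congr (_ * _); rewrite /mmap1 -big_split /= rmorph_prod; apply: eq_bigr => i _.
rewrite mnmE rmorphM !rmorphXn /= -hv exprMn -mulrA -exprD subnKC //.
exact: ltnW.
Qed.

Section LastVariable.
Variables (K : fieldType) (n : nat).

Definition split_var (i : 'I_n.+1) : {poly {mpoly K[n]}} :=
  if unlift ord_max i is Some j then ('X_j)%:P else 'X.

(** A polynomial in n + 1 variables as a polynomial in the last of them. *)
Definition split_last : {mpoly K[n.+1]} -> {poly {mpoly K[n]}} :=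
  mmap (polyC \o @mpolyC n K) split_var.

Lemma split_last_eval (R : comNzRingType) (iota : {rmorphism K -> R})
  (x : 'I_n.+1 -> R) Q :
  mmap iota x Q =
  (map_poly (mmap iota (fun j => x (lift ord_max j))) (split_last Q)).[x ord_max].
Proof.
pose ev : {poly {mpoly K[n]}} -> R := horner_eval (x ord_max) \o
  map_poly (mmap iota (fun j => x (lift ord_max j))).
have -> : mmap iota x Q = (ev \o split_last) Q.
  apply/esym; apply: mmap_unique => [c|i] /=.
    by rewrite /split_last mmapC /ev /= map_polyC /= /horner_eval hornerC mmapC.
  rewrite /split_last mmap_XU /split_var /ev /=; case: unliftP => [j ->|->].
    by rewrite map_polyC /= /horner_eval hornerC mmap_XU.
  by rewrite map_polyX /horner_eval hornerX.
by [].
Qed.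

Lemma split_last_neq0 Q : Q != 0 -> split_last Q != 0.
Proof.
apply: contraNneq => h.
have e : Q = mmap (@mpolyC n.+1 K) (fun i => 'X_i) Q.
  by apply: (mmap_unique (phi := [the {rmorphism _ -> _} of idfun])).
by rewrite e split_last_eval h rmorph0 horner0.
Qed.

End LastVariable.

Section PrimeChain.
Variables (K : fieldType) (R : comNzRingType) (iota : {rmorphism K -> R}).

(** The element z with the largest index lies in I_1 and not in I_0. Written
    as a polynomial in z, a relation modulo I_0 without constant term can be
    divided by z; otherwise its constant term is a nonzero relation modulo I_1
    between the other elements. In the end a nonzero constant would lie in
    I_n. *)
Lemma prime_chain_independent n (I : nat -> set R) (x : 'I_n -> R)
    (Q : {mpoly K[n]}) :
  (forall k f g, (k <= n)%N -> I k f -> I k g -> I k (f + g)) ->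
  (forall k f g, (k <= n)%N -> I k f -> I k (f * g)) ->
  (forall k f g, (k <= n)%N -> I k (f * g) -> I k f \/ I k g) ->
  (forall k, (k <= n)%N -> ~ I k 1) ->
  (forall k f, (k < n)%N -> I k f -> I k.+1 f) ->
  (forall i : 'I_n, I (n - i)%N (x i)) ->
  (forall i : 'I_n, ~ I (n - i.+1)%N (x i)) ->
  Q != 0 -> ~ I 0%N (mmap iota x Q).
Proof.
elim: n I x Q => [|n IH] I x Q ID IM IP I1 IS xI xN Q0.
  have [c e] : exists c, Q = c%:MP.
    exists Q@_0%MM; apply/mpolyP => m; have -> : m = 0%MM by apply/mnmP => -[].
    by rewrite mcoeffC eqxx mulr1.
  rewrite e mmapC => h; apply: (I1 0%N) => //.
  have c0 : c != 0 by apply: contraNneq Q0 => c0; rewrite e c0 mpolyC0.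
  by have := IM 0%N _ (iota c^-1) isT h; rewrite -rmorphM /= divff ?rmorph1.
rewrite split_last_eval; set ev := mmap _ _; set z := x ord_max.
have evN (q : {mpoly K[n]}) : q != 0 -> ~ I 1%N (ev q).
  move=> q0; apply: (IH (fun k => I k.+1) (fun j => x (lift ord_max j))) => //.
  - by move=> k f g kn; apply: ID.
  - by move=> k f g kn; apply: IM.
  - by move=> k f g kn; apply: IP.
  - by move=> k kn; apply: I1.
  - by move=> k f kn; apply: IS.
  - by move=> i; have := xI (lift ord_max i); rewrite lift_max subSn // ltnW.
  - move=> i; have := xN (lift ord_max i); rewrite lift_max subSS.
    by rewrite -subSn // subSS.
have zI : I 1%N z by have := xI ord_max; rewrite subSn // subnn.
have zN : ~ I 0%N z by have := xN ord_max; rewrite subnn.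
have := split_last_neq0 Q0; move: (split_last Q) => p.
elim/poly_ind: p => [|p c IHp]; first by rewrite eqxx.
rewrite rmorphD rmorphM /= map_polyX map_polyC /= hornerMXaddC.
have [->|c0 _ h] := eqVneq c 0.
  rewrite polyC0 addr0 mulf_eq0 polyX_eq0 orbF rmorph0 addr0 => p0 /IP[] //.
  exact: IHp.
apply: (evN c c0).
have h1 := IS 0%N _ isT h.
have e : ev c = (map_poly ev p).[z] * z + ev c + z * (- (map_poly ev p).[z]).
  by ring.
by rewrite e; apply: ID => //; apply: IM.
Qed.

End PrimeChain.

(** * Closures of points and dimension *)

Lemma irreducible_finite_union (T : topologicalType) (I : eqType) (s : seq I)
    (F : I -> set T) (Z : set T) :
  irreducible Z -> (forall i, closed (F i)) ->
  (forall x, Z x -> exists2 i, i \in s & F i x) ->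
  exists2 i, i \in s & (Z `<=` F i)%classic.
Proof.
move=> [[z Zz] irr] cF; elim: s => [/(_ z Zz)[] //|i s IH] cov.
pose G (s : seq I) := [set x | exists2 j, j \in s & F j x]%classic.
have cG : closed (G s).
  elim: (s) => [|j s' IHs].
    rewrite (_ : G [::] = set0); first exact: closed0.
    by apply/predeqP => x; split=> // -[].
  rewrite (_ : G (j :: s') = (F j `|` G s')%classic); first exact: closedU.
  apply/predeqP => x; split=> [[k]|[Fj|[k ks Fk]]].
  - rewrite inE => /orP[/eqP -> Fj|ks Fk]; first by left.
    by right; exists k.
  - by exists j; rewrite ?mem_head.
  - by exists k; rewrite // inE ks orbT.
have [x Zx|Zi|ZG] := irr (F i) (G s) (cF i) cG.
- have [j + Fj] := cov x Zx; rewrite inE => /orP[/eqP <-|js]; first by left.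
  by right; exists j.
- by exists i; rewrite ?mem_head.
- have [x /ZG//|j js Zj] := IH.
  by exists j; rewrite // inE js orbT.
Qed.

Lemma has_dim_between (T : topologicalType) (Z : set T) a b :
  irreducible_chain Z a -> (forall m, irreducible_chain Z m -> (m <= b)%N) ->
  exists2 m, has_dim Z m & (a <= m <= b)%N.
Proof.
move=> ha hb.
have ex : exists m, `[< irreducible_chain Z m >] by exists a; apply/asboolP.
have ub m : `[< irreducible_chain Z m >] -> (m <= b)%N by move/asboolP; apply: hb.
case: (ex_maxnP ex ub) => m /asboolP hm mx; exists m.
  by split=> // m' h; apply: mx; apply/asboolP.
by rewrite hb // andbT mx //; apply/asboolP.
Qed.

Lemma has_dim_unique (T : topologicalType) (Z : set T) m n :
  has_dim Z m -> has_dim Z n -> m = n.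
Proof.
by case=> cm mm [cn mn]; apply/eqP; rewrite eqn_leq mm // mn.
Qed.

Section Subspace.
Variables (K : fieldType) (d : nat) (X : set (flag_point K 3 d)).
Implicit Types (x y : X) (Z : set X).

(** The closure of x in the subspace X. *)
Definition specializations (x : flag_point K 3 d) : set X :=
  [set y : X | spec x (set_val y)]%classic.

Lemma closed_specializations (x0 : flag_point K 3 d) : closed (specializations x0).
Proof.
have -> : specializations x0 = (set_val @^-1` (closure [set x0]))%classic.
  by apply/predeqP => y; split=> /spec_closure.
apply: preimage_closed; last exact: closed_closure.
by move=> y _; apply: initial_continuous.
Qed.

Lemma closed_spec Z x y : closed Z -> Z x -> spec (set_val x) (set_val y) -> Z y.
Proof.
move=> cZ Zx /spec_closure s; apply: contrapT => nZ.
have oC : open (~` Z)%classic by rewrite openC.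
case: (oC) => V oV VE.
have Vy : V (set_val y) by move: nZ; rewrite -[~ Z y]/((~` Z)%classic y) -VE.
have [z [-> Vx]] := s V (open_nbhs_nbhs (conj oV Vy)).
have : (set_val @^-1` V)%classic x by [].
by rewrite VE => /(_ Zx).
Qed.

Lemma irreducible_specializations x :
  irreducible (specializations (set_val x)).
Proof.
split=> [|A B cA cB cov]; first by exists x; apply: spec_refl.
have [Ax|Bx] : (A `|` B)%classic x by apply: cov; apply: spec_refl.
  by left=> y; apply: closed_spec Ax.
by right=> y; apply: closed_spec Bx.
Qed.

Definition vanishing_on (w : chart 3 d) Z : set (chart_ring K 3 d) :=
  [set f | forall y, Z y -> in_chart w (set_val y) -> prime_at (set_val y) w f]%classic.

Lemma prime_atD (x : flag_point K 3 d) w f g :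
  prime_at x w f -> prime_at x w g -> prime_at x w (f + g).
Proof.
have [L [iota [p [l dx]]]] := defines_exists x.
move=> /(dx.2 w)[u hu f0] /(prime_atP dx g hu) g0.
by apply/(prime_atP dx _ hu); rewrite rmorphD /= f0 g0 addr0.
Qed.

Lemma vanishing_on_prime w Z f g : irreducible Z ->
  vanishing_on w Z (f * g) -> vanishing_on w Z f \/ vanishing_on w Z g.
Proof.
move=> [_ irr] h.
pose V f := [set y : X | ~ basic_set w f (set_val y)]%classic.
have cV f0 : closed (V f0).
  rewrite -openC; exists (basic_set w f0); first exact: basic_set_open.
  by apply/predeqP => y; rewrite /V /setC /=; split=> [b|/contrapT].
have VE f0 : (Z `<=` V f0)%classic -> vanishing_on w Z f0.
  by move=> sub y Zy yw; apply: contrapT => nf; apply: (sub y Zy); split.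
have [y Zy|/VE|/VE] := irr _ _ (cV f) (cV g); [|by left|by right].
have [yw|nyw] := pselect (in_chart w (set_val y)); last by left=> -[].
by have /prime_at_prime[hf|hg] := h y Zy yw; [left|right] => -[].
Qed.

(** An irreducible set that meets a chart is not covered by a smaller closed
    set and the complement of the chart, and within the chart closed sets are
    zero loci. *)
Lemma vanishing_on_strict w Z Z' x : closed Z -> irreducible Z' ->
  (Z `<` Z')%classic -> Z x -> in_chart w (set_val x) ->
  exists2 f, vanishing_on w Z f & ~ vanishing_on w Z' f.
Proof.
move=> cZ irr [ZZ' nZ'Z] Zx xw.
pose C := [set y : X | ~ basic_set w 1 (set_val y)]%classic.
have cC : closed C.
  rewrite -openC; exists (basic_set w 1); first exact: basic_set_open.
  by apply/predeqP => y; rewrite /C /setC /=; split=> [b|/contrapT].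
have CE y : C y <-> ~ in_chart w (set_val y).
  split=> [h yw|h []//]; apply: h; split=> //; exact: prime_at_proper.
have [y [Z'y yw nZy]] : exists y, [/\ Z' y, in_chart w (set_val y) & ~ Z y].
  apply: contrapT => no.
  have [y Z'y|//|sub] := irr.2 Z C cZ cC; last first.
    by have /CE := sub x (ZZ' x Zx); apply.
  have [Zy|nZy] := pselect (Z y); first by left.
  by right; apply/CE => yw; apply: no; exists y.
have oC : open (~` Z)%classic by rewrite openC.
case: (oC) => V oV VE.
have [I hI] := (oV : zariski_open V) w.
have nI z : in_chart w (set_val z) -> ~ Z z <-> ~ (I `<=` prime_at (set_val z) w)%classic.
  by move=> zw; rewrite -(hI _ zw) -[~ Z z]/((~` Z)%classic z) -VE.
have /existsNP[f /not_implyP[If nf]] := (nI y yw).1 nZy.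
exists f; last by move=> /(_ y Z'y yw).
move=> z Zz zw; apply: contrapT => nz.
by have := (nI z zw).2 (fun sub => nz (sub f If)); apply.
Qed.

(** A chain of m + 2 irreducible closed sets would give a chain of primes on a
    chart, and functions separating them; by prime_chain_independent these are
    algebraically independent at x. But their values at x are fractions in m
    variables, which contradicts algebraic_dependence. *)
Lemma dimension_le m (x : flag_point K 3 d) (L : fieldType)
    (iota : {rmorphism K -> L}) (phi : {rmorphism {mpoly K[m]} -> L})
    (P N : 'I_d -> 'rV[{mpoly K[m]}]_3) Z r :
  (forall c, iota c = phi c%:MP) -> injective phi ->
  defines x iota (fun j => map_mx phi (P j)) (fun j => map_mx phi (N j)) ->
  (Z `<=` specializations x)%classic -> irreducible_chain Z r -> (r <= m)%N.
Proof.
move=> hi inj dx Zx [c [cc cs]]; rewrite leqNgt; apply/negP => mr.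
have sub i j : (i <= j <= r)%N -> (c i `<=` c j)%classic.
  elim: j => [|j IH]; first by rewrite leqn0 => /andP[/eqP -> _] y.
  move=> /andP[]; rewrite leq_eqVlt => /orP[/eqP -> _ y //|ij jr].
  apply: (subset_trans (IH _)).
    by apply/andP; split; [rewrite -ltnS|apply: ltnW].
  by have [] := cs j jr.
have [_ [[x0 c0] _] _] := cc 0%N isT.
have [w xw] := chart_cover (set_val x0).
have cx0 i : (i <= r)%N -> c i x0 by move=> ir; apply: (sub 0%N i _ _ c0).
have cZ i y : (i <= r)%N -> c i y -> specializations x y.
  by move=> ir cy; apply: Zx; have [_ _] := cc i ir; apply.
have xI : in_chart w x by have [] := cZ 0%N _ isT c0 w xw.
pose I k := vanishing_on w (c (m.+1 - k)%N).
have bd k : (m.+1 - k <= r)%N by rewrite (leq_trans (leq_subr _ _)).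
have step (i : 'I_m.+1) : exists f, I (m.+1 - i)%N f /\ ~ I (m.+1 - i.+1)%N f.
  have [cl ir _] := cc i (leq_trans (ltnW (ltn_ord i)) mr).
  have [_ ir' _] := cc i.+1 (leq_trans (ltn_ord i) mr).
  have [f f1 f2] := vanishing_on_strict cl ir' (cs i (leq_trans (ltn_ord i) mr))
    (cx0 _ (leq_trans (ltnW (ltn_ord i)) mr)) xw.
  exists f; rewrite /I subKn ?(ltnW (ltn_ord i)) //.
  by rewrite subKn.
have [f hf] := choice step.
have FG i := universal_fraction (@mpolyC m K) w P N (f i).
have [F hF] := choice FG; have [G {}FG] := choice hF.
have [u hu] := (in_chartP dx w).1 xI.
have G0 i : G i != 0.
  have [Gn _] := FG i L iota phi u hi hu.
  by apply: contraNneq Gn => ->; rewrite rmorph0.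
have [Q Q0 hQ] := algebraic_dependence F G0.
have := @prime_chain_independent K (chart_ring K 3 d) (@mpolyC _ K) m.+1 I f Q.
apply=> //.
- by move=> k f1 f2 _ h1 h2 y cy yw; apply: prime_atD; [apply: h1|apply: h2].
- by move=> k f1 f2 _ h y cy yw; apply/prime_at_prime; left; apply: h.
- by move=> k f1 f2 _; apply: vanishing_on_prime; have [] := cc _ (bd k).
- by move=> k _ /(_ x0 (cx0 _ (bd k)) xw); apply: prime_at_proper.
- move=> k g km h y cy; apply: h; apply: sub cy; rewrite bd andbT.
  by rewrite leq_sub2l.
- by move=> i; have [] := hf i.
- by move=> i; have [] := hf i.
move=> y cy yw.
have [_ sxy] := cZ _ _ (bd 0%N) cy w yw.
apply: sxy; apply/(prime_atP dx _ hu).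
have -> : mmap iota u (mmap (@mpolyC _ K) f Q) =
    mmap iota (fun i => mmap iota u (f i)) Q.
  apply: (mmap_unique (phi := mmap iota u \o mmap (@mpolyC _ K) f)) => [a|i] /=.
    by rewrite !mmapC.
  by rewrite mmap_XU.
apply: (hQ L iota phi) => // i.
by have [_ ->] := FG i L iota phi u hi hu.
Qed.

(** The closures of successive proper specializations form a strictly
    decreasing chain of irreducible closed sets. *)
Lemma chain_of_specializations (z : nat -> X) Z r :
  (forall i, (i < r)%N -> spec (set_val (z i)) (set_val (z i.+1)) /\
     ~ spec (set_val (z i.+1)) (set_val (z i))) ->
  (specializations (set_val (z 0%N)) `<=` Z)%classic -> irreducible_chain Z r.
Proof.
move=> hz Z0; exists (fun i => specializations (set_val (z (r - i)%N))); split.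
  move=> i ir; split; first exact: closed_specializations.
    exact: irreducible_specializations.
  move=> y zy; apply: Z0; apply: spec_trans zy.
  elim: (r - i)%N (leq_subr i r) => [_|k IH kr]; first exact: spec_refl.
  by apply: spec_trans (IH (ltnW kr)) (hz k kr).1.
move=> i ir; have lt : (r - i.+1 < r)%N.
  by rewrite ltn_subrL (leq_ltn_trans _ ir).
have [s ns] := hz _ lt.
rewrite (_ : r - i = (r - i.+1).+1)%N; last by rewrite -subSn // subSS.
split=> [y|sub]; first exact: spec_trans.
by apply: ns; apply: sub; apply: spec_refl.
Qed.

End Subspace.

(** * Webs of triangles *)

Lemma rowmul3 (R : comNzRingType) (v : 'rV[R]_3) (g : 'M[R]_3) :
  v *m g = v 0 i0 *: row i0 g + v 0 i1 *: row i1 g + v 0 i2 *: row i2 g.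
Proof.
by apply: row3P; rewrite !mxE sum3.
Qed.

Section Web.
Variables (A B T : finType) (al : T -> 'I_3 -> A) (be : T -> 'I_3 -> B).
Hypothesis al_inj : forall t, injective (al t).
Hypothesis be_inj : forall t, injective (be t).
Hypothesis be_surj : forall s, exists t c, be t c = s.
Variable t0 : T.

(** The line at infinity, the verticals x = a, and the three sides y = b x + e
    of each triangle. A triangle t has its vertices on the verticals al t c
    and its sides have slopes be t c, the vertex c being opposite to the side
    c. *)
Definition wline : finType := option (A + T * 'I_3)%type.

Definition web_mark (l : wline) : wline :=
  if l is Some _ then None else Some (inl (al t0 i0)).

(** The points where three lines are forced to meet: the common point of the
    verticals, the point at infinity of each slope, and the vertex of each
    triangle opposite to each side. *)
Definition wpoint : finType := option (B + T * 'I_3)%type.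

Definition on (p : wpoint) (l : wline) : bool :=
  match p, l with
  | None, None => true
  | None, Some (inl _) => true
  | None, Some (inr _) => false
  | Some (inl s), None => true
  | Some (inl s), Some (inl _) => false
  | Some (inl s), Some (inr (t, c)) => be t c == s
  | Some (inr (t, c)), None => false
  | Some (inr (t, c)), Some (inl v) => v == al t c
  | Some (inr (t, c)), Some (inr (t', c')) => (t' == t) && (c' != c)
  end.

Definition web_conc (i j k : wline) : bool :=
  [|| i == j, j == k, i == k | [exists p, [&& on p i, on p j & on p k]]].

Lemma web_concC i j k : web_conc j i k = web_conc i j k.
Proof.
rewrite /web_conc [j == i]eq_sym; congr (_ || _).
rewrite orbCA; congr (_ || (_ || _)).
by apply: eq_existsb => p; rewrite andbCA.
Qed.

Lemma web_concA i j k : web_conc i k j = web_conc i j k.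
Proof.
rewrite /web_conc [k == j]eq_sym orbCA [RHS]orbCA; congr (_ || _).
rewrite orbCA; congr (_ || (_ || _)).
by apply: eq_existsb => p; rewrite [on p k && _]andbC.
Qed.

Lemma web_mark_neq l : web_mark l != l.
Proof. by case: l. Qed.

Lemma web_off i j : i != j -> exists k, ~~ web_conc i j k.
Proof.
have nex (P : pred wpoint) : P None = false -> (forall s, P (Some (inl s)) = false) ->
    (forall q, P (Some (inr q)) = false) -> [exists p, P p] = false.
  by move=> h0 h1 h2; apply/existsP => -[[[s|q]|]]; rewrite ?h0 ?h1 ?h2.
move=> ij; rewrite /web_conc (negbTE ij) /=.
case: i j ij => [[v|[t c]]|] [[v'|[t' c']]|] // ij.
- exists (Some (inr (t0, i0))); rewrite /= nex //= => q; rewrite ?andbF //.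
  case: q => u x; apply/and3P => -[/eqP e /eqP e' _].
  by move: ij; rewrite e e' eqxx.
- exists None; rewrite /= nex //= => q; rewrite ?andbF //; case: q => u x; rewrite ?andbF //.
- exists (Some (inr (t0, i0))); rewrite /= nex //= => q; rewrite ?andbF //; case: q => u x; rewrite ?andbF //.
- exists None; rewrite /= nex //= => q; rewrite ?andbF //; case: q => u x; rewrite ?andbF //.
- case: (eqVneq (be t c) (be t' c')) => [e|ne].
    exists (Some (inl (al t (if c == i0 then i1 else i0)))).
    rewrite /= nex //= => q; rewrite ?andbF //.
    case: q => u x; apply/and3P => -[/andP[/eqP e1 _] /andP[/eqP e2 _] _].
    move: e ij; rewrite e1 e2 => /be_inj ->.
    by rewrite eqxx.
  exists None; rewrite /= nex //= => q; rewrite ?andbF ?andbT //.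
    by apply/andP => -[/eqP e1 /eqP e2]; move: ne; rewrite e1 e2 eqxx.
  by case: q => u x; rewrite !andbF.
- exists (Some (inl (al t0 i0))); rewrite /= nex //= => q; rewrite ?andbF //; case: q => u x; rewrite ?andbF //.
- exists (Some (inr (t0, i0))); rewrite /= nex //= => q; rewrite ?andbF //; case: q => u x; rewrite ?andbF //.
- exists (Some (inl (al t0 i0))); rewrite /= nex //= => q; rewrite ?andbF //; case: q => u x; rewrite ?andbF //.
Qed.

Section Model.
Variables (R : comNzRingType) (a : A -> R) (b : B -> R) (y : T -> R).

(** The intercepts of the sides of a triangle, chosen so that its first two
    pairs of sides meet on their verticals. *)
Definition offset t (c : 'I_3) : R :=
  match val c with
  | 0 => y t
  | 1 => y t - (b (be t i1) - b (be t i0)) * a (al t i2)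
  | _ => y t + (b (be t i0) - b (be t i2)) * a (al t i1)
  end.

(** The third pair of sides meets on its vertical when the slopes of the sides
    and the abscissas of the opposite vertices are affinely equivalent. *)
Definition closes t : Prop :=
  (b (be t i1) - b (be t i0)) * a (al t i2)
  + (b (be t i2) - b (be t i1)) * a (al t i0)
  + (b (be t i0) - b (be t i2)) * a (al t i1) = 0.

Definition model_line (l : wline) : 'rV[R]_3 :=
  match l with
  | None => vec3 0 0 1
  | Some (inl v) => vec3 1 0 (- a v)
  | Some (inr (t, c)) => vec3 (- b (be t c)) 1 (- offset t c)
  end.

Lemma sides_meet t c c' c'' : closes t -> c != c' -> c'' != c -> c'' != c' ->
  offset t c - offset t c' = (b (be t c') - b (be t c)) * a (al t c'').
Proof.
move=> cl; move: c c' c''; apply: ord3P; apply: ord3P; apply: ord3P => //= _ _ _;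
rewrite /offset /=; try ring.
- rewrite -[LHS]addr0 -{}cl; ring.
- rewrite -[LHS]subr0 -{}cl; ring.
Qed.

Definition model_point (p : wpoint) : 'rV[R]_3 :=
  match p with
  | None => vec3 0 1 0
  | Some (inl s) => vec3 1 (b s) 0
  | Some (inr (t, c)) => let c' := if c == i0 then i1 else i0 in
      vec3 (a (al t c)) (b (be t c') * a (al t c) + offset t c') 1
  end.

Lemma model_point_on p l : (forall t, closes t) -> on p l ->
  dot (model_point p) (model_line l) = 0.
Proof.
move=> cl; rewrite /dot; case: p l => [[s|[t c]]|] [[v|[t' c']]|] //=;
  rewrite ?vec3E; try by move=> _; ring.
- by move=> /eqP ->; ring.
- by move=> /eqP ->; ring.
case/andP=> /eqP -> ne; set c1 := if c == i0 then i1 else i0.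
have n1 : c != c1 by rewrite /c1; move: (c); apply: ord3P.
have [->|ne1] := eqVneq c' c1; first by ring.
have := sides_meet (cl t) ne1 _ n1; rewrite eq_sym => /(_ ne) e.
have -> : offset t c1 = offset t c' - (b (be t c1) - b (be t c')) * a (al t c).
  by rewrite -e; ring.
by ring.
Qed.

Lemma model_conc i j k : (forall t, closes t) -> web_conc i j k ->
  br (model_line i) (model_line j) (model_line k) = 0.
Proof.
move=> cl /or4P[/eqP <-|/eqP <-|/eqP <-|/existsP[p /and3P[hi hj hk]]].
- exact: br_same.
- by rewrite /br dot_crossr.
- by rewrite /br dot_crossl.
have [x px] : exists x, model_point p 0 x = 1.
  by case: p {hi hj hk} => [[s|[t c]]|]; [exists i0|exists i2|exists i1];
    rewrite /= vec3E.
by apply: br_zero px _ _ _; apply: model_point_on.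
Qed.

Definition br_msv v t c :
  br (model_line None) (model_line (Some (inl v))) (model_line (Some (inr (t, c)))) = 1.
Proof. by rewrite /br /dot /cross /= !vec3E; ring. Qed.

Lemma br_mss t c t' c' :
  br (model_line None) (model_line (Some (inr (t, c))))
    (model_line (Some (inr (t', c')))) = b (be t' c') - b (be t c).
Proof. by rewrite /br /dot /cross /= !vec3E; ring. Qed.

Lemma br_vvs v v' t c :
  br (model_line (Some (inl v))) (model_line (Some (inl v')))
     (model_line (Some (inr (t, c)))) = a v' - a v.
Proof. by rewrite /br /dot /cross /= !vec3E; ring. Qed.

Lemma br_vss v t c t' c' :
  br (model_line (Some (inl v))) (model_line (Some (inr (t, c))))
     (model_line (Some (inr (t', c')))) =
  (b (be t c) - b (be t' c')) * a v + offset t c - offset t' c'.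
Proof. by rewrite /br /dot /cross /= !vec3E; ring. Qed.

Lemma br_sss t c t' c' t'' c'' :
  br (model_line (Some (inr (t, c)))) (model_line (Some (inr (t', c'))))
     (model_line (Some (inr (t'', c'')))) =
  (b (be t' c') - b (be t'' c'')) * offset t c
  + (b (be t'' c'') - b (be t c)) * offset t' c'
  + (b (be t c) - b (be t' c')) * offset t'' c''.
Proof. by rewrite /br /dot /cross /= !vec3E; ring. Qed.

End Model.
End Web.

(** * Arrangements with the concurrent triples of a web *)

Section WebGeometry.
Variables (A B T : finType) (al : T -> 'I_3 -> A) (be : T -> 'I_3 -> B).
Hypothesis al_inj : forall t, injective (al t).
Hypothesis be_inj : forall t, injective (be t).
Hypothesis be_surj : forall s, exists t c, be t c = s.
Variable t0 : T.

Local Notation line := (wline A T).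
Local Notation conc := (web_conc al be).

(** The triangles of a web are in general position when each of them can be
    translated vertically without moving the rest of the web. *)
Definition free_triangles (R : comNzRingType) (a : A -> R) (b : B -> R) (y : T -> R) :=
  forall t, exists theta : {rmorphism R -> R},
    [/\ forall v, theta (a v) = a v, forall s, theta (b s) = b s
      & forall t', theta (y t') = y t' + (t' == t)%:R].

Section Generic.
Variables (R : idomainType) (a : A -> R) (b : B -> R) (y : T -> R).
Hypothesis a_inj : injective a.
Hypothesis b_inj : injective b.
Hypothesis cl : forall t, closes al be a b t.
Hypothesis free : free_triangles a b y.

Local Notation ml := (model_line al be a b y).
Local Notation off := (offset al be a b y).

Lemma theta_offset t (theta : {rmorphism R -> R}) :
  (forall v, theta (a v) = a v) -> (forall s, theta (b s) = b s) ->
  (forall t', theta (y t') = y t' + (t' == t)%:R) ->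
  forall t' c, theta (off t' c) = off t' c + (t' == t)%:R.
Proof.
move=> ha hb hy t' c; rewrite /offset.
case: (val c) => [|[|k]]; first exact: hy.
  by rewrite rmorphB rmorphM rmorphB /= ha !hb hy; ring.
by rewrite rmorphD rmorphM rmorphB /= ha !hb hy; ring.
Qed.

(** If a vertical passes through the meeting point of two sides, these belong
    to one triangle, since otherwise one of them can be translated alone; then
    the vertical is the one through their common vertex. *)
Lemma vertical_sides v t c t' c' : (t, c) != (t', c') ->
  (b (be t c) - b (be t' c')) * a v + off t c - off t' c' = 0 ->
  conc (Some (inl v)) (Some (inr (t, c))) (Some (inr (t', c'))).
Proof.
move=> ne h; have [e|nt] := eqVneq t t'; last first.
  have [theta [ha hb hy]] := free t.
  have := congr1 theta h; rewrite !(rmorphD, rmorphN, rmorphM) /= !ha !hb.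
  rewrite !(theta_offset ha hb hy) eqxx eq_sym (negbTE nt) (rmorph0 theta) /= => h'.
  exfalso; have : (1 : R) == 0; last by rewrite oner_eq0.
  by apply/eqP; rewrite -[RHS]subr0 -{1}h' -h; ring.
subst t'; have cc : c != c' by apply: contraNneq ne => ->.
have [c'' n1 n2] : exists2 c'' : 'I_3, c'' != c & c'' != c'.
  move: (c) (c') cc; apply: ord3P; apply: ord3P => // _;
  by [exists i0|exists i1|exists i2].
have := sides_meet y (cl t) cc n1 n2 => e.
have : (b (be t c) - b (be t c')) * (a v - a (al t c'')) == 0.
  have -> : (b (be t c) - b (be t c')) * (a v - a (al t c'')) =
    (b (be t c) - b (be t c')) * a v + off t c - off t c'
    - (off t c - off t c' - (b (be t c') - b (be t c)) * a (al t c'')) by ring.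
  by rewrite h e subrr subr0.
rewrite mulf_eq0 !subr_eq0 (inj_eq b_inj) (inj_eq (@be_inj t)) (negbTE cc) /=.
rewrite (inj_eq a_inj) => /eqP ->; apply/or4P/Or44/existsP.
exists (Some (inr (t, c''))); rewrite /= !eqxx /=.
by rewrite eq_sym n1 eq_sym n2.
Qed.

(** Translating the triangles one at a time shows that three concurrent sides
    are parallel or belong to one triangle, and three sides of a triangle are
    not concurrent. *)
Lemma three_sides t c t' c' t'' c'' :
  (t, c) != (t', c') -> (t', c') != (t'', c'') -> (t, c) != (t'', c'') ->
  (b (be t' c') - b (be t'' c'')) * off t c
  + (b (be t'' c'') - b (be t c)) * off t' c'
  + (b (be t c) - b (be t' c')) * off t'' c'' = 0 ->
  conc (Some (inr (t, c))) (Some (inr (t', c'))) (Some (inr (t'', c''))).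
Proof.
move=> n1 n2 n3 h.
have slope (u : T) : (b (be t' c') - b (be t'' c'')) * (t == u)%:R
  + (b (be t'' c'') - b (be t c)) * (t' == u)%:R
  + (b (be t c) - b (be t' c')) * (t'' == u)%:R = 0.
  have [theta [ha hb hy]] := free u.
  have := congr1 theta h; rewrite !(rmorphD, rmorphN, rmorphM) /= !hb.
  rewrite !(theta_offset ha hb hy) (rmorph0 theta) => h'.
  by rewrite -[RHS]subr0 -{1}h' -h; ring.
have par s : be t c = s -> be t' c' = s -> be t'' c'' = s ->
  conc (Some (inr (t, c))) (Some (inr (t', c'))) (Some (inr (t'', c''))).
  move=> e e' e''; apply/or4P/Or44/existsP; exists (Some (inl s)).
  by rewrite /= e e' e'' eqxx.
have two s u x u' x' : be u x = s -> be u' x' = s -> (u, x) != (u', x') -> u != u'.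
  move=> <- e ne; apply: contraNneq ne => uu; rewrite uu in e *.
  by rewrite (be_inj e).
(* parallel sides of different triangles have different intercepts *)
have dif u x u' x' : u != u' -> off u x - off u' x' = 0 -> False.
  move=> uu hh; have [theta [ha hb hy]] := free u.
  have := congr1 theta hh; rewrite rmorphB /= !(theta_offset ha hb hy).
  rewrite eqxx eq_sym (negbTE uu) (rmorph0 theta) /= => h'.
  have : (1 : R) == 0; last by rewrite oner_eq0.
  by apply/eqP; rewrite -[RHS]subr0 -{1}h' -hh; ring.
have fin u x u' x' u'' x'' :
   (u, x) != (u', x') -> be u x = be u' x' ->
   (b (be u x) - b (be u'' x'')) * (off u x - off u' x') = 0 ->
   be u'' x'' = be u x.
  move=> ne e /eqP; rewrite mulf_eq0 => /orP[|/eqP /dif].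
    by rewrite subr_eq0 => /eqP/b_inj.
  by move=> /(_ (two _ _ _ _ _ erefl (esym e) ne)).
have [/(congr1 b) e12|d12] := eqVneq (be t c) (be t' c').
  have e := fin _ _ _ _ t'' c'' n1 (b_inj e12).
  apply: (par (be t c)) => //; first by rewrite (b_inj e12).
  by apply: e; rewrite -h -e12; ring.
have [/(congr1 b) e23|d23] := eqVneq (be t' c') (be t'' c'').
  have e := fin _ _ _ _ t c n2 (b_inj e23).
  suff e' : be t c = be t' c' by rewrite e' eqxx in d12.
  by apply: e; rewrite -h -e23; ring.
have [/(congr1 b) e13|d13] := eqVneq (be t c) (be t'' c'').
  have e := fin _ _ _ _ t' c' n3 (b_inj e13).
  suff e' : be t' c' = be t c by rewrite e' eqxx in d12.
  by apply: e; rewrite -[LHS]opprK -[X in _ = X]oppr0 -h -e13; congr (- _); ring.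
have nz u x u' x' : be u x != be u' x' -> b (be u x) - b (be u' x') != 0.
  by move=> ne; rewrite subr_eq0 (inj_eq b_inj).
(* three sides of different slopes belong to one triangle, and then they do
   not meet *)
have [e1|ne1] := eqVneq t t'; last first.
  have [e2|ne2] := eqVneq t t''; last first.
    move: (slope t); rewrite eqxx eq_sym (negbTE ne1) eq_sym (negbTE ne2).
    rewrite mulr1 !mulr0 !addr0 => /eqP.
    by rewrite (negbTE (nz _ _ _ _ d23)).
  subst t''; move: (slope t'); rewrite eqxx (negbTE ne1) mulr1 !mulr0 addr0 add0r.
  by move/eqP; rewrite eq_sym in d13; rewrite (negbTE (nz _ _ _ _ d13)).
subst t'; have [e2|ne2] := eqVneq t t''; last first.
  move: (slope t''); rewrite eqxx (negbTE ne2) mulr1 !mulr0 !add0r.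
  by move/eqP; rewrite (negbTE (nz _ _ _ _ d12)).
subst t''.
have cc : c != c' by apply: contraNneq n1 => ->.
have cc2 : c' != c'' by apply: contraNneq n2 => ->.
have cc3 : c != c'' by apply: contraNneq n3 => ->.
have E1 := sides_meet y (cl t) cc (_ : c'' != c) (_ : c'' != c').
have E2 := sides_meet y (cl t) cc3 (_ : c' != c) (_ : c' != c'').
move: E1 E2; rewrite eq_sym cc3 eq_sym cc2 eq_sym cc => /(_ isT isT) E1 /(_ isT isT) E2.
have : (b (be t c) - b (be t c')) * (b (be t c'') - b (be t c)) * (a (al t c'') - a (al t c')) == 0.
  apply/eqP; rewrite -[RHS]h.
  have -> : off t c' = off t c - (off t c - off t c') by ring.
  have -> : off t c'' = off t c - (off t c - off t c'') by ring.
  by rewrite E1 E2; ring.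
rewrite !mulf_eq0 !subr_eq0 !(inj_eq b_inj) (inj_eq a_inj) (negbTE d12) eq_sym (negbTE d13).
by rewrite (inj_eq (@al_inj t)) eq_sym (negbTE cc2).
Qed.

(** In general position the only concurrent triples are the forced ones: the
    brackets with three verticals or with the line at infinity only compare
    abscissas or slopes, and the others are treated by vertical_sides and
    three_sides. *)
Lemma model_br0_conc i j k : br (ml i) (ml j) (ml k) = 0 -> conc i j k.
Proof.
have [->|ij] := eqVneq i j; first by rewrite /web_conc eqxx.
have [->|jk] := eqVneq j k; first by rewrite /web_conc eqxx orbT.
have [->|ik] := eqVneq i k; first by rewrite /web_conc eqxx !orbT.
pose C i j k := br (ml i) (ml j) (ml k) = 0 -> conc i j k.
have C12 x u v : C x u v -> C u x v.
  move=> h; rewrite /C web_concC br_swap12 => /eqP.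
  by rewrite oppr_eq0 => /eqP; apply: h.
have C23 x u v : C x u v -> C x v u.
  move=> h; rewrite /C web_concA br_swap23 => /eqP.
  by rewrite oppr_eq0 => /eqP; apply: h.
have Cmvv v v' : C None (Some (inl v)) (Some (inl v')).
  by move=> _; apply/or4P/Or44/existsP; exists None.
have Cmvs v t c : C None (Some (inl v)) (Some (inr (t, c))).
  by rewrite /C br_msv => /eqP; rewrite oner_eq0.
have Cmss t c t' c' : C None (Some (inr (t, c))) (Some (inr (t', c'))).
  rewrite /C br_mss => /subr0_eq/b_inj e; apply/or4P/Or44/existsP.
  by exists (Some (inl (be t c))); rewrite /= e eqxx.
have Cvvv v v' v'' : C (Some (inl v)) (Some (inl v')) (Some (inl v'')).
  by move=> _; apply/or4P/Or44/existsP; exists None.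
have Cvvs v v' t c : C (Some (inl v)) (Some (inl v')) (Some (inr (t, c))).
  rewrite /C br_vvs => /subr0_eq/a_inj ->.
  by rewrite /web_conc eqxx.
have Cvss v t c t' c' : C (Some (inl v)) (Some (inr (t, c))) (Some (inr (t', c'))).
  rewrite /C br_vss; have [<- _|ne] := eqVneq (t, c) (t', c').
    by rewrite /web_conc eqxx orbT.
  exact: vertical_sides.
suff : C i j k by [].
case: i j k ij jk ik => [[v|[t c]]|] [[v'|[t' c']]|] [[v''|[t'' c'']]|] // n1 n2 n3;
  try by [|apply: C23|apply: C12|apply/C12/C23|apply/C23/C12|apply/C12/C23/C12].
rewrite /C br_sss; exact: three_sides.
Qed.

Lemma model_realizes i j k : (br (ml i) (ml j) (ml k) == 0) = conc i j k.
Proof.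
apply/eqP/idP; first exact: model_br0_conc.
exact: model_conc cl.
Qed.

End Generic.

(** The line at infinity, one vertical and one side of a triangle are not
    concurrent, so a projective transformation carries them to the lines x =
    0, y = 0 and infinity. The concurrencies at infinity then make the
    remaining lines vertical or of the prescribed slopes, and the vertices of
    the triangles determine their intercepts. *)
Lemma web_extraction (L : fieldType) (l : line -> 'rV[L]_3) :
  (forall i j k, (br (l i) (l j) (l k) == 0) = conc i j k) ->
  exists (g : 'M[L]_3) (a : A -> L) (b : B -> L) (y : T -> L) (s : line -> L),
    [/\ \det g != 0, injective a, injective b, forall t, closes al be a b t
      & forall i, s i != 0 /\ l i = s i *: (model_line al be a b y i *m g)].
Proof.
move=> hl.
pose m := l None; pose v0 := l (Some (inl (al t0 i0))).
pose h0 := l (Some (inr (t0, i0))).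
have nconc v t c : conc (Some (inl v)) (Some (inr (t, c))) None = false.
  rewrite /web_conc /=; apply/existsP => -[[[x|[t' c']]|]] //=.
  by rewrite !andbF.
have D0 : br v0 h0 m != 0 by rewrite hl nconc.
set D := br v0 h0 m in D0.
pose g : 'M[L]_3 := \matrix_(r < 3) (if r == i0 then v0 else if r == i1 then h0 else m).
have [g0 g1 g2] : [/\ row i0 g = v0, row i1 g = h0 & row i2 g = m].
  by split; rewrite rowK.
have gD : \det g = D by rewrite br_mxE g0 g1 g2.
have gE x z w : vec3 x z w *m g = x *: v0 + z *: h0 + w *: m.
  by rewrite rowmul3 g0 g1 g2 !vec3E.
have cr u : u = (br u h0 m / D) *: v0 + (br v0 u m / D) *: h0 + (br v0 h0 u / D) *: m.
  apply: (scalerI D0); rewrite !scalerDr !scalerA ![D * _]mulrC !divfK //.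
  exact: cramer.
pose c0 i := br (l i) h0 m / D; pose c1 i := br v0 (l i) m / D.
pose c2 i := br v0 h0 (l i) / D.
have lE i : l i = c0 i *: v0 + c1 i *: h0 + c2 i *: m by exact: cr.
pose a v := - (c2 (Some (inl v)) / c0 (Some (inl v))).
pose bs t c := - (c0 (Some (inr (t, c))) / c1 (Some (inr (t, c)))).
pose es t c := - (c2 (Some (inr (t, c))) / c1 (Some (inr (t, c)))).
pose std (i : line) : 'rV[L]_3 := match i with None => vec3 0 0 1
  | Some (inl v) => vec3 1 0 (- a v)
  | Some (inr (t, c)) => vec3 (- bs t c) 1 (- es t c) end.
pose s (i : line) := match i with None => 1
  | Some (inl v) => c0 i | Some (inr (t, c)) => c1 i end.
have c0n v : c0 (Some (inl v)) != 0.
  by rewrite mulf_neq0 ?invr_eq0 // hl nconc.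
have c1v v : c1 (Some (inl v)) = 0.
  rewrite /c1; suff /eqP -> : br v0 (l (Some (inl v))) m == 0 by rewrite mul0r.
  by rewrite hl; apply/or4P/Or44/existsP; exists None.
have c1n t c : c1 (Some (inr (t, c))) != 0.
  by rewrite mulf_neq0 ?invr_eq0 // hl nconc.
have sn i : s i != 0 by case: i => [[v|[t c]]|] //=; rewrite oner_neq0.
have ls i : l i = s i *: (std i *m g).
  case: i => [[v|[t c]]|] /=.
  - rewrite gE scale1r scale0r addr0 [LHS]lE c1v scale0r addr0 scalerDr scalerA.
    by rewrite /a opprK [c0 _ * _]mulrC divfK.
  - rewrite gE scale1r [LHS]lE !scalerDr !scalerA /bs /es !opprK.
    by rewrite [c1 _ * (c0 _ / _)]mulrC [c1 _ * (c2 _ / _)]mulrC !divfK.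
  - by rewrite gE !scale0r !add0r !scale1r.
have sb i j k : (br (std i) (std j) (std k) == 0) = conc i j k.
  rewrite -hl !ls br_scale br_mulmx !mulf_eq0 !(negbTE (sn _)) gD (negbTE D0).
  by rewrite /= orbF.
have bsE t c t' c' : be t c = be t' c' -> bs t c = bs t' c'.
  move=> e; have : conc None (Some (inr (t, c))) (Some (inr (t', c'))).
    by apply/or4P/Or44/existsP; exists (Some (inl (be t c))); rewrite /= e eqxx.
  rewrite -sb => /eqP h; apply/esym/subr0_eq; rewrite -[RHS]h.
  by rewrite /br /dot /cross /= !vec3E; ring.
have [f hf] := choice be_surj; have [f' {}hf] := choice hf.
pose b x := bs (f x) (f' x).
have bE t c : bs t c = b (be t c) by apply: bsE; rewrite hf.
pose y t := es t i0.
have vert t c c' c'' : c != c' -> c'' != c -> c'' != c' ->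
    (bs t c - bs t c') * a (al t c'') + es t c - es t c' = 0.
  move=> n1 n2 n3.
  have : conc (Some (inl (al t c''))) (Some (inr (t, c))) (Some (inr (t, c'))).
    apply/or4P/Or44/existsP; exists (Some (inr (t, c''))).
    by rewrite /= !eqxx /= eq_sym n2 eq_sym n3.
  rewrite -sb => /eqP h; rewrite -[RHS]h.
  by rewrite /br /dot /cross /= !vec3E; ring.
have oE t c : es t c = offset al be a b y t c.
  move: c; apply: ord3P; rewrite /offset //= -!bE /y.
    have := @vert t i0 i1 i2 isT isT isT => h.
    by rewrite -[LHS]addr0 -{}h; ring.
  have := @vert t i0 i2 i1 isT isT isT => h.
  by rewrite -[LHS]addr0 -{}h; ring.
have cl t : closes al be a b t.
  rewrite /closes -!bE.
  have h1 := @vert t i0 i1 i2 isT isT isT.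
  have h2 := @vert t i0 i2 i1 isT isT isT.
  have h3 := @vert t i1 i2 i0 isT isT isT.
  have -> : 0 = - ((bs t i0 - bs t i1) * a (al t i2) + es t i0 - es t i1)
    + ((bs t i0 - bs t i2) * a (al t i1) + es t i0 - es t i2)
    - ((bs t i1 - bs t i2) * a (al t i0) + es t i1 - es t i2) :> L.
    by rewrite h1 h2 h3; ring.
  by ring.
have stdE i : std i = model_line al be a b y i.
  by case: i => [[v|[t c]]|] //=; rewrite bE oE.
exists g, a, b, y, s; split=> //; first by rewrite gD.
- move=> v v' e; apply/eqP/negPn/negP => ne.
  have : conc (Some (inl v)) (Some (inl v')) (Some (inr (t0, i0))).
    rewrite -sb; apply/eqP; rewrite /br /dot /cross /= !vec3E e; ring.
  case/or4P=> [/eqP[e']|/eqP//|/eqP//|/existsP].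
    by rewrite e' eqxx in ne.
  case=> -[[x|[t c]]|] //=; rewrite ?andbF //.
  by case/and3P=> /eqP e1 /eqP e2; rewrite e1 e2 eqxx in ne.
- move=> x x' e; apply/eqP/negPn/negP => ne.
  have : conc None (Some (inr (f x, f' x))) (Some (inr (f x', f' x'))).
    rewrite -sb; apply/eqP; rewrite /br /dot /cross /= !vec3E.
    by rewrite -/(b x) -/(b x') e; ring.
  case/or4P=> [/eqP//|/eqP[e1 e2]|/eqP//|/existsP].
    by move: ne; rewrite -(hf x) -(hf x') e1 e2 eqxx.
  case=> -[[z|[t c]]|] //=; rewrite ?andbF //.
  by case/andP; rewrite !hf => /eqP e1 /eqP e2; rewrite e1 e2 eqxx in ne.
- by move=> i; rewrite -stdE; split.
Qed.

End WebGeometry.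

(** * Multiset relations between affine ratios *)

(** Each relation r will force the pairs {lam r, ex r} and {mm r, ey r} of
    ratios to have equal products lam * ex = mm * ey and equal products
    (1 - lam) * (1 - ex) = (1 - mm) * (1 - ey). *)
Section Ratios.
Variables (Om Rel : finType) (lam mm ex ey : Rel -> Om).
Hypothesis used : forall w, exists r,
  [|| lam r == w, mm r == w, ex r == w | ey r == w].

(** The ratios proper, and the two common products of each relation. *)
Definition ratio : finType := (Om + Rel * bool)%type.
(** A quadruple (r, side, flip) of verticals computes one product for the
    relation r: of its first or of its second pair of ratios (side), or of
    their complements to 1 (flip). The two sides share the ratio inr (r,
    flip), and this equates the two products. *)
Definition quad : finType := (Rel * bool * bool)%type.
Definition vert : finType := (quad * 'I_4)%type.
Definition slope : finType := (ratio * 'I_3)%type.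
Definition tri : finType := (quad * 'I_3)%type.

(** The ratios to which the three triangles of a quadruple are attached: the
    first factor, the product, the second factor. *)
Definition factor (q : quad) (i : 'I_3) : ratio :=
  match val i with
  | 0 => inl (if q.1.2 then mm q.1.1 else lam q.1.1)
  | 1 => inr (q.1.1, q.2)
  | _ => inl (if q.1.2 then ey q.1.1 else ex q.1.1)
  end.

Local Notation f0 := (ord0 : 'I_4).
Local Notation f1 := e1.
Local Notation f2 := e2.
Local Notation f3 := e3.

(** With abscissas 0, 1, u, p on the quadruple, the three triangles stand on
    the verticals (0, 1, u), (0, 1, p) and (0, u, p). Their ratios are u, p
    and p / u, so p is the product of u and of the third ratio. *)
Definition vertex (i c : 'I_3) : 'I_4 :=
  match val i, val c with
  | _, 0 => f0 | 0, 1 => f1 | 0, _ => f2 | 1, 1 => f1 | 1, _ => f3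
  | _, 1 => f2 | _, _ => f3
  end.

(** Exchanging two members of a slope triple replaces its ratio by the
    complement to 1. *)
Definition swap01 (s : bool) (c : 'I_3) : 'I_3 :=
  if s then match val c with 0 => i1 | 1 => i0 | _ => i2 end else c.

Definition tri_vert (t : tri) (c : 'I_3) : vert := (t.1, vertex t.2 c).
Definition tri_slope (t : tri) (c : 'I_3) : slope :=
  (factor t.1 t.2, swap01 t.1.2 c).

Lemma swap01K s : involutive (swap01 s).
Proof. by case: s => c //; move: c; apply: ord3P. Qed.

Lemma tri_vert_inj t : injective (tri_vert t).
Proof.
case: t => q i c c' [] /(congr1 val); move: i c c'.
by apply: ord3P; apply: ord3P; apply: ord3P.
Qed.

Lemma tri_slope_inj t : injective (tri_slope t).
Proof. by move=> c c' [] /(can_inj (swap01K _)). Qed.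

Lemma tri_slope_surj s : exists t c, tri_slope t c = s.
Proof.
case: s => w c.
suff [q [i e]] : exists q i, factor q i = w.
  by exists (q, i), (swap01 q.2 c); rewrite /tri_slope /= e swap01K.
case: w => [w|[r f]]; last by exists (r, false, f), i1.
have [r /or4P[] /eqP <-] := used w.
- by exists (r, false, false), i0.
- by exists (r, true, false), i0.
- by exists (r, false, false), i2.
- by exists (r, true, false), i2.
Qed.

Definition flipped (R : nzRingType) (s : bool) (z : R) : R :=
  if s then 1 - z else z.

Lemma flipped_nz (R : idomainType) s (x : R) : x != 0 -> x != 1 ->
  flipped s x != 0 /\ flipped s x != 1.
Proof.
case: s => //=; rewrite /flipped => n0 n1; split.
  by rewrite subr_eq0 eq_sym.
by rewrite -subr_eq0 addrAC subrr add0r oppr_eq0.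
Qed.

Lemma flip_product_nz (R : idomainType) s (x y : R) :
  x != 0 -> x != 1 -> y != 0 -> y != 1 -> flipped s x * flipped s y != 1 ->
  flipped s (flipped s x * flipped s y) != 0 /\
  flipped s (flipped s x * flipped s y) != 1.
Proof.
move=> x0 x1 y0 y1 xy; apply: flipped_nz => //.
by rewrite mulf_neq0 //; have [] := flipped_nz s x0 x1; have [] := flipped_nz s y0 y1.
Qed.

Section Values.
Variables (R : comNzRingType) (z : Om -> R).

(** The ratio inr (r, false) is the product of the pair of r, and inr (r,
    true) is the complement to 1 of the product of the complements. *)
Definition ratio_value (w : ratio) : R :=
  match w with
  | inl w => z w
  | inr (r, f) => flipped f (flipped f (z (lam r)) * flipped f (z (ex r)))
  end.

Definition satisfies (r : Rel) : Prop :=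
  z (lam r) * z (ex r) = z (mm r) * z (ey r) /\
  (1 - z (lam r)) * (1 - z (ex r)) = (1 - z (mm r)) * (1 - z (ey r)).

Lemma flippedK s (x : R) : flipped s (flipped s x) = x.
Proof. by case: s; rewrite /flipped //; ring. Qed.

Lemma factor_product (q : quad) : (forall r, satisfies r) ->
  flipped q.2 (ratio_value (factor q i1)) =
  flipped q.2 (ratio_value (factor q i0)) * flipped q.2 (ratio_value (factor q i2)).
Proof.
move=> sat; case: q => [[r sd] f]; rewrite /= flippedK.
have [s1 s2] := sat r.
by case: sd => //; case: f.
Qed.

(** Positions and scales of the slope triples and of the vertical quadruples,
    and heights of the triangles. *)
Definition placement : finType := ((quad + ratio) * bool + tri)%type.

Variable v : placement -> R.

(** Three slopes whose affine ratio is the value of the ratio s.1. *)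
Definition slope_value (s : slope) : R :=
  v (inl (inr s.1, false)) + v (inl (inr s.1, true)) *
  match val s.2 with 0 => 0 | 1 => 1 | _ => ratio_value s.1 end.

Definition quad_value (q : quad) (i : 'I_4) : R :=
  match val i with
  | 0 => 0 | 1 => 1
  | 2 => flipped q.2 (ratio_value (factor q i0))
  | _ => flipped q.2 (ratio_value (factor q i1))
  end.

Definition vert_value (a : vert) : R :=
  v (inl (inl a.1, false)) + v (inl (inl a.1, true)) * quad_value a.1 a.2.

Definition height (t : tri) : R := v (inr t).

(** Each triangle compares three slopes and three verticals with the same
    affine ratio; for the third triangle of a quadruple this is
    factor_product. *)
Lemma closes_values : (forall r, satisfies r) ->
  forall t, closes tri_vert tri_slope vert_value slope_value t.
Proof.
move=> sat [q i]; have := factor_product q sat.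
rewrite /closes /vert_value /slope_value /tri_vert /tri_slope /quad_value /=.
move: i; case: q => qq [] /=; apply: ord3P => /=; rewrite /flipped.
- by move=> _; ring.
- by move=> _; ring.
- by move=> ->; ring.
- by move=> _; ring.
- by move=> _; ring.
- by move=> ->; ring.
Qed.

Definition ratio_line : wline vert tri -> 'rV[R]_3 :=
  model_line tri_vert tri_slope vert_value slope_value height.

End Values.

Lemma ratio_line_map (R S : comNzRingType) (f : {rmorphism R -> S}) z v l :
  map_mx f (ratio_line z v l) = ratio_line (f \o z) (f \o v) l.
Proof.
have fl s x : f (flipped s x) = flipped s (f x).
  by case: s; rewrite /flipped // rmorphB rmorph1.
have fr w : f (ratio_value z w) = ratio_value (f \o z) w.
  by case: w => [w //|[r s]] /=; rewrite fl rmorphM /= !fl.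
have fs s : f (slope_value z v s) = slope_value (f \o z) (f \o v) s.
  rewrite /slope_value rmorphD rmorphM /=; congr (_ + _ * _).
  by case: (val s.2) => [|[|k]]; rewrite ?rmorph0 ?rmorph1.
have fq q i : f (quad_value z q i) = quad_value (f \o z) q i.
  rewrite /quad_value; case: (val i) => [|[|[|k]]]; rewrite ?rmorph0 ?rmorph1 //.
  by rewrite fl fr.
have fv a : f (vert_value z v a) = vert_value (f \o z) (f \o v) a.
  by rewrite /vert_value rmorphD rmorphM /= fq.
have fo t c : f (offset tri_vert tri_slope (vert_value z v) (slope_value z v) (height v) t c)
  = offset tri_vert tri_slope (vert_value (f \o z) (f \o v))
     (slope_value (f \o z) (f \o v)) (height (f \o v)) t c.
  rewrite /offset; case: (val c) => [|[|k]] //.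
    by rewrite rmorphB rmorphM rmorphB /= fv !fs.
  by rewrite rmorphD rmorphM rmorphB /= fv !fs.
by case: l => [[a|[t c]]|]; apply: row3P; rewrite mxE /= !vec3E
  ?rmorph0 ?rmorph1 ?rmorphN /= ?fv ?fs ?fo.
Qed.

Section GenericValues.
Variables (R : idomainType) (z : Om -> R) (v : placement -> R).
Hypothesis sat : forall r, satisfies z r.
Hypothesis free : forall p, exists theta : {rmorphism R -> R},
  (forall w, theta (z w) = z w) /\ forall p', theta (v p') = v p' + (p' == p)%:R.
Hypothesis scale : forall p, v (inl (p, true)) != 0.
Hypothesis nz : forall w, ratio_value z w != 0 /\ ratio_value z w != 1.

Local Notation av := (vert_value z v).
Local Notation bv := (slope_value z v).

(** The position of any slope triple or quadruple, and the height of any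
    triangle, can be moved without changing the rest. *)
Lemma translate p : exists theta : {rmorphism R -> R},
  [/\ forall w, theta (ratio_value z w) = ratio_value z w,
      forall q i, theta (quad_value z q i) = quad_value z q i
    & forall p', theta (v p') = v p' + (p' == p)%:R].
Proof.
have [th [hz hv]] := free p; exists th.
have fl s x : th (flipped s x) = flipped s (th x).
  by case: s; rewrite /flipped // rmorphB rmorph1.
have fr w : th (ratio_value z w) = ratio_value z w.
  by case: w => [w|[r s]] /=; [exact: hz|rewrite fl rmorphM /= !fl !hz].
split=> // q i; rewrite /quad_value; case: (val i) => [|[|[|k]]].
- exact: rmorph0.
- exact: rmorph1.
- by rewrite fl fr.
- by rewrite fl fr.
Qed.

(** Slopes of one triple differ because the ratio is neither 0 nor 1, and
    slopes of two triples differ because one triple can be translated alone. *)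
Lemma slope_value_inj : injective bv.
Proof.
case=> [w c] [w' c'] e; have [ew|nw] := eqVneq w w'.
  subst w'; congr (_, _); move: e; rewrite /slope_value /= => /addrI.
  move=> /(mulfI (scale _)); have [n0 n1] := nz w.
  move: c c'; apply: ord3P; apply: ord3P => //= /eqP.
  - by rewrite eq_sym oner_eq0.
  - by rewrite eq_sym (negbTE n0).
  - by rewrite oner_eq0.
  - by rewrite eq_sym (negbTE n1).
  - by rewrite (negbTE n0).
  - by rewrite (negbTE n1).
exfalso; have [th [hr hq hv]] := translate (inl (inr w, false)).
have := congr1 th e; rewrite /slope_value /= !rmorphD !rmorphM /= !hv.
have nE (b : bool) w2 : (inl (inr w2, b) == inl (inr w, false) :> placement)
    = (w2 == w) && (b == false) by [].
have wn : (w' == w) = false by rewrite eq_sym (negbTE nw).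
rewrite !nE eqxx wn /= !addr0.
have hm (k : nat) w2 : th (match k with 0 => 0 | 1 => 1 | _ => ratio_value z w2 end)
   = match k with 0 => 0 | 1 => 1 | _ => ratio_value z w2 end.
  by case: k => [|[|k]]; rewrite ?rmorph0 ?rmorph1.
rewrite !hm => h'; have : (1 : R) == 0; last by rewrite oner_eq0.
move: e h'; rewrite /slope_value /= => <- /eqP.
by rewrite -subr_eq0 (addrAC _ 1) [X in X == _]addrAC subrr add0r.
Qed.

(** The argument of slope_value_inj, with the products distinct from their
    factors because the other factor is not 1. *)
Lemma vert_value_inj : injective av.
Proof.
case=> [q c] [q' c'] e; have [eq|nq] := eqVneq q q'.
  subst q'; congr (_, _); move: e; rewrite /vert_value /= => /addrI.
  move=> /(mulfI (scale _)).
  have [n0 n1] : flipped q.2 (ratio_value z (factor q i0)) != 0 /\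
    flipped q.2 (ratio_value z (factor q i0)) != 1.
    by have [h h'] := nz (factor q i0); apply: flipped_nz.
  have [p0 p1] : flipped q.2 (ratio_value z (factor q i1)) != 0 /\
    flipped q.2 (ratio_value z (factor q i1)) != 1.
    by have [h h'] := nz (factor q i1); apply: flipped_nz.
  have np : flipped q.2 (ratio_value z (factor q i1)) !=
    flipped q.2 (ratio_value z (factor q i0)).
    rewrite factor_product // -subr_eq0 -[X in _ - X]mulr1 -mulrBr mulf_eq0.
    rewrite (negbTE n0) subr_eq0.
    by have [h h'] := nz (factor q i2); have [] := flipped_nz q.2 h h'.
  rewrite /quad_value.
  move: c c'; apply: ord4P; apply: ord4P => //= /eqP;
  by rewrite ?oner_eq0 1?eq_sym ?oner_eq0 ?(negbTE n0) ?(negbTE n1)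
    ?(negbTE p0) ?(negbTE p1) ?(negbTE np) // eq_sym ?(negbTE np)
    ?(negbTE n0) ?(negbTE n1) ?(negbTE p0) ?(negbTE p1) ?oner_eq0.
exfalso; have [th [hr hq hv]] := translate (inl (inl q, false)).
have := congr1 th e; rewrite /vert_value /= !rmorphD !rmorphM /= !hv !hq.
have nE (b : bool) w2 : (inl (inl w2, b) == inl (inl q, false) :> placement)
    = (w2 == q) && (b == false) by [].
have qn : (q' == q) = false by rewrite eq_sym (negbTE nq).
rewrite !nE eqxx qn /= !addr0.
move=> h'; have : (1 : R) == 0; last by rewrite oner_eq0.
move: e h'; rewrite /vert_value /= => <- /eqP.
by rewrite -subr_eq0 (addrAC _ 1) [X in X == _]addrAC subrr add0r.
Qed.

Lemma ratio_line_realizes i j k :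
  (br (ratio_line z v i) (ratio_line z v j) (ratio_line z v k) == 0)
  = web_conc tri_vert tri_slope i j k.
Proof.
apply: model_realizes.
- exact: tri_vert_inj.
- exact: tri_slope_inj.
- exact: vert_value_inj.
- exact: slope_value_inj.
- exact: closes_values.
move=> t; have [th [hr hq hv]] := translate (inr t); exists th.
have nE (p : (quad + ratio) * bool) : (inl p == inr t :> placement) = false by [].
split=> [[q o]|[w c]|t'].
- by rewrite /vert_value rmorphD rmorphM /= !hv hq !nE !addr0.
- rewrite /slope_value rmorphD rmorphM /= !hv !nE !addr0; congr (_ + _ * _).
  by case: (val c) => [|[|k']]; rewrite ?rmorph0 ?rmorph1.
- by rewrite /height hv.
Qed.

End GenericValues.

(** Conversely the affine ratios of the slope triples of a web with closing
    triangles satisfy the relations: the closing conditions say that the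
    abscissas of a quadruple are 0, 1, u, p up to an affine map, with p the
    product of u and of another ratio, and the quadruples on both sides of a
    relation share the ratio that encodes p. *)
Lemma ratio_extraction (L : fieldType) (a : vert -> L) (b : slope -> L) (y : tri -> L) :
  injective a -> injective b -> (forall t, closes tri_vert tri_slope a b t) ->
  exists (z : Om -> L) (v : placement -> L), (forall r, satisfies z r) /\
    forall l, model_line tri_vert tri_slope a b y l = ratio_line z v l.
Proof.
move=> ai bi cl.
pose rt (w : ratio) := (b (w, i2) - b (w, i0)) / (b (w, i1) - b (w, i0)).
have bn w : b (w, i1) - b (w, i0) != 0.
  by rewrite subr_eq0 (inj_eq bi); apply/eqP => -[].
have b1 w : b (w, i1) = b (w, i0) + (b (w, i1) - b (w, i0)) by ring.
have b2 w : b (w, i2) = b (w, i0) + (b (w, i1) - b (w, i0)) * rt w.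
  by rewrite mulrC divfK //; ring.
have an q : a (q, f1) - a (q, f0) != 0.
  by rewrite subr_eq0 (inj_eq ai); apply/eqP => -[].
have a1 q : a (q, f1) = a (q, f0) + (a (q, f1) - a (q, f0)) by ring.
have key q i : a (q, vertex i i2) = a (q, f0) +
    (a (q, vertex i i1) - a (q, f0)) * flipped q.2 (rt (factor q i)).
  have := cl (q, i); rewrite /closes /tri_vert /tri_slope /=.
  have -> : vertex i i0 = f0 by move: (i); apply: ord3P.
  rewrite /flipped; case: (q.2) => /=; rewrite b2 => h; apply/eqP;
    rewrite -subr_eq0; apply/eqP; apply: (mulfI (bn (factor q i))); rewrite mulr0.
    by rewrite -[RHS]oppr0 -h; ring.
  by rewrite -[RHS]h; ring.
have prod q : flipped q.2 (rt (factor q i1)) =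
    flipped q.2 (rt (factor q i0)) * flipped q.2 (rt (factor q i2)).
  have k0 := key q i0; have k1 := key q i1; have k2 := key q i2.
  move: k0 k1 k2; rewrite /= => k0 k1 k2; apply: (mulfI (an q)).
  move: k2; rewrite /vertex /= k0 k1 => /addrI ->; ring.
pose z w := rt (inl w).
have sat r : satisfies z r.
  have p0 := prod (r, false, false); have p1 := prod (r, true, false).
  have p2 := prod (r, false, true); have p3 := prod (r, true, true).
  by split; [rewrite -[LHS]p0 -[RHS]p1|rewrite -[LHS]p2 -[RHS]p3].
have zE w : ratio_value z w = rt w.
  case: w => [//|[r f]] /=; have := prod (r, false, f).
  by rewrite /= => <-; rewrite flippedK.
pose v (p : placement) : L := match p with
  | inl (inl q, s) => if s then a (q, f1) - a (q, f0) else a (q, f0)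
  | inl (inr w, s) => if s then b (w, i1) - b (w, i0) else b (w, i0)
  | inr t => y t end.
exists z, v; split=> // l.
have aE : a = vert_value z v.
  apply/funext => -[q c]; rewrite /vert_value /quad_value !zE.
  move: c; apply: ord4P => /=.
  - by rewrite mulr0 addr0.
  - by rewrite mulr1; exact: a1.
  - exact: (key q i0).
  - exact: (key q i1).
have bE : b = slope_value z v.
  apply/funext => -[w c]; rewrite /slope_value zE.
  move: c; apply: ord3P => /=.
  - by rewrite mulr0 addr0.
  - by rewrite mulr1; exact: b1.
  - exact: b2.
by rewrite aE bE.
Qed.

End Ratios.

(** * The arrangement scheme of a system of ratio relations *)

Lemma defines_scale (K : fieldType) d (x : flag_point K 3 d) (L : fieldType)
    (iota : {rmorphism K -> L}) (p l p' l' : 'I_d -> 'rV[L]_3) (a b : 'I_d -> L) :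
  (forall j, a j != 0) -> (forall j, b j != 0) ->
  (forall j, p j = a j *: p' j) -> (forall j, l j = b j *: l' j) ->
  defines x iota p l -> defines x iota p' l'.
Proof.
move=> a0 b0 pa lb [fl dx]; split=> [j|w f].
  have := fl j; rewrite /flag_pair pa lb !scaler_eq0 !negb_or => /and3P[].
  move=> /andP[_ ->] /andP[_ ->].
  have -> : dot (a j *: p' j) (b j *: l' j) = a j * b j * dot (p' j) (l' j).
    by rewrite /dot !mxE; ring.
  by rewrite !mulf_eq0 (negbTE (a0 j)) (negbTE (b0 j)).
rewrite dx; split=> -[u hu z]; exists u => // j.
  have [s [t [s0 t0 ps lt]]] := hu j.
  exists ((a j)^-1 * s), ((b j)^-1 * t); rewrite !mulf_neq0 ?invr_neq0 //.
  by rewrite -!scalerA -ps -lt pa lb !scalerA !mulVf // !scale1r.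
have [s [t [s0 t0 ps lt]]] := hu j.
exists (a j * s), (b j * t); rewrite !mulf_neq0 //.
by rewrite pa lb ps lt !scalerA.
Qed.

Lemma mark_map d (mu : 'I_d -> 'I_d) (R S : comNzRingType)
    (f : {rmorphism R -> S}) (l : 'I_d -> 'rV[R]_3) k :
  map_mx f (mark mu l k) = mark mu (fun j => map_mx f (l j)) k.
Proof. exact: map_cross. Qed.

Section RatioScheme.
Variables (Om Rel : finType) (lam mm ex ey : Rel -> Om).
Hypothesis used : forall w, exists r,
  [|| lam r == w, mm r == w, ex r == w | ey r == w].
Variable r0 : Rel.

Local Notation tv := (@tri_vert Rel).
Local Notation ts := (tri_slope lam mm ex ey).
Local Notation wl := (wline (vert Rel) (tri Rel)).
Local Notation plc := (placement Om Rel).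
Local Notation nline := #|{: wl}|.
Local Notation rline := (ratio_line lam mm ex ey).

(** A triangle whose first vertical is used to mark the point of the line at
    infinity. *)
Definition base_tri : tri Rel := (r0, false, false, i0).

Definition conc (i j k : 'I_nline) : bool :=
  web_conc tv ts (enum_val i) (enum_val j) (enum_val k).

Definition marking (k : 'I_nline) : 'I_nline :=
  enum_rank (web_mark tv base_tri (enum_val k)).

Definition ratio_array : dot_array 3 nline := pattern_array conc marking.

Section Family.
Variables (R : comNzRingType) (z : Om -> R) (v : plc -> R).

Definition ratio_lines (i : 'I_nline) : 'rV[R]_3 := rline z v (enum_val i).

Definition framed_lines (g : 'M[R]_3) i := ratio_lines i *m g.

End Family.

Lemma framed_lines_map (R S : comNzRingType) (f : {rmorphism R -> S}) z v g i :
  map_mx f (framed_lines z v g i) = framed_lines (f \o z) (f \o v) (map_mx f g) i.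
Proof. by rewrite /framed_lines map_mxM ratio_line_map. Qed.

Lemma framed_lines_br (R : comNzRingType) (z : Om -> R) v g i j k :
  br (framed_lines z v g i) (framed_lines z v g j) (framed_lines z v g k) =
  br (ratio_lines z v i) (ratio_lines z v j) (ratio_lines z v k) * \det g.
Proof. exact: br_mulmx. Qed.

Lemma framed_lines_conc (R : comNzRingType) (z : Om -> R) v g i j k :
  (forall r, satisfies lam mm ex ey z r) -> conc i j k ->
  br (framed_lines z v g i) (framed_lines z v g j) (framed_lines z v g k) = 0.
Proof.
move=> sat c; rewrite framed_lines_br; have cl := closes_values v sat.
by rewrite /ratio_lines /rline (model_conc _ cl c) mul0r.
Qed.

Lemma conc_pencils (L : fieldType) (l : 'I_nline -> 'rV[L]_3) :
  realizes conc l -> pencils conc marking.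
Proof.
move=> rl; apply: realizes_pencils rl _ _ => [i j ij|k].
  have [|c nc] := @web_off _ _ _ tv ts (tri_slope_inj (ey := ey)) base_tri
    (enum_val i) (enum_val j).
    by rewrite (inj_eq enum_val_inj).
  by exists (enum_rank c); rewrite /conc enum_rankK.
by rewrite -(inj_eq enum_val_inj) enum_rankK web_mark_neq.
Qed.

(** By web_extraction and ratio_extraction: an arrangement with this
    concurrency pattern has a projective frame in which it is a model, and its
    ratios satisfy the relations. *)
Lemma scheme_extraction (L : fieldType) (l : 'I_nline -> 'rV[L]_3) :
  realizes conc l ->
  exists (z : Om -> L) (v : plc -> L) (g : 'M[L]_3) (s : 'I_nline -> L),
    [/\ forall r, satisfies lam mm ex ey z r, \det g != 0
      & forall i, s i != 0 /\ l i = s i *: framed_lines z v g i].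
Proof.
move=> rl.
have [|g [a [b [y [s [g0 ai bi cl ls]]]]]] := @web_extraction _ _ _ tv ts
  (tri_slope_surj used) base_tri L
  (fun i => l (enum_rank i)).
  by move=> i j k; rewrite rl /conc !enum_rankK.
have [z [v [sat e]]] := ratio_extraction y ai bi cl.
exists z, v, g, (fun i => s (enum_val i)); split=> // i.
have [sn li] := ls (enum_val i); split=> //.
by rewrite enum_valK in li; rewrite li e.
Qed.

Lemma scheme_point (K : fieldType) (x : flag_point K 3 nline) :
  pencils conc marking -> perm_array_scheme K ratio_array x ->
  exists (L : fieldType) (iota : {rmorphism K -> L}) (z : Om -> L) (v : plc -> L)
    (g : 'M[L]_3), [/\ forall r, satisfies lam mm ex ey z r,
      realizes conc (framed_lines z v g)
      & defines x iota (mark marking (framed_lines z v g)) (framed_lines z v g)].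
Proof.
move=> Hc /(perm_array_schemeP Hc)[|L [iota [l [rl dx]]]].
  exact: leq_ltn_trans (ltn_ord (enum_rank (None : wl))).
have [z [v [g [s [sat g0 ls]]]]] := scheme_extraction rl.
exists L, iota, z, v, g; have s0 i : s i != 0 by have [] := ls i.
have lE i : l i = s i *: framed_lines z v g i by have [] := ls i.
split=> // [i j k|].
  rewrite -rl !lE br_scale !mulf_eq0 !(negbTE (s0 _)) //=.
apply: (defines_scale (a := fun k => s k * s (marking k)) (b := s)) dx => // j.
  by rewrite mulf_neq0.
by rewrite /mark !lE crossZ.
Qed.

(** ** The standard chart *)

(** The chart in which the coordinates of a model are the abscissas of its
    verticals and the slopes and intercepts of its sides. *)
Definition std_chart : chart 3 nline := fun j =>
  match (enum_val j : wl) with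
  | None => tperm i0 i1
  | Some (inl _) => (tperm i0 i1 * tperm i1 i2)%g
  | Some (inr _) => tperm i1 i2
  end.

Section StandardChart.
Variables (R : comNzRingType) (z : Om -> R) (v : plc -> R).

Local Notation av := (vert_value lam mm ex ey z v).
Local Notation bv := (slope_value lam ex z v).
Local Notation off := (offset tv ts av bv (height v)).

Definition std_coord (e : 'I_#|{: Defs.coord 3 nline}|) : R :=
  let x := val (enum_val e) in
  match (enum_val x.1.1 : wl) with
  | None => 0
  | Some (inl a) => if x.1.2 == i1 then av a else 0
  | Some (inr (t, c)) => if x.1.2 == i1 then off t c
                         else if x.2 == i2 then bv (ts t c) else 0
  end.

Lemma std_entry j (i k : 'I_3) : (i < k)%N -> entry std_coord j i k =
  match (enum_val j : wl) with
  | None => 0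
  | Some (inl a) => if i == i1 then av a else 0
  | Some (inr (t, c)) => if i == i1 then off t c
                         else if k == i2 then bv (ts t c) else 0
  end.
Proof. by move=> ik; rewrite /entry insubT //= /std_coord enum_rankK. Qed.

Lemma tperm01 : (tperm i0 i1 i0 = i1) * (tperm i0 i1 i1 = i0) * (tperm i0 i1 i2 = i2).
Proof. by rewrite tpermL tpermR tpermD. Qed.

Lemma tperm12 : (tperm i1 i2 i0 = i0) * (tperm i1 i2 i1 = i2) * (tperm i1 i2 i2 = i1).
Proof. by rewrite tpermL tpermR tpermD. Qed.

(** The normalization of model lines agrees with the one built into the chart. *)
Lemma std_cln j : cln std_chart std_coord j = ratio_lines z v j.
Proof.
rewrite /ratio_lines /rline /cln /std_chart.
have e12 := @std_entry j i1 i2 isT; have e01 := @std_entry j i0 i1 isT.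
have e02 := @std_entry j i0 i2 isT; move: e12 e01 e02.
case E : (enum_val j) => [[a|[t c]]|] /= -> -> ->;
  apply: row3P; rewrite mxE ?permM ?tperm01 ?tperm12 /= ?vec3E //; ring.
Qed.

Lemma std_mark j : exists2 s : R, s * s = 1 &
  cpt std_chart std_coord j = s *: mark marking (ratio_lines z v) j.
Proof.
have e02 := @std_entry j i0 i2 isT; have e01 := @std_entry j i0 i1 isT.
have e00 : entry std_coord j i0 i0 = 1 by rewrite entry_low.
exists (if (enum_val j : wl) is Some (inl _) then -1 else 1).
  by case: (enum_val j) => [[?|?]|]; ring.
rewrite /mark /ratio_lines /rline /marking enum_rankK.
move: e01 e02; have cE k : cpt std_chart std_coord j 0 k =
  entry std_coord j i0 (std_chart j k) by rewrite mxE chart_mxE.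
case E : (enum_val j) => [[a|[t c]]|] /= h1 h2; apply: row3P;
  rewrite cE /std_chart E ?permM ?tperm01 ?tperm12 ?h1 ?h2 ?e00 mxE /cross /=
    !vec3E; ring.
Qed.

End StandardChart.

(** ** An invariant comparing two ratios *)

Section Invariant.

(** Some side with slope s. *)
Definition side_of (s : slope Om Rel) : 'I_nline :=
  if [pick tc : tri Rel * 'I_3 | ts tc.1 tc.2 == s] is Some (t, c)
  then enum_rank (Some (inr (t, c)) : wl) else enum_rank (None : wl).

Lemma side_ofP s : exists t c, ts t c = s /\ side_of s = enum_rank (Some (inr (t, c)) : wl).
Proof.
rewrite /side_of; case: pickP => [[t c] /eqP e|no]; first by exists t, c.
have [t [c e]] := tri_slope_surj used s.
by have := no (t, c); rewrite /= e eqxx.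
Qed.

Definition infinity : 'I_nline := enum_rank (None : wl).
Definition vertical : 'I_nline := enum_rank (Some (inl (tv base_tri i0)) : wl).

(** The difference of two affine ratios of slopes, written with brackets of
    lines so as to be homogeneous of the same degree in each line. *)
Definition bracket_difference (R : comNzRingType) (l : 'I_nline -> 'rV[R]_3)
    (s s' : ratio Om Rel) : R :=
  let m := l infinity in let v0 := l vertical in
  let b k := l (side_of (s, k)) in let b' k := l (side_of (s', k)) in
  br m (b i0) (b i2) * br m v0 (b i1) * br m (b' i0) (b' i1) * br m v0 (b' i2)
  - br m (b' i0) (b' i2) * br m v0 (b' i1) * br m (b i0) (b i1) * br m v0 (b i2).

Lemma bracket_difference_map (R S : comNzRingType) (f : {rmorphism R -> S}) l s s' :
  f (bracket_difference l s s') =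
  bracket_difference (fun j => map_mx f (l j)) s s'.
Proof. by rewrite /bracket_difference rmorphB !rmorphM /= !map_br. Qed.

Lemma bracket_difference_model (R : comNzRingType) (z : Om -> R) v g s s' :
  bracket_difference (framed_lines z v g) s s' =
  \det g ^+ 4 * v (inl (inr s, true)) * v (inl (inr s', true))
   * (ratio_value lam ex z s - ratio_value lam ex z s').
Proof.
rewrite /bracket_difference !framed_lines_br /ratio_lines.
have [t0 [c0 [e0 ->]]] := side_ofP (s, i0); have [t1 [c1 [E1 ->]]] := side_ofP (s, i1).
have [t2 [c2 [E2 ->]]] := side_ofP (s, i2).
have [t0' [c0' [e0' ->]]] := side_ofP (s', i0).
have [t1' [c1' [E1' ->]]] := side_ofP (s', i1).
have [t2' [c2' [E2' ->]]] := side_ofP (s', i2).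
rewrite /infinity /vertical !enum_rankK /rline !br_mss !br_msv e0 E1 E2 e0' E1' E2'.
by rewrite /slope_value /=; ring.
Qed.

Lemma bracket_difference_scale (R : comNzRingType) (l : 'I_nline -> 'rV[R]_3)
    (a : 'I_nline -> R) s s' :
  bracket_difference (fun j => a j *: l j) s s' =
  a infinity ^+ 4 * a vertical ^+ 2
  * (a (side_of (s, i0)) * a (side_of (s, i1)) * a (side_of (s, i2)))
  * (a (side_of (s', i0)) * a (side_of (s', i1)) * a (side_of (s', i2)))
  * bracket_difference l s s'.
Proof. by rewrite /bracket_difference !br_scale; ring. Qed.

End Invariant.
(** ** Points of the scheme *)

Lemma scheme_point_exists (K : fieldType) (L : fieldType) (iota : {rmorphism K -> L})
    (l : 'I_nline -> 'rV[L]_3) :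
  realizes conc l -> exists x : perm_array_scheme K ratio_array,
    defines (set_val x) iota (mark marking l) l.
Proof.
move=> rl; have Hc := conc_pencils rl.
have h j : flag_pair (mark marking l j) (l j) by apply: mark_pair Hc _ _ rl _.
have hx : perm_array_scheme K ratio_array (pair_point iota h).
  apply/(perm_array_schemeP Hc); last by exists L, iota, l; split=> //;
    apply: pair_point_defines.
  exact: leq_ltn_trans (ltn_ord (enum_rank (None : wl))).
exists (exist _ (pair_point iota h) (mem_set hx)).
exact: pair_point_defines.
Qed.

Lemma std_coords (L : fieldType) (z : Om -> L) (v : plc -> L) :
  coords std_chart (mark marking (framed_lines z v 1%:M)) (framed_lines z v 1%:M)
    (std_coord z v).
Proof.
have e : framed_lines z v 1%:M = ratio_lines z v.
  by apply/funext => i; rewrite /framed_lines mulmx1.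
move=> j; rewrite e; have [s ss ->] := std_mark z v j; rewrite std_cln.
exists s, 1; rewrite scalerA ss !scale1r oner_neq0; split=> //.
by apply: contra_eq_neq ss => ->; rewrite mul0r eq_sym oner_neq0.
Qed.

(** Abscissas, slopes and intercepts are coordinates of the standard chart;
    positions and scales are differences of these, and ratios are quotients of
    such differences. *)
Lemma readable_parameter (K : fieldType) (t : plc + Om) :
  exists N D : chart_ring K 3 nline, forall (L : fieldType)
    (iota : {rmorphism K -> L}) (z : Om -> L) (v : plc -> L),
    (forall p, v (inl (p, true)) != 0) ->
    mmap iota (std_coord z v) D != 0 /\
    mmap iota (std_coord z v) N = mmap iota (std_coord z v) D *
      match t with inl p => v p | inr w => z w end.
Proof.
pose X i c : chart_ring K 3 nline := - generic_line K std_chart i 0 c.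
have XE (L : fieldType) (iota : {rmorphism K -> L}) z v i c :
    mmap iota (std_coord z v) (X i c) = - ratio_lines z v i 0 c.
  rewrite rmorphN /= -std_cln -(generic_line_eval std_chart iota (std_coord z v) i).
  by rewrite [in RHS]mxE.
pose VX a := X (enum_rank (Some (inl a) : wl)) i2.
have VE (L : fieldType) (iota : {rmorphism K -> L}) z v a :
    mmap iota (std_coord z v) (VX a) = vert_value lam mm ex ey z v a.
  by rewrite XE /ratio_lines enum_rankK /rline /= vec3E opprK.
pose SX s := X (side_of s) i0.
have SE (L : fieldType) (iota : {rmorphism K -> L}) z v s :
    mmap iota (std_coord z v) (SX s) = slope_value lam ex z v s.
  rewrite XE /ratio_lines; have [t' [c [<- ->]]] := side_ofP s.
  by rewrite enum_rankK /rline /= vec3E opprK.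
case: t => [[[[q|s] b]|u]|w].
- exists (if b then VX (q, e1) - VX (q, ord0) else VX (q, ord0)), 1.
  move=> L iota z v _; rewrite rmorph1 oner_neq0 mul1r; split=> //.
  case: b; rewrite ?rmorphB /= !VE /vert_value /quad_value /=; ring.
- exists (if b then SX (s, i1) - SX (s, i0) else SX (s, i0)), 1.
  move=> L iota z v _; rewrite rmorph1 oner_neq0 mul1r; split=> //.
  case: b; rewrite ?rmorphB /= !SE /slope_value /=; ring.
- exists (X (enum_rank (Some (inr (u, i0)) : wl)) i2), 1.
  move=> L iota z v _; rewrite rmorph1 oner_neq0 mul1r; split=> //.
  by rewrite XE /ratio_lines enum_rankK /rline /= vec3E opprK.
exists (SX (inl w, i2) - SX (inl w, i0)), (SX (inl w, i1) - SX (inl w, i0)).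
move=> L iota z v sc; rewrite !rmorphB /= !SE /slope_value /=.
have -> : forall a b : L, a + b * 1 - (a + b * 0) = b by move=> a b; ring.
by split; [exact: sc|ring].
Qed.

(** On a model the bracket difference is a unit times the difference of the
    two ratios, and it is homogeneous in each line, so the lines may be
    normalized as the chart requires. *)
Lemma bracket_difference_vanishes (K : fieldType) (x : flag_point K 3 nline)
    (L : fieldType) (iota : {rmorphism K -> L}) z v g w s s' :
  defines x iota (mark marking (framed_lines z v g)) (framed_lines z v g) ->
  \det g != 0 -> (forall p, v (inl (p, true)) != 0) -> in_chart w x ->
  prime_at x w (bracket_difference (generic_line K w) s s') <->
  ratio_value lam ex z s = ratio_value lam ex z s'.
Proof.
move=> dx g0 sc xw; have [u hu] := (in_chartP dx w).1 xw.
have [b hb] : exists b : 'I_nline -> L, forall j, b j != 0 /\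
    cln w u j = b j *: framed_lines z v g j.
  suff /choice[b hb] : forall j, exists b, b != 0 /\
      cln w u j = b *: framed_lines z v g j by exists b.
  move=> j; have [a [b [_ b0 _ ->]]] := hu j; exists b^-1.
  by rewrite invr_eq0 scalerA mulVf ?scale1r.
have b0 j : b j != 0 by have [] := hb j.
have bE j : cln w u j = b j *: framed_lines z v g j by have [] := hb j.
rewrite (prime_atP dx _ hu) bracket_difference_map.
have -> : (fun j => map_mx (mmap iota u) (generic_line K w j)) =
    (fun j => b j *: framed_lines z v g j).
  by apply/funext => j; rewrite generic_line_eval bE.
rewrite bracket_difference_scale bracket_difference_model.
split=> [/eqP|->]; last by rewrite subrr !mulr0.
rewrite !mulf_eq0 ?expf_eq0 /= !(negbTE g0) !(negbTE (b0 _)) !(negbTE (sc _)) /=.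
by rewrite subr_eq0 => /eqP.
Qed.

End RatioScheme.

(** * Polynomials in the variables of a finite type *)

Section GenericVariables.
Variables (K : fieldType) (V : finType) (used : pred V).

Definition active : finType := {x : V | used x}.
Definition gpoly := {mpoly K[#|{: active}|]}.

(** The polynomial variable attached to x, and 0 if x is not used. *)
Definition gen (x : V) : gpoly :=
  if (insub x : option active) is Some y then 'X_(enum_rank y) else 0.

Section Evaluation.
Variables (S : comNzRingType) (iota : {rmorphism K -> S}) (f : V -> S).

Definition geval : gpoly -> S :=
  mmap iota (fun i : 'I_#|{: active}| => f (val (enum_val i))).

HB.instance Definition _ := GRing.RMorphism.on geval.

Lemma geval_gen x : used x -> geval (gen x) = f x.
Proof.
by move=> ux; rewrite /gen insubT /geval mmap_XU enum_rankK.
Qed.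

Lemma gevalC c : geval c%:MP = iota c.
Proof. by rewrite /geval mmapC. Qed.

Lemma geval_unique (phi : {rmorphism gpoly -> S}) a :
  (forall c, phi c%:MP = iota c) -> (forall x, used x -> phi (gen x) = f x) ->
  phi a = geval a.
Proof.
move=> hc hx; apply: mmap_unique => // i.
rewrite -hx; last exact: valP.
congr (phi _); rewrite /gen; case: insubP => [y _ e|]; last by rewrite valP.
by rewrite (val_inj e) enum_valK.
Qed.

End Evaluation.

Lemma geval_id a : geval (@mpolyC _ K) gen a = a.
Proof. by apply/esym; apply: (geval_unique (phi := idfun)). Qed.

Lemma gen_neq_exp x y e : used x -> used y -> x != y -> gen x != gen y ^+ e.
Proof.
move=> ux uy xy; apply/eqP.
move/(congr1 (geval idfun (fun t => if t == x then (e != 0%N)%:R else 0 : K))).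
rewrite rmorphXn /= !geval_gen // eqxx [y == x]eq_sym (negbTE xy) expr0n.
by case: (e == 0%N) => /= /eqP; rewrite ?(eq_sym 0) oner_eq0.
Qed.

Lemma gen_neq0 x : used x -> gen x != 0.
Proof.
move=> ux; apply/eqP => /(congr1 (geval idfun (fun=> 1 : K))).
by rewrite geval_gen // rmorph0 => /eqP; rewrite oner_eq0.
Qed.

Lemma gen_neq1 x : used x -> gen x != 1.
Proof.
move=> ux; apply/eqP => /(congr1 (geval idfun (fun=> 0 : K))).
by rewrite geval_gen // rmorph1 => /eqP; rewrite eq_sym oner_eq0.
Qed.

Lemma gen_flip_product x y s : used x -> used y ->
  flipped s (gen x) * flipped s (gen y) != 1.
Proof.
move=> ux uy; apply/eqP => /(congr1 (geval idfun (fun=> s%:R : K))).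
have e t : used t -> geval idfun (fun=> s%:R : K) (flipped s (gen t)) = 0.
  by case: s => ut; rewrite /flipped ?rmorphB ?rmorph1 /= geval_gen ?subrr.
by rewrite rmorph1 rmorphM /= !e // mul0r => /eqP; rewrite eq_sym oner_eq0.
Qed.

Definition subst_gen (x : V) (c : gpoly) : gpoly -> gpoly :=
  geval (@mpolyC _ K) (fun t => if t == x then c else gen t).

HB.instance Definition _ x c := GRing.RMorphism.on (subst_gen x c).

Lemma subst_gen_other x c t : used t -> t != x -> subst_gen x c (gen t) = gen t.
Proof. by move=> ut tx; rewrite /subst_gen geval_gen // (negbTE tx). Qed.

Lemma subst_gen_same x c : used x -> subst_gen x c (gen x) = c.
Proof. by move=> ux; rewrite /subst_gen geval_gen // eqxx. Qed.

(** A nonzero polynomial remains nonzero when one variable is replaced by a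
    suitable power of another, since it has finitely many roots in the former;
    this works over every field, finite or not. *)
Lemma nonzero_subst x y (a : gpoly) : used x -> used y -> x != y -> a != 0 ->
  exists e, subst_gen x (gen y ^+ e) a != 0.
Proof.
move=> ux uy xy a0.
pose rho : gpoly -> {poly gpoly} :=
  geval (polyC \o @mpolyC #|{: active}| K) (fun t => if t == x then 'X else (gen t)%:P).
have rhoE c : (rho a).[c] = subst_gen x c a.
  apply: (geval_unique (phi := horner_eval c \o rho)) => [b|t ut] /=.
    by rewrite /rho gevalC /horner_eval /= hornerC.
  rewrite /rho geval_gen // /horner_eval.
  by case: eqP => _; rewrite ?hornerX ?hornerC.
have r0 : rho a != 0.
  apply: contraNneq a0 => r0; rewrite -(geval_id a).
  have -> : geval (@mpolyC _ K) gen a = subst_gen x (gen x) a.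
    apply: (geval_unique (phi := geval (@mpolyC _ K) gen)) => [c'|t ut].
      exact: gevalC.
    by rewrite /= geval_gen //; case: eqP => [->|].
  by rewrite -rhoE r0 horner0.
apply: contrapT => no.
have all0 e : root (rho a) (gen y ^+ e).
  rewrite /root rhoE; apply/negP => h; apply: no; exists e; exact/negP.
pose s := [seq gen y ^+ e | e <- iota 0 (size (rho a))].
have inj : injective (fun e => gen y ^+ e).
  move=> e e' he.
  pose f : V -> {poly K} := fun=> 'X.
  have := congr1 (geval (polyC : {rmorphism K -> {poly K}}) f) he.
  rewrite !rmorphXn /= !geval_gen // => /(congr1 (fun p : {poly K} => size p)).
  by rewrite /f !size_polyXn => -[].
have := max_poly_roots r0 (_ : all (root (rho a)) s) (_ : uniq s).
rewrite size_map size_iota ltnn => h; apply: (Bool.diff_false_true).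
rewrite h //; first by apply/allP => _ /mapP[e _ ->].
by rewrite map_inj_uniq ?iota_uniq.
Qed.

End GenericVariables.

(** * Ratio relations with many families of solutions *)

Section Star.
Variables (K : fieldType) (n k : nat).

(** The ratios are mu, the lambda_j, and pairs x_jl, y_jl; over a field the
    relations force {lambda_j, x_jl} = {mu, y_jl} as multisets, for all j and
    l. *)
Definition star_ratio : finType := option ('I_n.+1 + 'I_n.+1 * 'I_k.+1 * bool)%type.
Definition star_rel : finType := ('I_n.+1 * 'I_k.+1)%type.

Definition star_mu (r : star_rel) : star_ratio := None.
Definition star_lam (r : star_rel) : star_ratio := Some (inl r.1).
Definition star_x (r : star_rel) : star_ratio := Some (inr (r, false)).
Definition star_y (r : star_rel) : star_ratio := Some (inr (r, true)).

Lemma star_used w : exists r, [|| star_lam r == w, star_mu r == w, star_x r == w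
  | star_y r == w].
Proof.
case: w => [[j|[[j l] b]]|].
- by exists (j, ord0); rewrite eqxx.
- by exists (j, l); case: b; rewrite eqxx ?orbT.
- by exists (ord0, ord0); rewrite eqxx orbT.
Qed.

Implicit Types S : {set 'I_n.+1}.

(** For each S there is a solution family: when j is in S, lambda_j is free and
    x_jl = mu, y_jl = lambda_j for all l; otherwise lambda_j = mu and
    x_jl = y_jl is free for every l. *)
Definition star_value (R : Type) S (w : star_ratio -> R) (o : star_ratio) : R :=
  match o with
  | None => w None
  | Some (inl j) => if j \in S then w (Some (inl j)) else w None
  | Some (inr (j, l, b)) =>
      if j \in S then (if b then w (Some (inl j)) else w None)
      else w (Some (inr (j, l, false)))
  end.

Definition star_free S (o : star_ratio) : bool :=
  match o with
  | None => true
  | Some (inl j) => j \in S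
  | Some (inr (j, l, b)) => (j \notin S) && ~~ b
  end.

Local Notation sat := (satisfies star_lam star_mu star_x star_y).

Lemma star_sat (R : comNzRingType) S (w : star_ratio -> R) r :
  sat (star_value S w) r.
Proof.
case: r => j l; rewrite /satisfies /=; case: ifP => _; split; ring.
Qed.

Lemma star_value_free S o :
  exists2 o', star_free S o' & forall (R : Type) (w : star_ratio -> R),
    star_value S w o = w o'.
Proof.
case: o => [[j|[[j l] b]]|] /=; last by exists None.
  by case jS: (j \in S); [exists (Some (inl j))|exists None].
case jS: (j \in S); last by exists (Some (inr (j, l, false))) => //=; rewrite jS.
by case: b; [exists (Some (inl j))|exists None].
Qed.

(** Eliminating x from the two equations of a relation gives (lambda - mu) (y
    - lambda) = 0, so each lambda_j decides alone which of the two cases holds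
    for all its pairs. *)
Lemma star_solution (L : fieldType) (z : star_ratio -> L) :
  (forall r, sat z r) ->
  exists S, forall o, star_value S z o = z o.
Proof.
move=> hz; exists [set j | z (Some (inl j)) != z None]%SET.
case=> [[j|[[j l] b]]|] //=; rewrite inE.
  by case: eqP => //= ->.
have [] := hz (j, l); rewrite /star_lam /star_mu /star_x /star_y /=.
set la := z (Some (inl j)); set m := z None.
set x := z (Some (inr (j, l, false))); set y := z (Some (inr (j, l, true))).
move=> e1 e2; have e3 : la + x = m + y.
  apply: (addIr (- 1 - la * x)); rewrite [in RHS]e1.
  have -> : la + x + (-1 - la * x) = - ((1 - la) * (1 - x)) by ring.
  by rewrite e2; ring.
have xE : x = m + y - la by rewrite -e3; ring.
case: (eqVneq la m) => [lm|nlm] /=.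
  have xy : x = y by rewrite xE lm; ring.
  by case: b => //; rewrite -/x -/y xy.
have : (la - m) * (y - la) == 0.
  apply/eqP; transitivity (la * x - m * y); first by rewrite xE; ring.
  by rewrite e1 subrr.
rewrite mulf_eq0 !subr_eq0 (negbTE nlm) /= => /eqP yl.
by case: b; rewrite -/x -/y // xE yl; ring.
Qed.

Local Notation plc := (placement star_ratio star_rel).
Local Notation dim := #|{: wline (vert star_rel) (tri star_rel)}|.
Local Notation arr := (ratio_array star_lam star_mu star_x star_y (ord0, ord0)).
Local Notation cnc := (conc star_lam star_mu star_x star_y).
Local Notation mrk := (@marking star_rel (ord0, ord0)).
Local Notation lines := (framed_lines star_lam star_mu star_x star_y).
Local Notation rv := (ratio_value star_lam star_x).

(** The entries of the frame, the placements, and the values of the ratios. *)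
Definition star_var : finType := ('I_3 * 'I_3 + plc + star_ratio)%type.

Definition star_active S (t : star_var) : bool :=
  if t is inr o then star_free S o else true.

Section Component.
Variable S : {set 'I_n.+1}.

Local Notation act := (star_active S).
Local Notation A := {mpoly K[#|{: active act}|]}.
Local Notation gn := (gen K act).

Section Values.
Variables (R : comNzRingType) (f : star_var -> R).
Definition st_z : star_ratio -> R := star_value S (fun o => f (inr o)).
Definition st_v : plc -> R := fun p => f (inl (inr p)).
Definition st_g : 'M[R]_3 := \matrix_(i, j) f (inl (inl (i, j))).
End Values.

Lemma geval_lines (R : comNzRingType) (iota : {rmorphism K -> R}) f j :
  map_mx (geval iota f) (lines (st_z gn) (st_v gn) (st_g gn) j) =
  lines (st_z f) (st_v f) (st_g f) j.
Proof.
pose phi : {rmorphism A -> R} := geval iota f.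
have g x : act x -> phi (gn x) = f x by apply: geval_gen.
have ez : phi \o st_z gn = st_z f.
  apply/funext => o; have [o' fo e] := star_value_free S o.
  by rewrite /st_z e -[LHS]/(phi _) e g.
have ev : phi \o st_v gn = st_v f by apply/funext => p; apply: g.
have eg : map_mx phi (st_g gn) = st_g f.
  by apply/matrixP => i i'; rewrite !mxE; apply: g.
by rewrite -ez -ev -eg; apply: framed_lines_map.
Qed.

Lemma generic_value o : exists2 o', star_free S o' & st_z gn o = gn (inr o').
Proof.
have [o' fo e] := star_value_free S o.
by exists o'; rewrite // /st_z e.
Qed.

Lemma generic_ratio_nz w : rv (st_z gn) w != 0 /\ rv (st_z gn) w != 1.
Proof.
case: w => [o|[r f]].
  rewrite -[rv _ _]/(st_z gn o); have [o' fo ->] := generic_value o.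
  by rewrite gen_neq0 ?gen_neq1.
rewrite -[rv _ _]/(flipped f (flipped f (st_z gn (star_lam r)) *
  flipped f (st_z gn (star_x r)))).
have [o fo ->] := generic_value (star_lam r).
have [o' fo' ->] := generic_value (star_x r).
by apply: flip_product_nz; rewrite ?gen_neq0 ?gen_neq1 ?gen_flip_product.
Qed.

(** The free variables supply the translations that ratio_line_realizes
    requires. *)
Lemma generic_realizes i j l :
  (br (ratio_lines star_lam star_mu star_x star_y (st_z gn) (st_v gn) i)
      (ratio_lines star_lam star_mu star_x star_y (st_z gn) (st_v gn) j)
      (ratio_lines star_lam star_mu star_x star_y (st_z gn) (st_v gn) l) == 0)
  = cnc i j l.
Proof.
apply: ratio_line_realizes => [r|p|p|w].
- exact: star_sat.
- pose th : {rmorphism A -> A} :=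
    geval (used := act) (@mpolyC _ K) (fun t => gn t + (t == inl (inr p))%:R).
  have thE t : act t -> th (gn t) = gn t + (t == inl (inr p))%:R.
    by apply: geval_gen.
  exists th; split=> [o|p']; last exact: (thE (inl (inr p'))).
  have [o' fo ->] := generic_value o.
  by rewrite (thE (inr o') fo) addr0.
- exact: gen_neq0.
- exact: generic_ratio_nz.
Qed.

Lemma generic_det : \det (st_g gn) != 0.
Proof.
apply/eqP => /(congr1 (geval idfun (fun t : star_var =>
  if t is inl (inl (i, j)) then (i == j)%:R else 0 : K))).
rewrite rmorph0 -det_map_mx (_ : map_mx _ _ = 1%:M).
  by move/eqP; rewrite det1 oner_eq0.
by apply/matrixP => i j; rewrite !mxE /= geval_gen.
Qed.

End Component.
End Star.

(** * The components of the star scheme *)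

Section StarScheme.
Variables (K : fieldType) (n k : nat).
Implicit Types S : {set 'I_n.+1}.

Local Notation Rel := (star_rel n k).
Local Notation Om := (star_ratio n k).
Local Notation plc := (placement Om Rel).
Local Notation slam := (@star_lam n k).
Local Notation smu := (@star_mu n k).
Local Notation sx := (@star_x n k).
Local Notation sy := (@star_y n k).
Local Notation nl := #|{: wline (vert Rel) (tri Rel)}|.
Local Notation cnc := (conc slam smu sx sy).
Local Notation mrk := (@marking Rel (ord0, ord0)).
Local Notation lines := (framed_lines slam smu sx sy).
Local Notation var := (star_var n k).
Local Notation act := (@star_active n k).
Local Notation gn S := (gen K (act S)).
Local Notation A S := {mpoly K[#|{: active (act S)}|]}.

Definition star_array : dot_array 3 nl := ratio_array slam smu sx sy (ord0, ord0).
Definition star_scheme : set (flag_point K 3 nl) := perm_array_scheme K star_array.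
Implicit Types x y : star_scheme.

(** The dependent ratios are computed from the free ones of the family S. *)
Definition config S (R : comNzRingType) (f : var -> R) : 'I_nl -> 'rV[R]_3 :=
  lines (st_z S f) (st_v f) (st_g f).

(** The point x is given by the lines of the configuration with parameters f. *)
Definition at_config S (L : fieldType) (iota : {rmorphism K -> L}) (f : var -> L) x :=
  defines (set_val x) iota (mark mrk (config S f)) (config S f).

Lemma at_config_exists S (L : fieldType) (iota : {rmorphism K -> L}) (f : var -> L) :
  realizes cnc (config S f) -> exists x, at_config S iota f x.
Proof. exact: scheme_point_exists. Qed.

(** Functions of the parameters that vanish at the first choice of parameters
    must vanish at the second. *)
Lemma spec_config S (L1 L2 : fieldType) (iota1 : {rmorphism K -> L1})
    (iota2 : {rmorphism K -> L2}) (g1 : var -> L1) (g2 : var -> L2) x y :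
  (forall a, geval (used := act S) iota1 g1 a = 0 -> geval iota2 g2 a = 0) ->
  at_config S iota1 g1 x -> at_config S iota2 g2 y -> spec (set_val x) (set_val y).
Proof.
move=> ker dx dy.
have e (L : fieldType) (iota : {rmorphism K -> L}) (g : var -> L) :
    (fun j => map_mx (geval iota g) (config S (gn S) j)) = config S g.
  by apply/funext => j; apply: geval_lines.
have e' (L : fieldType) (iota : {rmorphism K -> L}) (g : var -> L) :
    (fun j => map_mx (geval iota g) (mark mrk (config S (gn S)) j)) =
    mark mrk (config S g).
  by apply/funext => j; rewrite mark_map e.
apply: (spec_family (iotaA := @mpolyC _ K) (f1 := geval iota1 g1)
  (f2 := geval iota2 g2) (iota1 := iota1) (iota2 := iota2)
  (P := mark mrk (config S (gn S))) (N := config S (gn S))) => //.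
- by move=> c; symmetry; apply: gevalC.
- by move=> c; symmetry; apply: gevalC.
- by rewrite e e'.
- by rewrite e e'.
Qed.

(** A field of fractions of each coordinate ring, of which only the embedding
    matters. *)
Variables (F : {set 'I_n.+1} -> fieldType) (to_frac : forall S, {rmorphism A S -> F S}).
Hypothesis to_frac_inj : forall S, injective (to_frac S).

Lemma to_frac_neq0 S a : a != 0 -> to_frac S a != 0.
Proof. by apply: contraNneq; rewrite -[RHS](rmorph0 (to_frac S)) => /to_frac_inj ->. Qed.

Definition frac_iota S : {rmorphism K -> F S} := to_frac S \o @mpolyC _ K.

Lemma geval_to_frac S (h : var -> A S) a :
  geval (used := act S) (frac_iota S) (to_frac S \o h) a =
  to_frac S (geval (used := act S) (@mpolyC _ K) h a).
Proof.
apply/esym; apply: (geval_unique (phi := to_frac S \o geval (used := act S) (@mpolyC _ K) h)).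
  by move=> c; congr (to_frac S _); apply: gevalC.
by move=> t ut; congr (to_frac S _); apply: geval_gen.
Qed.

Lemma st_z_to_frac S (h : var -> A S) o :
  st_z S (to_frac S \o h) o = to_frac S (st_z S h o).
Proof. by have [o' _ e] := star_value_free S o; rewrite /st_z !e. Qed.

Lemma st_g_to_frac S (h : var -> A S) :
  st_g (to_frac S \o h) = map_mx (to_frac S) (st_g h).
Proof. by apply/matrixP => i i'; rewrite !mxE. Qed.

Lemma config_to_frac S (h : var -> A S) j :
  config S (to_frac S \o h) j = map_mx (to_frac S) (config S h j).
Proof.
have ez : st_z S (to_frac S \o h) = to_frac S \o st_z S h.
  by apply/funext => o; apply: st_z_to_frac.
by rewrite /config ez st_g_to_frac; symmetry; apply: framed_lines_map.
Qed.

Lemma generic_config_realizes S : realizes cnc (config S (to_frac S \o gn S)).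
Proof.
move=> i j l; rewrite !config_to_frac -map_br -(rmorph0 (to_frac S)).
rewrite (inj_eq (@to_frac_inj S)) framed_lines_br mulf_eq0.
by rewrite (negbTE (generic_det _ _ _)) orbF generic_realizes.
Qed.

Lemma star_pencils : pencils cnc mrk.
Proof. exact: conc_pencils (generic_config_realizes finset.set0). Qed.

Lemma star_permutation_array : permutation_array star_array.
Proof. exact: pattern_permutation_array star_pencils. Qed.

(** Each family S has a generic point, given by independent parameters. *)
Lemma generic_points : exists eta : {set 'I_n.+1} -> star_scheme,
  forall S, at_config S (frac_iota S) (to_frac S \o gn S) (eta S).
Proof.
have [S|eta h] := @choice _ _
    (fun S x => at_config S (frac_iota S) (to_frac S \o gn S) x).
  exact/at_config_exists/generic_config_realizes.
by exists eta.
Qed.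

Section Components.
Variable eta : {set 'I_n.+1} -> star_scheme.
Hypothesis etaP : forall S, at_config S (frac_iota S) (to_frac S \o gn S) (eta S).

Lemma spec_generic S (L : fieldType) (iota : {rmorphism K -> L}) (f : var -> L) y :
  at_config S iota f y -> spec (set_val (eta S)) (set_val y).
Proof.
move=> dy; apply: spec_config (etaP S) dy => a; rewrite geval_to_frac geval_id.
by rewrite -(rmorph0 (to_frac S)) => /to_frac_inj ->; rewrite rmorph0.
Qed.

(** By star_solution every point has parameters in one of the families, hence
    lies in the closure of the generic point of this family. *)
Lemma star_cover y : exists S, spec (set_val (eta S)) (set_val y).
Proof.
have [|L [iota [z [v [g [sat rl dy]]]]]] :=
  scheme_point (@star_used n k) star_pencils (x := set_val y).
  exact: set_valP.
have [S hS] := star_solution sat; exists S.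
pose f (t : var) : L := match t with
  | inl (inl (i, j)) => g i j | inl (inr p) => v p | inr o => z o end.
apply: (@spec_generic S L iota f); rewrite /at_config /config.
have -> : st_z S f = z by apply/funext => o; rewrite /st_z -[RHS]hS.
by have -> : st_g f = g by apply/matrixP => i j; rewrite mxE.
Qed.

(** An equality of two ratios is a closed condition, detected by the bracket
    difference. *)
Lemma spec_generic_ratio S T o o' : spec (set_val (eta T)) (set_val (eta S)) ->
  st_z T (gn T) o = st_z T (gn T) o' -> st_z S (gn S) o = st_z S (gn S) o'.
Proof.
move=> sp e; have [w Sw] := chart_cover (set_val (eta S)).
have [Tw sub] := sp w Sw.
have zE U u : ratio_value slam sx (st_z U (to_frac U \o gn U)) (inl u) =
    to_frac U (st_z U (gn U) u) by apply: st_z_to_frac.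
have gE U : \det (st_g (to_frac U \o gn U)) != 0.
  by rewrite st_g_to_frac det_map_mx; apply/to_frac_neq0/generic_det.
have vE U p : st_v (to_frac U \o gn U) (inl (p, true)) != 0.
  by apply: to_frac_neq0; apply: gen_neq0.
have hT := bracket_difference_vanishes (@star_used n k) (inl o) (inl o')
  (etaP T) (gE T) (vE T) Tw.
have hS := bracket_difference_vanishes (@star_used n k) (inl o) (inl o')
  (etaP S) (gE S) (vE S) Sw.
apply: (@to_frac_inj S); rewrite -!zE; apply/hS/sub/hT.
by rewrite !zE e.
Qed.

(** When j is in T and not in S, the equality x_j0 = mu holds at the generic
    point of T but not at that of S; when j is in S and not in T, this is so
    for lambda_j = mu. *)
Lemma spec_generic_eq S T : spec (set_val (eta T)) (set_val (eta S)) -> T = S.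
Proof.
move=> sp; apply/setP => j; have h o o' := @spec_generic_ratio S T o o' sp.
have vI (R : comNzRingType) (U : {set 'I_n.+1}) (f : var -> R) (b : bool) : j \in U ->
    st_z U f (Some (inr (j, ord0, b))) = f (inr (if b then Some (inl j) else None)).
  by rewrite /st_z /= => ->; case: b.
have vN (R : comNzRingType) (U : {set 'I_n.+1}) (f : var -> R) (b : bool) : j \notin U ->
    st_z U f (Some (inr (j, ord0, b))) = f (inr (Some (inr (j, ord0, false)))).
  by rewrite /st_z /= => /negbTE ->.
have vm (R : comNzRingType) (U : {set 'I_n.+1}) (f : var -> R) : st_z U f None = f (inr None) by [].
have vl (R : comNzRingType) (U : {set 'I_n.+1}) (f : var -> R) :
    st_z U f (Some (inl j)) = f (inr (if j \in U then Some (inl j) else None)).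
  by rewrite /st_z /=; case: ifP.
have uN (U : {set 'I_n.+1}) : j \notin U -> act U (inr (Some (inr (j, ord0, false)))).
  by move=> jU; rewrite /= jU.
have ne (U : {set 'I_n.+1}) t : act U (inr t) -> t != None ->
    gn U (inr t) != gn U (inr None).
  move=> ut nt; rewrite -[X in _ != X]expr1; apply: gen_neq_exp => //.
case jT: (j \in T); case jS: (j \in S) => //.
  have := h (Some (inr (j, ord0, false))) None.
  rewrite vI // vm vN ?jS // vm => /(_ erefl) /eqP.
  by rewrite (negbTE (ne _ _ _ _)) // uN ?jS.
have := h (Some (inl j)) None; rewrite !vl !vm jT jS => /(_ erefl) /eqP.
by rewrite (negbTE (ne _ _ _ _)).
Qed.

(** An irreducible set is contained in one of the finitely many closures that
    cover the scheme, and none of these contains another. *)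
Lemma star_component S :
  irreducible_component (@specializations K _ star_scheme (set_val (eta S))).
Proof.
split; first exact: irreducible_specializations.
move=> Z irr sub.
pose G T := @specializations K _ star_scheme (set_val (eta T)).
have [T|y _|T _ ZT] := irreducible_finite_union (s := enum {set 'I_n.+1})
  (F := G) irr.
- exact: closed_specializations.
- by have [T h] := star_cover y; exists T; rewrite ?mem_enum.
have TS : T = S.
  by apply: spec_generic_eq; apply: ZT; apply: sub; apply: spec_refl.
by rewrite TS in ZT; apply/seteqP.
Qed.

Lemma star_dim_le S r :
  irreducible_chain (@specializations K _ star_scheme (set_val (eta S))) r ->
  (r <= #|{: active (act S)}|)%N.
Proof.
apply: (dimension_le (iota := frac_iota S) (phi := to_frac S)
  (P := mark mrk (config S (gn S))) (N := config S (gn S))) => [|||y].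
- by move=> c.
- exact: to_frac_inj.
- have e : (fun j => map_mx (to_frac S) (config S (gn S) j)) =
      config S (to_frac S \o gn S) by apply/funext => j; rewrite config_to_frac.
  have e' : (fun j => map_mx (to_frac S) (mark mrk (config S (gn S)) j)) =
      mark mrk (config S (to_frac S \o gn S)).
    by apply/funext => j; rewrite mark_map e.
  by rewrite e e'; apply: etaP.
- by [].
Qed.

End Components.
End StarScheme.

(** * Dimensions of the components *)

Section StarDimension.
Variables (K : fieldType) (n k : nat).
Implicit Types S : {set 'I_n.+1}.

Local Notation Rel := (star_rel n k).
Local Notation Om := (star_ratio n k).
Local Notation plc := (placement Om Rel).
Local Notation nl := #|{: wline (vert Rel) (tri Rel)}|.
Local Notation cnc := (conc (@star_lam n k) (@star_mu n k) (@star_x n k) (@star_y n k)).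
Local Notation mrk := (@marking Rel (ord0, ord0)).
Local Notation var := (star_var n k).
Local Notation act := (@star_active n k).
Local Notation gn S := (gen K (act S)).
Local Notation A S := {mpoly K[#|{: active (act S)}|]}.
Local Notation scheme := (@star_scheme K n k).

(** The position of the first quadruple, which is the parameter that stays
    generic. *)
Definition base_var : var := inl (inr (inl (inl (ord0, ord0, false, false), false))).

(** The parameters of the family S that are specialized one after the other:
    all but the base parameter and the entries of the frame. *)
Definition movable S : pred var :=
  fun t => [&& act S t, t != base_var & if t is inl (inl _) then false else true].

Lemma star_value_self (R : Type) S (w : Om -> R) o : star_free S o ->
  star_value S w o = w o.
Proof.
by case: o => [[j|[[j l] b]]|] //= => [->|/andP[/negbTE -> /negbTE ->]].
Qed.

Section Family.
Variables (F : {set 'I_n.+1} -> fieldType) (to_frac : forall S, {rmorphism A S -> F S}).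
Hypothesis to_frac_inj : forall S, injective (to_frac S).
Variable S : {set 'I_n.+1}.

Local Notation gn := (gn S).
Local Notation iota := (frac_iota to_frac S).

(** Parameters in the standard frame; the parameter t is generic if e t is
    None, and the power m of the base parameter if e t is Some m. *)
Definition powers (e : var -> option nat) (t : var) : A S :=
  match t with
  | inl (inl (i, j)) => (i == j)%:R
  | _ => if e t is Some m then gn base_var ^+ m else gn t
  end.

Lemma powers_base e : e base_var = None -> powers e base_var = gn base_var.
Proof.
move=> eb.
change ((if e base_var is Some m then gn base_var ^+ m else gn base_var) = gn base_var).
by rewrite eb.
Qed.

Definition powers_eval e : {rmorphism A S -> A S} :=
  geval (used := act S) (@mpolyC _ K) (powers e).

(** If the brackets of non-concurrent triples and the scales of the model stay
    nonzero, the parameters still define a point of the scheme. *)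
Definition nondegeneracy : A S :=
  \prod_(c : 'I_nl * 'I_nl * 'I_nl | ~~ cnc c.1.1 c.1.2 c.2)
    br (config S gn c.1.1) (config S gn c.1.2) (config S gn c.2)
  * \prod_p gn (inl (inr (inl (p, true)))).

Definition nondegenerate e := e base_var = None /\ powers_eval e nondegeneracy != 0.

Lemma powers_g e : st_g (powers e) = 1%:M.
Proof. by apply/matrixP => i j; rewrite !mxE. Qed.

Lemma nondegenerate_start : nondegenerate (fun=> None).
Proof.
have gE x : act S x -> powers_eval (fun=> None) (gn x) = powers (fun=> None) x.
  by move=> ux; apply: geval_gen.
have brE i j l : powers_eval (fun=> None)
    (br (config S gn i) (config S gn j) (config S gn l)) =
    br (config S (powers (fun=> None)) i) (config S (powers (fun=> None)) j)
       (config S (powers (fun=> None)) l).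
  have h j' : map_mx (powers_eval (fun=> None)) (config S gn j') =
      config S (powers (fun=> None)) j' by apply: geval_lines.
  by rewrite -!h; apply: map_br.
split=> //; rewrite rmorphM; apply: mulf_neq0; rewrite rmorph_prod; apply/prodf_neq0.
  move=> c nc; rewrite brE /config framed_lines_br powers_g det1 mulr1.
  have -> : st_z S (powers (fun=> None)) = st_z S gn by [].
  have -> : st_v (powers (fun=> None)) = st_v gn by [].
  by rewrite generic_realizes.
by move=> p _; rewrite gE //; apply: gen_neq0.
Qed.

Definition set_power (e : var -> option nat) t m t' :=
  if t' == t then Some m else e t'.

Lemma powers_eval_set e t m a : movable S t -> e t = None -> e base_var = None ->
  powers_eval (set_power e t m) a =
  subst_gen t (gn base_var ^+ m) (powers_eval e a).
Proof.
case/and3P=> ut tb tg et eb; symmetry.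
apply: (geval_unique (phi := subst_gen t (gn base_var ^+ m) \o powers_eval e)).
  move=> c; transitivity (subst_gen t (gn base_var ^+ m) c%:MP); last exact: gevalC.
  by congr (subst_gen _ _ _); apply: gevalC.
move=> x ux; transitivity (subst_gen t (gn base_var ^+ m) (powers e x)).
  by congr (subst_gen _ _ _); apply: geval_gen.
have sb0 : subst_gen t (gn base_var ^+ m) (gn base_var) = gn base_var.
  by apply: subst_gen_other; [|rewrite eq_sym].
have sb j : subst_gen t (gn base_var ^+ m) (gn base_var ^+ j) = gn base_var ^+ j.
  transitivity (subst_gen t (gn base_var ^+ m) (gn base_var) ^+ j); first exact: rmorphXn.
  by congr (_ ^+ j).
have [xt|xt] := eqVneq x t.
  subst x; transitivity (gn base_var ^+ m).
    rewrite -[RHS](subst_gen_same _ ut); congr (subst_gen _ _ _).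
    by move: tg et; rewrite /powers; case: (t) => [[//|p]|o] _ ->.
  by move: tg; rewrite /powers /set_power eqxx; case: (t) => [[]|].
rewrite /powers /set_power (negbTE xt).
have so : subst_gen t (gn base_var ^+ m) (gn x) = gn x by apply: subst_gen_other.
case: x ux xt so => [[[i j]|p]|o] ux xt so; first exact: rmorph_nat.
  by case: (e _).
by case: (e _).
Qed.

(** By nonzero_subst some power of the base parameter can be substituted
    without loss of nondegeneracy. *)
Lemma nondegenerate_step e t : movable S t -> e t = None -> nondegenerate e ->
  exists m, nondegenerate (set_power e t m).
Proof.
move=> mt et [eb nz]; have /and3P[ut tb _] := mt.
have [m hm] := @nonzero_subst K var (act S) t base_var _ ut isT tb nz.
exists m; split; last by rewrite powers_eval_set.
by rewrite /set_power eq_sym (negbTE tb).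
Qed.

Definition at_powers e (x : scheme) :=
  at_config S iota (to_frac S \o powers e) x.

Lemma powers_config e j : config S (to_frac S \o powers e) j =
  map_mx (to_frac S) (map_mx (powers_eval e) (config S gn j)).
Proof.
rewrite config_to_frac; congr (map_mx _ _); symmetry; apply: geval_lines.
Qed.

Lemma nondegenerate_factors e : nondegenerate e ->
  (forall i j l, ~~ cnc i j l ->
    powers_eval e (br (config S gn i) (config S gn j) (config S gn l)) != 0) /\
  forall p, powers e (inl (inr (inl (p, true)))) != 0.
Proof.
case=> _; rewrite rmorphM mulf_eq0 negb_or !rmorph_prod => /andP[].
move=> /prodf_neq0 h /prodf_neq0 h'; split=> [i j l|p]; first exact: (h (i, j, l)).
by move: (h' p isT); congr (_ != 0); apply: geval_gen.
Qed.

Lemma nondegenerate_scale e p : nondegenerate e ->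
  to_frac S (powers e (inl (inr (inl (p, true))))) != 0.
Proof. by move/nondegenerate_factors => [_ h]; apply: to_frac_neq0. Qed.

Lemma nondegenerate_realizes e : nondegenerate e ->
  realizes cnc (config S (to_frac S \o powers e)).
Proof.
move/nondegenerate_factors => [h _] i j l; rewrite !powers_config -map_br -map_br.
case c: (cnc i j l); last by apply/negbTE/to_frac_neq0/h => //; rewrite c.
rewrite (_ : br _ _ _ = 0) ?rmorph0 ?eqxx //.
by apply: framed_lines_conc c => r; apply: star_sat.
Qed.

Lemma nondegenerate_point e : nondegenerate e -> exists x, at_powers e x.
Proof. by move/nondegenerate_realizes; apply: at_config_exists. Qed.

(** Substituting a power for a parameter factors through the earlier
    parameters. *)
Lemma spec_powers e t m x y : movable S t -> e t = None -> e base_var = None ->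
  at_powers e x -> at_powers (set_power e t m) y ->
  spec (set_val x) (set_val y).
Proof.
move=> mt et eb; apply: spec_config => a; rewrite !geval_to_frac.
move=> h; have e0 : powers_eval e a = 0.
  by apply: (@to_frac_inj S); rewrite rmorph0.
have -> : geval (used := act S) (@mpolyC _ K) (powers (set_power e t m)) a =
  subst_gen t (gn base_var ^+ m) (powers_eval e a) by apply: powers_eval_set.
by rewrite e0 !rmorph0.
Qed.

Local Notation sc f := (std_coord (@star_lam n k) (@star_mu n k) (@star_x n k)
  (@star_y n k) (st_z S f) (st_v f)).

Lemma powers_coords e : coords (std_chart (Rel := Rel))
  (mark mrk (config S (to_frac S \o powers e))) (config S (to_frac S \o powers e))
  (sc (to_frac S \o powers e)).
Proof.
have -> : config S (to_frac S \o powers e) =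
    framed_lines (@star_lam n k) (@star_mu n k) (@star_x n k) (@star_y n k)
      (st_z S (to_frac S \o powers e)) (st_v (to_frac S \o powers e)) 1%:M.
  by rewrite /config st_g_to_frac powers_g map_mx1.
exact: std_coords.
Qed.

Lemma readable_variable t : act S t -> (if t is inl (inl _) then false else true) ->
  exists N D : chart_ring K 3 nl, forall f : var -> F S,
    (forall p, f (inl (inr (inl (p, true)))) != 0) ->
    mmap iota (sc f) D != 0 /\ mmap iota (sc f) N = mmap iota (sc f) D * f t.
Proof.
case: t => [[//|p]|o] ut _.
  have [N [D h]] := readable_parameter (@star_used n k) K (inl p).
  by exists N, D => f nz; apply: h.
have [N [D h]] := readable_parameter (@star_used n k) K (inr o).
exists N, D => f nz; have [h1 h2] := h _ iota (st_z S f) (st_v f) nz.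
by split=> //; rewrite h2 /st_z star_value_self.
Qed.

(** A parameter that has become a power of the base parameter satisfies a
    polynomial equation in the chart coordinates, by readable_variable, that
    did not hold before. *)
Lemma spec_powers_strict e t m x y : movable S t -> e t = None ->
  nondegenerate e -> nondegenerate (set_power e t m) ->
  at_powers e x -> at_powers (set_power e t m) y ->
  ~ spec (set_val y) (set_val x).
Proof.
move=> mt et nd nd' dx dy sp; have /and3P[ut tb tg] := mt; have [eb _] := nd.
have [N [D hN]] := readable_variable ut tg.
have [N' [D' hN']] := @readable_variable base_var isT isT.
have cx := powers_coords e; have cy := powers_coords (set_power e t m).
have xw : in_chart (std_chart (Rel := Rel)) (set_val x).
  by apply/(in_chartP dx); exists (sc (to_frac S \o powers e)).
have [_ sub] := sp _ xw.
pose p := N * D' ^+ m - D * N' ^+ m.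
have pE e' : nondegenerate e' -> exists2 c, c != 0 &
    mmap iota (sc (to_frac S \o powers e')) p =
    c * to_frac S (powers e' t - powers e' base_var ^+ m).
  move=> nde; have nz q := nondegenerate_scale q nde.
  pose M : {rmorphism chart_ring K 3 nl -> F S} :=
    mmap iota (sc (to_frac S \o powers e')).
  have [D0 NE] : M D != 0 /\ M N = M D * to_frac S (powers e' t) := hN _ nz.
  have [D0' NE'] : M D' != 0 /\ M N' = M D' * to_frac S (powers e' base_var) :=
    hN' _ nz.
  exists (M D * M D' ^+ m); first by rewrite mulf_neq0 ?expf_neq0.
  transitivity (M N * M D' ^+ m - M D * M N' ^+ m).
    by rewrite -!rmorphXn -!rmorphM -rmorphB.
  rewrite NE NE' exprMn [in RHS]rmorphB rmorphXn mulrBr.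
  by congr (_ - _); rewrite ?mulrA // mulrAC.
have : prime_at (set_val x) (std_chart (Rel := Rel)) p.
  apply: sub; apply/(prime_atP dy _ cy); have [c _ ->] := pE _ nd'.
  have -> : powers (set_power e t m) t = gn base_var ^+ m.
    by move: tg; rewrite /powers /set_power eqxx; case: (t) => [[]|].
  have -> : powers (set_power e t m) base_var = gn base_var.
    by apply: powers_base; rewrite /set_power eq_sym (negbTE tb).
  by rewrite subrr rmorph0 mulr0.
rewrite (prime_atP dx _ cx); have [c c0 ->] := pE _ nd.
move/eqP; rewrite mulf_eq0 (negbTE c0) orFb => /eqP h.
have /eqP : powers e t - powers e base_var ^+ m = 0.
  by apply: (@to_frac_inj S); rewrite rmorph0.
have -> : powers e t = gn t by move: tg et; rewrite /powers; case: (t) => [[]|] // ? _ ->.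
rewrite (powers_base eb).
by rewrite subr_eq0; apply/negP/gen_neq_exp.
Qed.

Lemma powers_chain s e x : uniq s -> nondegenerate e -> at_powers e x ->
  (forall t, t \in s -> movable S t /\ e t = None) ->
  exists z : nat -> scheme, z 0%N = x /\ forall i, (i < size s)%N ->
    spec (set_val (z i)) (set_val (z i.+1)) /\
    ~ spec (set_val (z i.+1)) (set_val (z i)).
Proof.
elim: s e x => [|t s IH] e x; first by move=> _ _ _ _; exists (fun=> x).
case/andP=> ts us nd dx h; have [mt et] := h t (mem_head _ _).
have [m nd'] := nondegenerate_step mt et nd.
have [y dy] := nondegenerate_point nd'.
have [|z [z0 hz]] := IH _ y us nd' dy.
  move=> t' t's; have [mt' et'] := h t' (mem_behead (s := t :: s) t's).
  split=> //; rewrite /set_power; case: eqP => // tt.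
  by rewrite tt (negbTE ts) in t's.
exists (fun i => if i is i'.+1 then z i' else x); split=> // -[_|i]; last exact: hz.
rewrite z0; have [eb _] := nd.
split; first exact: spec_powers mt et eb dx dy.
exact: spec_powers_strict mt et nd nd' dx dy.
Qed.

(** In the standard frame, the movable parameters are specialized one by one
    to powers of the base parameter; each step is a proper specialization. *)
Lemma star_dim_ge x : at_config S iota (to_frac S \o gn) x ->
  irreducible_chain (@specializations K _ scheme (set_val x)) #|movable S|.
Proof.
move=> dx; have [y dy] := nondegenerate_point nondegenerate_start.
have [t|z [z0 hz]] := powers_chain (enum_uniq (movable S)) nondegenerate_start dy.
  by rewrite mem_enum.
rewrite cardE; apply: chain_of_specializations hz _ => u yu.
apply: spec_trans yu; rewrite z0; apply: spec_config dx dy => a.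
rewrite geval_to_frac geval_id => h.
have -> : a = 0 by apply: (@to_frac_inj S); rewrite rmorph0.
exact: rmorph0.
Qed.

End Family.

(** The nine entries of the frame and the base parameter are the only active
    parameters that are not movable. *)
Lemma movable_card S : (#|act S| <= #|movable S| + 10)%N.
Proof.
pose fixed (o : option ('I_3 * 'I_3)) : var :=
  if o is Some ij then inl (inl ij) else base_var.
rewrite -(cardID (movable S) (act S)) leq_add //.
  by apply/subset_leq_card/fintype.subsetP => t; rewrite !inE => /andP[].
have <- : #|{: option ('I_3 * 'I_3)}| = 10%N by rewrite card_option card_prod !card_ord.
apply: leq_trans (leq_image_card fixed predT).
apply/subset_leq_card/fintype.subsetP => t; case/andP=> nm ut.
suff [o ->] : exists o, t = fixed o by apply: fintype.image_f.
have {}ut : act S t by [].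
have : ~~ movable S t by []; rewrite /movable ut.
have [-> _|_] := eqVneq t base_var; first by exists None.
by case: t {nm ut} => [[ij|p]|o] // _; exists (Some ij).
Qed.

(** Adding j to S frees lambda_j and removes the k + 1 parameters x_jl. *)
Lemma active_card S j : j \notin S -> (#|act (j |: S)%SET| + k <= #|act S|)%N.
Proof.
move=> jS; pose x l : var := inr (Some (inr (j, l, false))).
have xi : injective x by move=> l l' [].
pose B := [set x l | l : 'I_k.+1]%SET.
pose T S' := [set t | act S' t]%SET.
have cT S' : #|T S'| = #|act S'| by rewrite cardsE.
have dis : [disjoint T (j |: S)%SET & B].
  apply/pred0P => t /=; apply/negbTE/negP => /andP[+ /imsetP[l _ tE]].
  by rewrite tE inE /= setU11.
have sub : (T (j |: S)%SET :|: B \subset inr (Some (inl j)) |: T S)%SET.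
  apply/fintype.subsetP => t; rewrite !inE => /orP[|/imsetP[l _ ->]]; last first.
    by rewrite /= jS ?orbT.
  case: t => [t|[[i|[[i l] b]]|]] //=; rewrite ?orbT // !inE.
    by case/orP=> [/eqP ->|->]; rewrite ?eqxx ?orbT.
  by rewrite negb_or => /andP[/andP[_ ->] ->]; rewrite ?orbT.
have := subset_leq_card sub; rewrite cardsU disjoint_setI0 // cards0 subn0.
rewrite card_imset // card_ord cardsU1 !cT => h.
by have := leq_trans h (leq_add (leq_b1 _) (leqnn _)); rewrite addnS add1n ltnS.
Qed.

End StarDimension.

(** For k = 11 the dimension of the component of S is between the number of
    its active parameters minus 10 and that number. Enlarging S by one element
    removes at least 11 parameters, so the components of the initial segments
    have strictly decreasing dimensions. *)
Lemma many_components (K : fieldType) (n : nat) :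
  exists (d : nat) (P : dot_array 3 d),
      [/\ (0 < d)%N, permutation_array P
        & exists (Z : 'I_n.+1 -> set (perm_array_scheme K P)) (delta : 'I_n.+1 -> nat),
            [/\ forall i, irreducible_component (Z i),
                forall i, has_dim (Z i) (delta i)
              & injective delta]].
Proof.
(* The bounds on each dimension differ by 10, so a drop of k = 11 suffices. *)
pose k := 11%N; pose act := @star_active n k.
pose F (S : {set 'I_n.+1}) : fieldType := {fraction {mpoly K[#|{: active (act S)}|]}}.
pose fr S : {rmorphism {mpoly K[#|{: active (act S)}|]} -> F S} := @tofrac _.
have inj S : injective (fr S) by move=> a b /eqP; rewrite tofrac_eq => /eqP.
exists _, (star_array n k); split.
- exact: leq_ltn_trans (ltn_ord (enum_rank None)).
- exact: star_permutation_array inj.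
have [eta hE] := generic_points inj.
pose S (i : nat) := [set j : 'I_n.+1 | (j < i)%N]%SET.
have dim (i : 'I_n.+1) : exists m,
    has_dim (@specializations K _ (@star_scheme K n k) (set_val (eta (S i)))) m /\
    (#|movable (k := k) (S i)| <= m <= #|act (S i)|)%N.
  have [r|m h1 h2] := has_dim_between (star_dim_ge inj (hE (S i))) (b := #|act (S i)|).
    by move/(star_dim_le inj hE); rewrite card_sig.
  by exists m.
have [delta hd] := @choice _ _ (fun (i : 'I_n.+1) m => _ /\ _) dim.
have step i : (i < n.+1)%N -> (#|act (S i.+1)| + k <= #|act (S i)|)%N.
  move=> iN; have -> : S i.+1 = (Ordinal iN |: S i)%SET.
    by apply/setP => j; rewrite !inE ltnS leq_eqVlt.
  by apply: active_card; rewrite inE ltnn.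
have far i j : (i < j)%N -> (j <= n)%N -> (#|act (S j)| + k <= #|act (S i)|)%N.
  elim: j => // j IH; rewrite ltnS leq_eqVlt => /orP[/eqP -> jn|ij jn].
    by apply: step; apply: ltnW.
  have := step j (ltnW jn); move/(leq_trans (leq_addr _ _)) => h.
  by apply: leq_trans (IH ij (ltnW jn)); rewrite leq_add2r.
have mono (i j : 'I_n.+1) : (i < j)%N -> (delta j < delta i)%N.
  move=> ij; have [_ /andP[_ uj]] := hd j; have [_ /andP[li _]] := hd i.
  have h := far i j ij (ltn_ord j).
  have h' : (delta j + k <= delta i + 10)%N.
    apply: leq_trans (leq_add uj (leqnn k)) _; apply: leq_trans h _.
    by apply: leq_trans (movable_card _ _) _; rewrite leq_add2r.
  by rewrite -(leq_add2r 10) addSn -addnS.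
have dinj : injective delta.
  move=> i j e; case: (ltngtP i j) => [/mono|/mono|/val_inj//]; by rewrite e ltnn.
exists (fun i : 'I_n.+1 => @specializations K _ (@star_scheme K n k) (set_val (eta (S i)))), delta.
split=> [i|i|]; last exact: dinj.
- exact: (star_component inj hE).
- exact: (hd i).1.
Qed.

Lemma not_equidimensional_scheme (K : fieldType) :
  exists (d : nat) (P : dot_array 3 d),
    [/\ (0 < d)%N, permutation_array P & ~ equidimensional (perm_array_scheme K P)].
Proof.
have [d [P [d0 hP [Z [delta [cZ dZ inj]]]]]] := many_components K 1.
exists d, P; split=> // -[m hm].
have e i : delta i = m := has_dim_unique (dZ i) (hm _ (cZ i)).
by have := inj ord0 ord_max; rewrite !e => /(_ erefl) /(congr1 val).
Qed.

(** * Field-valued points avoiding a multiplicative set *)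

Section AvoidingPoint.
Local Open Scope classical_set_scope.
Variable R : comNzRingType.

Definition is_ideal (I : set R) : Prop :=
  I 0 /\ forall a b c, I b -> I c -> I (a * b + c).

(** Units and inverses are chosen classically, after which the field of
    fractions is available. *)
Lemma domain_in_field (D : comNzRingType) :
  (forall x y : D, x * y = 0 -> (x == 0) || (y == 0)) ->
  exists (L : fieldType) (rho : {rmorphism D -> L}), injective rho.
Proof.
move=> dom.
pose unit (x : D) := `[< exists y, y * x = 1 >].
have /choice[inv0 inv0P] : forall x : D, exists y, unit x -> y * x = 1.
  move=> x; case: (pselect (exists y, y * x = 1)) => [[y e]|no]; first by exists y.
  by exists 0 => /asboolP.
pose inv x := if unit x then inv0 x else x.
have mulV : {in unit, left_inverse 1 inv *%R}.
  by move=> x ux; rewrite /inv [unit x](ux : unit x = true); apply: inv0P.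
have unitP (x y : D) : y * x = 1 -> unit x by move=> e; apply/asboolP; exists y.
have invN : {in [predC unit], inv =1 id}.
  by move=> x; rewrite inE /= /inv => /negbTE; rewrite /in_mem /= => ->.
pose U : comUnitRingType := HB.pack D
  (GRing.ComNzRing_hasMulInverse.Build D mulV unitP invN).
pose V : idomainType := HB.pack (U : Type) U
  (GRing.ComUnitRing_isIntegral.Build U dom).
pose rho : {rmorphism V -> {fraction V}} := @tofrac V.
exists {fraction V}, rho => x y /eqP.
by rewrite (@tofrac_eq V) => /eqP.
Qed.

(** The field of fractions of the quotient ring. *)
Lemma prime_ideal_point (q : set R) : is_ideal q -> ~ q 1 ->
  (forall a b, q (a * b) -> q a \/ q b) ->
  exists (L : fieldType) (rho : {rmorphism R -> L}),
    forall a, rho a = 0 <-> q a.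
Proof.
move=> [q0 qD] q1 qM; pose p : R -> bool := fun x => `[< q x >].
have cl : idealr_closed p.
  split; [exact/asboolP|exact/asboolP|move=> a u v hu hv].
  by apply/asboolP/qD; apply/asboolP.
have pr : prime_idealr_closed p.
  by move=> u v /asboolP/qM[h|h]; apply/orP; [left|right]; apply/asboolP.
pose J : prime_idealr R := HB.pack p (isIdealr.Build R p cl)
  (isPrimeIdealrClosed.Build R p pr).
have [x y|L [rho inj]] := @domain_in_field {ideal_quot J}.
  exact: Quotient.rquot_IdomainAxiom.
pose pi : {rmorphism R -> {ideal_quot J}} := (\pi_({ideal_quot J}))%qT.
have piE a : pi a = 0 <-> q a.
  have -> : q a <-> Quotient.equiv J a 0.
    by rewrite Quotient.equivE subr0; split=> h; apply/asboolP.
  rewrite -(rmorph0 pi); split=> [/eqP|h]; last apply/eqP.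
    by rewrite eqmodE.
  by rewrite eqmodE.
exists L, (rho \o pi) => a; rewrite -piE; split=> [h|/= ->]; last exact: rmorph0.
by apply: inj; rewrite rmorph0.
Qed.

(** By Zorn's lemma there is a maximal ideal among those that contain I and
    avoid T, and it is prime: if it contained a b but neither a nor b, the
    ideals generated by adding a and b would both meet T, and so would their
    product. *)
Lemma avoiding_point (I T : set R) : is_ideal I -> T 1 ->
  (forall a b, T a -> T b -> T (a * b)) -> (forall a, I a -> ~ T a) ->
  exists (L : fieldType) (rho : {rmorphism R -> L}),
    (forall a, I a -> rho a = 0) /\ forall a, T a -> rho a != 0.
Proof.
move=> hI T1 TM IT.
pose good (q : set R) := [/\ is_ideal q, I `<=` q & forall a, q a -> ~ T a].
pose P (q : set R) := q !=set0 -> good q.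
have [F FP tot [x [q Fq qx]]|q [Pq mx]] := @Zorn_bigcup R P.
  have gF r : F r -> r !=set0 -> good r by move=> Fr; apply: FP.
  have gq := gF q Fq (ex_intro _ x qx); split.
  - split=> [|a b c [r Fr rb] [r' Fr' rc]].
      by exists q => //; have [[]] := gq.
    have [sub|sub] := tot r r' Fr Fr'.
      exists r' => //; have [[_ h] _ _] := gF r' Fr' (ex_intro _ c rc).
      by apply: h => //; apply: sub.
    exists r => //; have [[_ h] _ _] := gF r Fr (ex_intro _ b rb).
    by apply: h => //; apply: sub.
  - by move=> a Ia; exists q => //; have [_ h _] := gq; apply: h.
  - by move=> a [r Fr ra]; have [_ _ h] := gF r Fr (ex_intro _ a ra); apply: h.
have [x qx] : q !=set0.
  apply: contrapT => /set0P/negP/negPn/eqP q0; apply: (mx I); last by move=> _; split.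
  rewrite q0; split=> [a []//|sub]; by have := sub 0 hI.1.
have [iq Iq qT] := Pq (ex_intro _ x qx); have [q0 qD] := iq.
pose J b := [set c | exists2 r, True & exists2 y, q y & c = r * b + y].
have JT b : ~ q b -> exists2 c, J b c & T c.
  move=> nqb; apply: contrapT => no; apply: (mx (J b)).
    split=> [y qy|sub]; first by exists 0 => //; exists y; rewrite // mul0r add0r.
    by apply/nqb/sub; exists 1 => //; exists 0; rewrite // mul1r addr0.
  move=> _; split.
  - split; first by exists 0 => //; exists 0; rewrite // mul0r addr0.
    move=> a c d [r _ [y qy ->]] [r' _ [y' qy' ->]].
    exists (a * r + r') => //; exists (a * y + y'); first exact: qD.
    by ring.
  - by move=> a /Iq qa; exists 0 => //; exists a; rewrite // mul0r add0r.
  - by move=> a Ja Ta; apply: no; exists a.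
have qM a b : q (a * b) -> q a \/ q b.
  move=> qab; have [qa|nqa] := pselect (q a); first by left.
  right; apply: contrapT => nqb.
  have [c [r _ [y qy cE]] Tc] := JT a nqa.
  have [d [r' _ [y' qy' dE]] Td] := JT b nqb.
  apply: (qT (c * d)); last exact: TM.
  have -> : c * d = (r * r') * (a * b) + ((r * a) * y' + ((r' * b + y') * y + 0)).
    by rewrite cE dE; ring.
  by apply: (qD) => //; apply: (qD) => //; apply: qD.
have q1 : ~ q 1 by move=> /qT.
have [L [rho hrho]] := prime_ideal_point iq q1 qM.
exists L, rho; split=> [a /Iq qa|a Ta]; first exact/hrho.
by apply/eqP => /hrho /qT.
Qed.

End AvoidingPoint.

(** * The minors defining an arrangement scheme *)

Section Minors.
Variables (K : fieldType) (d : nat) (conc : 'I_d -> 'I_d -> 'I_d -> bool).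
Variable mu : 'I_d -> 'I_d.
Hypothesis Hc : pencils conc mu.
Variables (w : chart 3 d) (R : comNzRingType) (iota : {rmorphism K -> R}).
Variable u : 'I_#|{: Defs.coord 3 d}| -> R.

Local Notation ev := (mmap iota u : {rmorphism chart_ring K 3 d -> R}).
Local Notation l := (cln w u).
Local Notation X := (fun i => 'X_i : chart_ring K 3 d).

(** The inverse of the j-th chart matrix. Its column 2 is the line of the
    flag, and its column 1 is a second line through the point of the flag. *)
Definition dual_basis j : 'M[R]_3 := map_mx ev (invmx (chart_mx w X j)).

Lemma chart_mx_eval j : map_mx ev (chart_mx w X j) = chart_mx w u j.
Proof.
rewrite chart_mx_map; congr (chart_mx _ _ _).
by apply/funext => i; apply: mmap_XU.
Qed.

Lemma dual_basisV j : chart_mx w u j *m dual_basis j = 1%:M.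
Proof.
by rewrite -chart_mx_eval -map_mxM mulmxV ?chart_mx_unit // map_mx1.
Qed.

Lemma dual_basisK j : dual_basis j *m chart_mx w u j = 1%:M.
Proof.
by rewrite -chart_mx_eval -map_mxM mulVmx ?chart_mx_unit // map_mx1.
Qed.

Lemma dual_basis_line j a : dual_basis j a i2 = l j 0 a.
Proof.
have e : chart_mx w u j *m (l j)^T = \col_i (i == i2)%:R.
  apply/matrixP => i c; rewrite !mxE -(row_chart_cln w u j i) dot_sum.
  by apply: eq_bigr => k _; rewrite !mxE.
have h : (l j)^T = dual_basis j *m (\col_i (i == i2)%:R).
  by rewrite -e mulmxA dual_basisK mul1mx.
transitivity ((dual_basis j *m (\col_i (i == i2)%:R : 'cV[R]_3)) a 0).
  by rewrite [RHS]mxE sum3 ![(\col_i _) _ _]mxE /= !mulr0 mulr1 !add0r.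
by rewrite -h mxE.
Qed.

Lemma dual_basis_point j (k : 'I_3) : (0 < k)%N ->
  dot (cpt w u j) (\row_a dual_basis j a k) = 0.
Proof.
move=> k0; have := congr1 (fun M : 'M_3 => M i0 k) (dual_basisV j).
rewrite !mxE (_ : (i0 == k) = false) ?mulr0n; last by apply/negbTE; case: k k0 => [[]].
by move=> h; rewrite dot_sum -[RHS]h; apply: eq_bigr => c _; rewrite !mxE.
Qed.

Lemma minor_eval m (row : 'I_m -> 'I_3) (col : 'I_m -> 'I_d * 'I_3) :
  ev (\det (\matrix_(a, b) invmx (chart_mx w X (col b).1) (row a) (col b).2)) =
  \det (\matrix_(a, b) dual_basis (col b).1 (row a) (col b).2).
Proof.
by rewrite -det_map_mx; congr (\det _); apply/matrixP => a b; rewrite !mxE.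
Qed.

(** For the position that is 1 at the three lines and 2 elsewhere the rank is
    1, and the determinant of the three lines is one of the minors. *)
Lemma minors_conc :
  (forall f, minor_equation K (pattern_array conc mu) w f -> ev f = 0) ->
  forall i j k, conc i j k -> br (l i) (l j) (l k) = 0.
Proof.
move=> h i j k c.
have [<-|ij] := eqVneq i j; first exact: br_same.
pose x : position 3 d := [ffun a => if a \in [set i; j; k]%SET then i1 else i2].
have Jx : line_set mu x = [set i; j; k]%SET.
  apply/setP => a; rewrite inE ffunE; case: ifP => // aN /=.
  by apply/existsP => -[b /andP[_]]; rewrite ffunE; case: ifP.
pose col (b : 'I_3) := (if b == i0 then i else if b == i1 then j else k, i2).
have := h (\det (\matrix_(a, b) invmx (chart_mx w X (col b).1) a (col b).2)).
rewrite (minor_eval id col) => e; rewrite -[RHS]e.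
  rewrite -det_tr br_mxE; congr (br _ _ _); apply/rowP => a;
  by rewrite -dual_basis_line; symmetry; rewrite 3!mxE.
exists x, 1%N, id, col; split=> // [|b].
  have r1 : lines_rank conc (line_set mu x) = 1%N.
    rewrite (lines_rank2 Hc (i := i) (j := j)) ?Jx ?inE ?eqxx ?orbT //.
    suff -> : [forall k0 in [set i; j; k]%SET, conc i j k0] by [].
    apply/forall_inP => a; rewrite !inE => /orP[/orP[]|] /eqP -> //.
      exact: conc12 Hc _ _.
    exact: conc22 Hc _ _.
  by move=> a; rewrite -[RHS]r1; apply: rank_below.
have cb : (col b).1 \in [set i; j; k]%SET.
  by rewrite !inE /col /=; case: (b == i0); [|case: (b == i1)]; rewrite eqxx ?orbT.
by rewrite ffunE cb.
Qed.

(** The columns of a minor for the position x are lines through the common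
    points of the lines selected by x. If the rank is 3 there are no such
    columns, and if it is 2 they are all equal; if it is 1 they are orthogonal
    to the meet of two of the lines, which is not a zero divisor by
    assumption; if it is 0 two of the four rows of the minor coincide. *)
Lemma conc_minors f : (0 < d)%N ->
  (forall j, exists2 s : R, s * s = 1 & cpt w u j = s *: cross (l j) (l (mu j))) ->
  (forall i j k, conc i j k -> br (l i) (l j) (l k) = 0) ->
  (forall i j, i != j -> exists c, forall a, cross (l i) (l j) 0 c * a = 0 -> a = 0) ->
  minor_equation K (pattern_array conc mu) w f -> ev f = 0.
Proof.
move=> d0 hm hc reg [x [r [row [col [rk xc ->]]]]].
rewrite minor_eval; set J := line_set mu x.
have rE : r = lines_rank conc J.
  by rewrite -(rk (Ordinal d0)); apply: rank_below.
have inJ b : (col b).1 \in J by rewrite inE (leq_trans (xc b)) // -ltnS ltn_ord.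
pose C b : 'rV[R]_3 := \row_a dual_basis (col b).1 a (col b).2.
have CP b : C b = l (col b).1 \/
    mu (col b).1 \in J /\ dot (cpt w u (col b).1) (C b) = 0.
  have [k1|k1] := ltnP 1 (col b).2.
    left; rewrite /C (_ : (col b).2 = i2); last first.
      by apply/val_inj/eqP; rewrite eqn_leq k1 -ltnS ltn_ord.
    by apply/rowP => a; rewrite mxE dual_basis_line.
  have x0 : x (col b).1 = 0%N :> nat.
    by apply/eqP; rewrite -leqn0 -ltnS (leq_trans (xc b)).
  right; split; last by apply: dual_basis_point; apply: leq_ltn_trans (xc b).
  by rewrite inE; apply/orP; right; apply/existsP; exists (col b).1; rewrite x0 !eqxx.
have entry_C a b : (\matrix_(a, b) dual_basis (col b).1 (row a) (col b).2) a b =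
    C b 0 (row a) by rewrite [LHS]mxE [RHS]mxE.
set M := \matrix_(a, b) _ in entry_C *.
case: (set_0Vmem J) => [J0|[i iJ]]; first by have := inJ ord0; rewrite J0 inE.
have [Ji|] := eqVneq J [set i]%SET.
  have r2 : r = 2%N by rewrite rE Ji lines_rank1.
  have Ci b : C b = l i.
    have ji : (col b).1 = i by apply/eqP; have := inJ b; rewrite Ji inE.
    have [-> //|[+ _]] := CP b; first by rewrite ji.
    by rewrite ji Ji inE (negbTE (mark_neq Hc i)).
  rewrite -det_tr; pose b1 : 'I_(3 - r).+1 := cast_ord (congr1 (fun r => (3 - r).+1) (esym r2)) ord_max.
  apply: (determinant_alternate (i1 := ord0) (i2 := b1)).
    by rewrite -(inj_eq val_inj).
  by move=> a; rewrite mxE [RHS]mxE !entry_C !Ci.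
move=> Ji; have {Ji} [j jJ ij] : exists2 j, j \in J & i != j.
  have /set0Pn[j] : (J :\ i != finset.set0)%SET.
    by apply: contraNneq Ji => J0; rewrite -{1}(finset.setD1K iJ) J0 finset.setU0.
  by rewrite finset.in_setD1 => /andP[ji jJ]; exists j; rewrite 1?eq_sym.
have := lines_rank2 Hc iJ jJ ij; rewrite -rE.
case: forall_inP => [cJ r1|_ r0]; last first.
  have : ~~ injectiveb row.
    apply/negP => /injectiveP/leq_card; rewrite !card_ord.
    by move: (r0 : r = 0%N) => ->.
  case/injectivePn => a [a' aa e].
  by apply: (determinant_alternate aa) => b; rewrite !entry_C e.
set q := cross (l i) (l j); have qC b : dot q (C b) = 0.
  have ql k : k \in J -> dot q (l k) = 0 by move=> kJ; apply/hc/cJ.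
  have [->|[mJ pc]] := CP b; first exact/ql/inJ.
  have [s ss pE] := hm (col b).1.
  have c1 := cpt0 w u (col b).1; set c := ((w _)^-1 i0)%g in c1.
  have -> : q = q 0 c *: cpt w u (col b).1.
    apply/rowP => k; rewrite [RHS]mxE -[LHS]mulr1 -c1 pE [X in _ * X]mxE.
    rewrite [X in _ = _ * X]mxE mulrCA [RHS]mulrCA; congr (_ * _).
    by apply: cross_parallel; [exact/ql/inJ|exact: ql].
  have dotZ (t : R) (v v' : 'rV[R]_3) : dot (t *: v) v' = t * dot v v'.
    by rewrite /dot !mxE; ring.
  by rewrite dotZ pc mulr0.
move: (r1 : r = 1%N) => r1'; clear rE rk; subst r.
have [c regc] := reg i j ij.
pose N : 'M[R]_3 := \matrix_(b, a) C b 0 a.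
pose S : 'M[R]_3 := \matrix_(a, k) (row a == k)%:R.
have NT k b : N^T k b = C b 0 k by rewrite [LHS]mxE [LHS]mxE.
have -> : M = S *m N^T.
  apply/matrixP => a b; rewrite entry_C [RHS]mxE (bigD1 (row a)) //= big1 => [|k ka].
    by rewrite NT [S a _]mxE eqxx mul1r addr0.
  by rewrite [S a k]mxE eq_sym (negbTE ka) mul0r.
have rN b : matrix.row b N = C b by apply/rowP => k; rewrite [LHS]mxE [LHS]mxE.
rewrite det_mulmx det_tr (br_mxE N) !rN (regc _ (br_common_zero c (qC i0) (qC i1) (qC i2))).
exact: mulr0.
Qed.

End Minors.

(** * A scheme that is not reduced *)

(** The ring A[epsilon] with epsilon^2 = 0; the pair (a, b) stands for a + b
    epsilon. *)
Definition dual_number (A : comNzRingType) : Type := (A * A)%type.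

Section DualNumbers.
Variable A : comNzRingType.
Implicit Types a b c : dual_number A.

HB.instance Definition _ := GRing.Zmodule.on (dual_number A).

Definition dual_mul a b : dual_number A := (a.1 * b.1, a.1 * b.2 + a.2 * b.1).

Lemma dual_mulA : associative dual_mul.
Proof. by move=> a b c; congr (_, _) => /=; ring. Qed.

Lemma dual_mulC : commutative dual_mul.
Proof. by move=> a b; congr (_, _) => /=; ring. Qed.

Lemma dual_mul1 : left_id ((1, 0) : dual_number A) dual_mul.
Proof. by case=> a b; congr (_, _) => /=; ring. Qed.

Lemma dual_mulD : left_distributive dual_mul +%R.
Proof. by move=> a b c; congr (_, _) => /=; ring. Qed.

Lemma dual_1n0 : ((1, 0) : dual_number A) != 0.
Proof. by apply/eqP => -[/eqP]; rewrite oner_eq0. Qed.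

HB.instance Definition _ := GRing.Zmodule_isComNzRing.Build (dual_number A)
  dual_mulA dual_mulC dual_mul1 dual_mulD dual_1n0.

Definition dual_value (a : dual_number A) : A := a.1.

Lemma dual_value_zmod : zmod_morphism dual_value. Proof. by []. Qed.
Lemma dual_value_monoid : monoid_morphism dual_value. Proof. by []. Qed.
HB.instance Definition _ := GRing.isZmodMorphism.Build (dual_number A) A dual_value
  dual_value_zmod.
HB.instance Definition _ := GRing.isMonoidMorphism.Build (dual_number A) A dual_value
  dual_value_monoid.

Definition dual_const (a : A) : dual_number A := (a, 0).

Lemma dual_const_zmod : zmod_morphism dual_const.
Proof. by move=> a b; congr (_, _); rewrite subr0. Qed.
Lemma dual_const_monoid : monoid_morphism dual_const.
Proof. by split=> // a b; congr (_, _) => /=; ring. Qed.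
HB.instance Definition _ := GRing.isZmodMorphism.Build A (dual_number A) dual_const
  dual_const_zmod.
HB.instance Definition _ := GRing.isMonoidMorphism.Build A (dual_number A) dual_const
  dual_const_monoid.

End DualNumbers.

Lemma dual_regular (A : idomainType) (a b : dual_number A) :
  dual_value a != 0 -> a * b = 0 -> b = 0.
Proof.
case: a b => [a a'] [b b'] /= a0 [/eqP]; rewrite mulf_eq0 (negbTE a0) => /eqP -> /=.
by rewrite mulr0 addr0 => /eqP; rewrite mulf_eq0 (negbTE a0) => /eqP ->.
Qed.

(** The ratios None, Some false and Some true stand for lambda, mu and y; the
    only relation is {lambda, lambda} = {mu, y}, that is mu = lambda + t and
    y = lambda - t with t^2 = 0. *)
Section DoublePoint.
Variable K : fieldType.

Local Notation Om := (option bool).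
Local Notation Rel := unit.
Local Notation plc := (placement Om Rel).

Definition dbl_lam (r : Rel) : Om := None.
Definition dbl_mu (r : Rel) : Om := Some false.
Definition dbl_y (r : Rel) : Om := Some true.

Lemma dbl_used w : exists r, [|| dbl_lam r == w, dbl_mu r == w, dbl_lam r == w
  | dbl_y r == w].
Proof. by exists tt; case: w => [[]|]. Qed.

Local Notation sat := (satisfies dbl_lam dbl_mu dbl_lam dbl_y).
Local Notation nl := #|{: wline (vert Rel) (tri Rel)}|.
Local Notation cnc := (conc dbl_lam dbl_mu dbl_lam dbl_y).
Local Notation mrk := (@marking Rel tt).
Local Notation arr := (ratio_array dbl_lam dbl_mu dbl_lam dbl_y tt).
Local Notation rlines := (ratio_lines dbl_lam dbl_mu dbl_lam dbl_y).
Local Notation flines := (framed_lines dbl_lam dbl_mu dbl_lam dbl_y).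

(** Eliminating y gives (lambda - mu)^2 = 0. *)
Lemma double_solution (R : idomainType) (z : Om -> R) : (forall r, sat z r) ->
  z None = z (Some false).
Proof.
move=> /(_ tt) []; rewrite /dbl_lam /dbl_mu /dbl_y.
set a := z None; set m := z (Some false); set y := z (Some true) => e1 e2.
have yE : y = 2%:R * a - m.
  have -> : y = (m * y - (1 - m) * (1 - y)) + 1 - m by ring.
  by rewrite -e1 -e2; ring.
have : (a - m) ^+ 2 == 0.
  apply/eqP; transitivity (a * a - m * y); first by rewrite yE; ring.
  by rewrite e1 subrr.
by rewrite expf_eq0 subr_eq0 => /eqP.
Qed.

Definition dbl_var : finType := option plc.
Local Notation used := (xpredT : pred dbl_var).
Local Notation gn := (gen K used).
Local Notation A := {mpoly K[#|{: active used}|]}.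
Local Notation D := (dual_number A).

(** At the point considered the three ratios have one common value, a free
    variable. *)
Definition dbl_z (o : Om) : A := gn None.
Definition dbl_v (p : plc) : A := gn (Some p).

Lemma double_realizes i j k :
  (br (rlines dbl_z dbl_v i) (rlines dbl_z dbl_v j) (rlines dbl_z dbl_v k) == 0)
  = cnc i j k.
Proof.
apply: ratio_line_realizes => [r|p|p|w]; first by [].
- pose th : {rmorphism A -> A} :=
    geval (used := used) (@mpolyC _ K) (fun t => gn t + (t == Some p)%:R).
  have thE t : th (gn t) = gn t + (t == Some p)%:R by apply: geval_gen.
  by exists th; split=> [o|p']; [rewrite -[RHS]addr0; apply: thE|apply: thE].
- exact: gen_neq0.
case: w => [o|[r f]]; first by rewrite gen_neq0 ?gen_neq1.
by apply: flip_product_nz; rewrite ?gen_neq0 ?gen_neq1 ?gen_flip_product.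
Qed.

(** The tangent vector mu = lambda + epsilon, y = lambda - epsilon; it
    satisfies the relation because epsilon^2 = 0. *)
Definition tan_z (o : Om) : D :=
  (gn None, if o is Some b then if b then -1 else 1 else 0).
Definition tan_v (p : plc) : D := dual_const (dbl_v p).

Lemma tan_sat r : sat tan_z r.
Proof. by split; congr (_, _) => /=; ring. Qed.

Lemma rlines1 (R : comNzRingType) (z : Om -> R) v :
  flines z v 1%:M = rlines z v.
Proof. by apply/funext => i; rewrite /framed_lines mulmx1. Qed.

Local Notation chrt := (std_chart (Rel := Rel)).
Local Notation tan_u := (std_coord dbl_lam dbl_mu dbl_lam dbl_y tan_z tan_v).
Local Notation iotaD := (@dual_const A \o @mpolyC _ K).
Local Notation phi := (mmap iotaD tan_u : {rmorphism chart_ring K 3 nl -> D}).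

Variables (L : fieldType) (fr : {rmorphism A -> L}).
Hypothesis fr_inj : injective fr.

Local Notation iota := (fr \o @mpolyC _ K).
Local Notation val := (fr \o @dual_value A).
Local Notation lines := (rlines (fr \o dbl_z) (fr \o dbl_v)).

Lemma tan_lines_value i : map_mx val (rlines tan_z tan_v i) = lines i.
Proof. exact: (ratio_line_map dbl_lam dbl_mu dbl_lam dbl_y val). Qed.

Lemma lines_map i : map_mx fr (rlines dbl_z dbl_v i) = lines i.
Proof. exact: ratio_line_map. Qed.

Lemma lines_realize : realizes cnc lines.
Proof.
move=> i j k; rewrite -!lines_map -map_br -(rmorph0 fr) (inj_eq fr_inj).
exact: double_realizes.
Qed.

Lemma double_pencils : pencils cnc mrk.
Proof. exact: conc_pencils lines_realize. Qed.

Lemma lines_gt0 : (0 < nl)%N.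
Proof. exact: leq_ltn_trans (ltn_ord (enum_rank None)). Qed.

(** The value at the point of the meet of two lines is not zero, because the
    arrangement at the point has distinct lines. *)
Lemma tan_regular i j : i != j -> exists c, forall a : D,
  cross (rlines tan_z tan_v i) (rlines tan_z tan_v j) 0 c * a = 0 -> a = 0.
Proof.
move=> ij; have := realizes_cross double_pencils lines_realize ij.
case/row3_neq0 => c hc; exists c => a; apply: dual_regular.
apply: contraNneq hc => h.
have e : cross (lines i) (lines j) 0 c =
    fr (dual_value (cross (rlines tan_z tan_v i) (rlines tan_z tan_v j) 0 c)).
  by rewrite -!tan_lines_value -(map_cross val) [LHS]mxE.
by rewrite e h rmorph0.
Qed.

Lemma tan_minors f : minor_equation K arr chrt f -> phi f = 0.
Proof.
apply: (conc_minors double_pencils) => [|j|i j k c|i j ij].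
- exact: lines_gt0.
- have [s ss e] := std_mark dbl_lam dbl_mu dbl_lam dbl_y tt tan_z tan_v j.
  by exists s; [exact: ss|rewrite !std_cln; exact: e].
- by rewrite !std_cln -!rlines1; apply: framed_lines_conc c; apply: tan_sat.
- by rewrite !std_cln; apply: tan_regular.
Qed.

(** So the tangent vector is tangent to the scheme. *)
Lemma tan_ideal f : generated_ideal (minor_equation K arr chrt) f -> phi f = 0.
Proof.
case=> s [hs ->]; elim: s hs => [|c s IH] hs; first by rewrite big_nil rmorph0.
rewrite big_cons.
transitivity (phi c.1 * phi c.2 + phi (\sum_(t <- s) t.1 * t.2)).
  by rewrite rmorphD rmorphM.
rewrite IH => [|t ts]; last by apply: hs; rewrite inE ts orbT.
by rewrite (tan_minors (hs c (mem_head _ _))) mulr0 addr0.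
Qed.

(** The bracket difference of lambda and mu, which is nilpotent but not zero
    near the point. *)
Definition double_function : chart_ring K 3 nl :=
  bracket_difference dbl_lam dbl_mu dbl_lam dbl_y tt (generic_line K chrt)
    (inl None) (inl (Some false)).

Lemma tan_function : phi double_function =
  dual_const (dbl_v (inl (inr (inl None), true)) *
              dbl_v (inl (inr (inl (Some false)), true))) * (0, -1).
Proof.
transitivity (bracket_difference dbl_lam dbl_mu dbl_lam dbl_y tt
    (flines tan_z tan_v 1%:M) (inl None) (inl (Some false))).
  have <- : (fun j => map_mx phi (generic_line K chrt j)) = flines tan_z tan_v 1%:M.
    by apply/funext => j; rewrite generic_line_eval std_cln rlines1.
  exact: bracket_difference_map.
transitivity (\det (1%:M : 'M[D]_3) ^+ 4 *
    tan_v (inl (inr (inl None), true)) * tan_v (inl (inr (inl (Some false)), true)) *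
    (tan_z None - tan_z (Some false))); first exact: (bracket_difference_model dbl_used).
rewrite det1 expr1n mul1r /tan_v -rmorphM; congr (_ * _).
by rewrite -[LHS]/((gn None - gn None, 0 - 1) : D) subrr sub0r.
Qed.

Variable x : perm_array_scheme K arr.
Hypothesis defx : defines (set_val x) iota (mark mrk lines) lines.

Lemma double_coords : coords chrt (mark mrk lines) lines (val \o tan_u).
Proof.
move=> j; have [s ss e] := std_mark dbl_lam dbl_mu dbl_lam dbl_y tt tan_z tan_v j.
have vs : val s * val s = 1 by rewrite -rmorphM ss rmorph1.
exists (val s), 1; split.
- by apply: contra_eq_neq vs => ->; rewrite mul0r eq_sym oner_neq0.
- exact: oner_neq0.
- rewrite -cpt_map e (map_mxZ val) scalerA vs scale1r mark_map.
  by congr (mark _ _ _); apply/funext => i; symmetry; apply: tan_lines_value.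
by rewrite scale1r -cln_map std_cln tan_lines_value.
Qed.

Lemma double_in_chart : in_chart chrt (set_val x).
Proof. by apply/(in_chartP defx); exists (val \o tan_u); apply: double_coords. Qed.

Lemma double_primeP f : prime_at (set_val x) chrt f <-> val (phi f) = 0.
Proof.
rewrite (prime_atP defx f double_coords).
suff -> : mmap iota (val \o tan_u) f = val (phi f) by [].
symmetry; apply: (mmap_unique (phi := val \o phi)) => [c|i].
  by rewrite -[LHS]/(val (phi c%:MP)) (_ : phi c%:MP = iotaD c) //; apply: mmapC.
by congr (val _); apply: mmap_XU.
Qed.

(** Multiplied by a function that does not vanish at the point, the bracket
    difference of lambda and mu still takes a nonzero multiple of epsilon as
    its value on the tangent vector. *)
Lemma double_function_nonzero : ~ zero_germ arr (set_val x) chrt double_function.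
Proof.
case=> s ns /tan_ideal; rewrite rmorphM tan_function => h.
have s0 : dual_value (phi s) != 0.
  by apply/eqP => h0; apply/ns/double_primeP; rewrite /= h0 rmorph0.
have /(congr1 snd) := dual_regular s0 h.
rewrite -[LHS]/(_ * _ * -1 + 0 * 0) mulr0 addr0 mulrN1 => /eqP.
by rewrite oppr_eq0 mulf_eq0 /dbl_v !(negbTE (gen_neq0 _ _)).
Qed.

(** If no power vanished near the point, then by avoiding_point the equations
    of the scheme would have a field-valued solution at which this function
    and all functions not vanishing at the point are nonzero. This solution is
    an arrangement with the prescribed concurrent triples, and double_solution
    gives lambda = mu on it, so that the function is zero there. *)
Lemma double_function_nilpotent : exists m,
  zero_germ arr (set_val x) chrt (double_function ^+ m).
Proof.
apply: contrapT => no; set p := prime_at (set_val x) chrt.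
pose I := generated_ideal (minor_equation K arr chrt).
pose T := [set t | exists s m, ~ p s /\ t = s * double_function ^+ m]%classic.
have hI : is_ideal I.
  split=> [|a b c [s [hs ->]] [s' [hs' ->]]]; first by exists [::]; rewrite big_nil.
  exists ([seq (a * t.1, t.2) | t <- s] ++ s'); split=> [t|].
    by rewrite mem_cat => /orP[/mapP[t' /hs ? ->]|/hs'].
  rewrite big_cat big_map mulr_sumr; congr (_ + _).
  by apply: eq_bigr => t _; rewrite mulrA.
have p1 : ~ p 1 by apply: prime_at_proper.
have T1 : T 1 by exists 1, 0%N; rewrite expr0 mulr1.
have TM a b : T a -> T b -> T (a * b).
  case=> s [m [ns ->]] [s' [m' [ns' ->]]]; exists (s * s'), (m + m')%N.
  split; first by case/prime_at_prime.
  by rewrite exprD mulrACA.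
have IT a : I a -> ~ T a.
  by move=> Ia [s [m [ns e]]]; apply: no; exists m, s; rewrite // -e.
have [L' [rho [rI rT]]] := avoiding_point hI T1 TM IT.
pose iota' := rho \o @mpolyC _ K : {rmorphism K -> L'}.
pose u' i := rho 'X_i.
have rhoE f : mmap iota' u' f = rho f by symmetry; apply: mmap_unique.
pose l j := cln chrt u' j.
have lE j : map_mx rho (generic_line K chrt j) = l j by apply: cln_map.
have rl : realizes cnc l.
  move=> i j k; case c: (cnc i j k).
    apply/eqP; apply: (minors_conc double_pencils (iota := iota')) c => f hf.
    rewrite [LHS]rhoE; apply: rI; exists [:: (1, f)]; split.
      by move=> t; rewrite inE => /eqP ->.
    by rewrite big_seq1 mul1r.
  apply/negbTE; rewrite -!lE -map_br; apply: rT.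
  exists (br (generic_line K chrt i) (generic_line K chrt j) (generic_line K chrt k)), 0%N.
  split; last by rewrite expr0 mulr1.
  move/double_primeP; have pE i' : map_mx phi (generic_line K chrt i') =
      rlines tan_z tan_v i' by rewrite generic_line_eval std_cln.
  rewrite -[LHS]/(val _) map_br !pE map_br !tan_lines_value => /eqP.
  by rewrite lines_realize c.
have [z [v [g [s [sz g0 ls]]]]] := scheme_extraction dbl_used (tt : Rel) rl.
have zE := double_solution sz.
have : rho double_function != 0.
  by apply: rT; exists 1, 1%N; rewrite expr1 mul1r.
have -> : rho double_function = bracket_difference dbl_lam dbl_mu dbl_lam dbl_y tt
    (fun j => s j *: flines z v g j) (inl None) (inl (Some false)).
  have <- : l = fun j => s j *: flines z v g j.
    by apply/funext => j; have [] := ls j.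
  have <- : (fun j => map_mx rho (generic_line K chrt j)) = l by apply/funext.
  exact: bracket_difference_map.
rewrite bracket_difference_scale (bracket_difference_model dbl_used).
have -> : ratio_value dbl_lam dbl_lam z (inl None) =
    ratio_value dbl_lam dbl_lam z (inl (Some false)) := zE.
by rewrite subrr !mulr0 eqxx.
Qed.

Lemma double_not_reduced : ~ perm_array_scheme_reduced K arr.
Proof.
move=> red; have [m hm] := double_function_nilpotent.
exact/double_function_nonzero/(red _ (set_valP x) _ double_in_chart _ m hm).
Qed.

End DoublePoint.

Lemma nonreduced_scheme (K : fieldType) : exists (d : nat) (P : dot_array 3 d),
  [/\ (0 < d)%N, permutation_array P & ~ perm_array_scheme_reduced K P].
Proof.
pose A := {mpoly K[#|{: active (xpredT : pred dbl_var)}|]}.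
pose fr : {rmorphism A -> {fraction A}} := @tofrac A.
have inj : injective fr by move=> a b /eqP; rewrite tofrac_eq => /eqP.
have [x dx] := scheme_point_exists tt (fr \o @mpolyC _ K) (lines_realize inj).
exists _, (ratio_array dbl_lam dbl_mu dbl_lam dbl_y tt); split.
- exact: lines_gt0.
- exact: pattern_permutation_array (double_pencils inj).
- exact: double_not_reduced inj x dx.
Qed.

Theorem mainTheorem8 (K : fieldType) :
  (forall N : nat, (0 < N)%N ->
    exists (d : nat) (P : dot_array 3 d),
      [/\ (0 < d)%N, permutation_array P
        & exists (Z : 'I_N -> set (perm_array_scheme K P)) (delta : 'I_N -> nat),
            [/\ forall i, irreducible_component (Z i),
                forall i, has_dim (Z i) (delta i)
              & injective delta]]) /\
  (exists (d : nat) (P : dot_array 3 d),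
      [/\ (0 < d)%N, permutation_array P & ~ perm_array_scheme_reduced K P]) /\
  (exists (d : nat) (P : dot_array 3 d),
      [/\ (0 < d)%N, permutation_array P
        & ~ equidimensional (perm_array_scheme K P)]).
Proof.
split; first by case=> // n _; apply: many_components.
split; [exact: nonreduced_scheme|exact: not_equidimensional_scheme].
Qed.
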